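(* Let $\mathbf{a}=(a_S)_{S\subseteq[n]}\in\mathbb{R}^{2^n}$ with $a_\emptyset=1$. There exists an $n\times n$ Hermitian matrix over $\mathbb{C}$ whose vector of principal minors is $\mathbf{a}$ if and only if for every $\gamma\in\mathrm{SL}_2(\mathbb{R})^n\rtimes S_n$, writing $\mathbf{a}'=\gamma\cdot\mathbf{a}$: (i) $a'_{1}a'_{2}-a'_{\emptyset}a'_{12}\geq 0$; (ii) $\mathrm{HypDet}(\mathbf{a}')\leq 0$; and (iii) $\mathbf{a}'$ satisfies the three degree-12 equations stating that the restrictions of $B_{x_4}\big(\mathrm{Discr}_{x_3}(\Delta_{12}f_{\mathbf{a}'})\big)$, $C_{x_4}\big(\mathrm{Discr}_{x_3}(\Delta_{12}f_{\mathbf{a}'})\big)$ and $D_{x_4}\big(\mathrm{Discr}_{x_3}(\Delta_{12}f_{\mathbf{a}'})\big)$ to $x_5=\cdots=x_n=0$ are all zero.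
   Context: $[n]=\{1,\dots,n\}$. The principal minor of $A$ indexed by $S$ is the determinant $A_S$ of the submatrix with rows and columns $S$, $A_\emptyset=1$. Subscripts such as $a_{12}$ abbreviate $a_{\{1,2\}}$. To $\mathbf{a}$ associate the multiaffine polynomial $f_{\mathbf{a}}=\sum_{S\subseteq[n]}a_S\prod_{i\in[n]\setminus S}x_i$. The group $\mathrm{SL}_2(\mathbb{R})^n\rtimes S_n$ acts on multiaffine polynomials: $S_n$ permutes the variables, and $\gamma=(\gamma_i)$ with $\gamma_i=\begin{pmatrix}a_i&b_i\\c_i&d_i\end{pmatrix}$ acts by $\gamma\cdot f=\prod_{i=1}^n(c_ix_i+d_i)\cdot f\big(\tfrac{a_1x_1+b_1}{c_1x_1+d_1},\dots,\tfrac{a_nx_n+b_n}{c_nx_n+d_n}\big)$; $\gamma\cdot\mathbf{a}$ is defined by $f_{\gamma\cdot\mathbf{a}}=\gamma\cdot f_{\mathbf{a}}$. The Rayleigh difference is $\Delta_{ij}f=\frac{\partial f}{\partial x_i}\frac{\partial f}{\partial x_j}-f\frac{\partial^2f}{\partial x_i\partial x_j}$. For a polynomial $px^2+qx+r$ of degree at most two in $x$, $\mathrm{Discr}_x=q^2-4pr$. The hyperdeterminant is the polynomial in $a_S$, $S\subseteq\{1,2,3\}$, $$\mathrm{HypDet}(\mathbf{a})=(a_1a_{23}+a_2a_{13}-a_3a_{12}-a_\emptyset a_{123})^2-4(a_1a_2-a_\emptyset a_{12})(a_{13}a_{23}-a_3a_{123}).$$ For $h=\sum_{j=0}^4b_jx^j$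 of degree at most $4$ in $x$: $B_x(h)=b_4b_1^2-b_3^2b_0$, $C_x(h)=b_1^3-4b_0b_1b_2+8b_0^2b_3$, $D_x(h)=b_1^2b_2-4b_0b_2^2+2b_0b_1b_3+16b_0^2b_4$. Convention for small $n$: conditions involving indices or variables larger than $n$ are void. *)

(* Defs.v *)
From HB Require Import structures.
From mathcomp Require Import all_boot all_order all_algebra all_fingroup.
From mathcomp Require Import reals complex mpoly.

Set Implicit Arguments.
Unset Strict Implicit.
Unset Printing Implicit Defensive.

Import Order.TTheory GRing.Theory Num.Theory.
Local Open Scope ring_scope.

(* Indices are 0-based: the paper's index k is the element of 'I_n of value k.-1. *)

Definition principal_minor (K : comNzRingType) (n : nat) (A : 'M[K]_n)
    (S : {set 'I_n}) : K :=
  \det (mxsub (@enum_val _ (mem S)) (@enum_val _ (mem S)) A).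

Definition multiaffine (K : nzRingType) (n : nat) (f : {mpoly K[n]}) : Prop :=
  forall m : 'X_{1..n}, m \in msupp f -> forall i, (m i <= 1)%N.

Definition fpoly (K : comNzRingType) (n : nat) (a : {set 'I_n} -> K) :
    {mpoly K[n]} :=
  \sum_(S : {set 'I_n}) a S *: \prod_(i in ~: S) 'X_i.

(* The vector a with fpoly a = f, for f multiaffine (see fcoefK below). *)
Definition fcoef (K : nzRingType) (n : nat) (f : {mpoly K[n]})
    (S : {set 'I_n}) : K :=
  f@_[multinom (i \notin S : nat) | i < n].

(* On a multiaffine f this is the Moebius substitution
     prod_i (c_i x_i + d_i) * f ((a_i x_i + b_i) / (c_i x_i + d_i))_i
   with denominators cleared monomial by monomial; see sl2_act_meval. *)
Definition sl2_act (K : comNzRingType) (n : nat) (g : 'I_n -> 'M[K]_2)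
    (f : {mpoly K[n]}) : {mpoly K[n]} :=
  \sum_(m <- msupp f) f@_m *:
    \prod_(i < n)
      ((g i 0 0 *: 'X_i + (g i 0 1)%:MP) ^+ m i *
       (g i 1 0 *: 'X_i + (g i 1 1)%:MP) ^+ (1 - m i)).

(* Each element of SL_2(K)^n ><| S_n is uniquely a product of some g in
   SL_2(K)^n and some s in S_n; the product g s acts as s followed by g. *)
Definition poly_act (K : comNzRingType) (n : nat) (g : 'I_n -> 'M[K]_2)
    (s : 'S_n) (f : {mpoly K[n]}) : {mpoly K[n]} :=
  sl2_act g (msym s f).

Definition vec_act (K : comNzRingType) (n : nat) (g : 'I_n -> 'M[K]_2)
    (s : 'S_n) (a : {set 'I_n} -> K) : {set 'I_n} -> K :=
  fcoef (poly_act g s (fpoly a)).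

Definition rayleigh (K : comNzRingType) (n : nat) (i j : 'I_n)
    (f : {mpoly K[n]}) : {mpoly K[n]} :=
  f^`M(i) * f^`M(j) - f * f^`M(i)^`M(j).

(* Coefficient of x_k^j in p viewed as a polynomial in x_k whose coefficients
   are polynomials in the other variables (see varcoefE). *)
Definition varcoef (K : nzRingType) (n : nat) (k : 'I_n) (j : nat)
    (p : {mpoly K[n]}) : {mpoly K[n]} :=
  \sum_(m <- msupp p | m k == j) p@_m *: 'X_[(m - U_(k) *+ j)%MM].

Definition discr (K : comNzRingType) (n : nat) (k : 'I_n) (p : {mpoly K[n]}) :
    {mpoly K[n]} :=
  varcoef k 1%N p ^+ 2 - 4%:R * varcoef k 2%N p * varcoef k 0%N p.

Definition HypDet (K : comNzRingType) (n : nat) (i1 i2 i3 : 'I_n)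
    (a : {set 'I_n} -> K) : K :=
  (a [set i1] * a [set i2; i3] + a [set i2] * a [set i1; i3]
     - a [set i3] * a [set i1; i2] - a set0 * a [set i1; i2; i3]) ^+ 2
  - 4%:R * (a [set i1] * a [set i2] - a set0 * a [set i1; i2])
         * (a [set i1; i3] * a [set i2; i3] - a [set i3] * a [set i1; i2; i3]).

Definition Bpoly (K : comNzRingType) (n : nat) (k : 'I_n) (h : {mpoly K[n]}) :
    {mpoly K[n]} :=
  let b j := varcoef k j h in b 4%N * b 1%N ^+ 2 - b 3%N ^+ 2 * b 0%N.

Definition Cpoly (K : comNzRingType) (n : nat) (k : 'I_n) (h : {mpoly K[n]}) :
    {mpoly K[n]} :=
  let b j := varcoef k j h in
  b 1%N ^+ 3 - 4%:R * b 0%N * b 1%N * b 2%N + 8%:R * b 0%N ^+ 2 * b 3%N.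

Definition Dpoly (K : comNzRingType) (n : nat) (k : 'I_n) (h : {mpoly K[n]}) :
    {mpoly K[n]} :=
  let b j := varcoef k j h in
  b 1%N ^+ 2 * b 2%N - 4%:R * b 0%N * b 2%N ^+ 2 + 2%:R * b 0%N * b 1%N * b 3%N
  + 16%:R * b 0%N ^+ 2 * b 4%N.

Definition restrict_first (K : comNzRingType) (n d : nat) (p : {mpoly K[n]}) :
    {mpoly K[n]} :=
  p \mPo [tuple (if (i < d)%N then 'X_i else 0) | i < n].

Section Sanity.
Variables (K : comNzRingType) (n : nat).
Implicit Types (f p : {mpoly K[n]}) (a : {set 'I_n} -> K) (S : {set 'I_n}).

Lemma multiaffine0 : multiaffine (0 : {mpoly K[n]}).
Proof. by move=> m; rewrite msupp0. Qed.

Lemma multiaffineP f :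
  multiaffine f <-> forall m : 'X_{1..n}, (exists i, (1 < m i)%N) -> f@_m = 0.
Proof.
split=> [mf m [i mi] | mf m + i].
  apply/eqP; apply: contraTT mi; rewrite -mcoeff_msupp -leqNgt => /mf; exact.
by rewrite mcoeff_msupp; apply: contraR; rewrite -ltnNge => mi; rewrite mf //; exists i.
Qed.

Lemma multiaffine_sum (I : Type) (r : seq I) (P : pred I) (F : I -> {mpoly K[n]}) :
  (forall i, P i -> multiaffine (F i)) -> multiaffine (\sum_(i <- r | P i) F i).
Proof.
move=> mF; apply/multiaffineP => m mi; rewrite raddf_sum /= big1 // => i /mF.
by move/multiaffineP; apply.
Qed.

Lemma multiaffineZ c f : multiaffine f -> multiaffine (c *: f).
Proof.
move/multiaffineP => mf; apply/multiaffineP => m mi.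
by rewrite mcoeffZ mf // mulr0.
Qed.

Lemma prodX_set S :
  \prod_(i in S) 'X_i = 'X_[K, [multinom (i \in S : nat) | i < n]].
Proof.
rewrite mprodXE; congr 'X_[_]; apply/mnmP => i.
rewrite mnm_sumE mnmE; under eq_bigr do rewrite mnm1E.
have [iS|iS] := boolP (i \in S).
  rewrite (bigD1 i) //= eqxx big1 // => j /andP[_ /negPf ji].
  by rewrite ji.
by rewrite big1 // => j jS; case: eqP jS iS => // -> ->.
Qed.

Lemma multiaffine_set S : multiaffine ('X_[K, [multinom (i \in S : nat) | i < n]]).
Proof. by move=> m; rewrite msuppX inE => /eqP-> i; rewrite mnmE leq_b1. Qed.

Lemma multiaffine_prod (u v : 'I_n -> K) :
  multiaffine (\prod_(i < n) (u i *: 'X_i + (v i)%:MP)).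
Proof.
rewrite bigA_distr; apply: multiaffine_sum => J _.
have -> : \prod_i (if i \in J then u i *: 'X_i else (v i)%:MP) =
    (\prod_(i < n) (if i \in J then u i else v i)) *:
      \prod_(i in J) ('X_i : {mpoly K[n]}).
  rewrite (big_mkcond (fun i => i \in J)) /= -mul_mpolyC rmorph_prod /=.
  rewrite -big_split /=; apply: eq_bigr => i _; case: ifP => _.
    by rewrite mul_mpolyC.
  by rewrite mulr1.
by apply: multiaffineZ; rewrite prodX_set; apply: multiaffine_set.
Qed.

Lemma fpolyE a :
  fpoly a = \sum_S a S *: 'X_[K, [multinom (i \notin S : nat) | i < n]].
Proof.
apply: eq_bigr => S _; rewrite prodX_set; congr (_ *: 'X_[_]).
by apply/mnmP => i; rewrite !mnmE inE.
Qed.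

Lemma multiaffine_fpoly a : multiaffine (fpoly a).
Proof.
apply: multiaffine_sum => S _; apply: multiaffineZ; rewrite prodX_set.
exact: multiaffine_set.
Qed.

Lemma notin_mnm_inj :
  injective (fun S : {set 'I_n} => [multinom (i \notin S : nat) | i < n]).
Proof.
move=> S T /mnmP eST; apply/setP => i.
by move: (eST i); rewrite !mnmE; do 2!case: (i \in _).
Qed.

Lemma fpolyK a S : fcoef (fpoly a) S = a S.
Proof.
rewrite /fcoef fpolyE raddf_sum /= (bigD1 S) //= mcoeffZ mcoeffX eqxx mulr1.
rewrite big1 ?addr0 // => T neTS.
by rewrite mcoeffZ mcoeffX (inj_eq notin_mnm_inj) (negPf neTS) mulr0.
Qed.

Lemma fcoefK f : multiaffine f -> fpoly (fcoef f) = f.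
Proof.
move=> mf; apply/mpolyP => m.
have [/existsP[i mi] | Nm] := boolP [exists i : 'I_n, (1 < m i)%N].
  have e : exists i, (1 < m i)%N by exists i.
  by rewrite ((multiaffineP _).1 mf) // ((multiaffineP _).1 (@multiaffine_fpoly _)).
have -> : m = [multinom (i \notin [set i | m i == 0%N] : nat) | i < n].
  apply/mnmP => i; rewrite mnmE inE.
  move: Nm; rewrite negb_exists => /forallP/(_ i); rewrite -leqNgt.
  by case: (m i) => [|[]].
exact: fpolyK.
Qed.

Lemma multiaffine_msym (s : 'S_n) f : multiaffine f -> multiaffine (msym s f).
Proof.
move/multiaffineP => mf; apply/multiaffineP => m [i mi].
rewrite mcoeff_sym mf //; exists ((s^-1)%g i); by rewrite mnmE permKV.
Qed.

Lemma multiaffine_sl2_act (g : 'I_n -> 'M[K]_2) f :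
  multiaffine f -> multiaffine (sl2_act g f).
Proof.
move=> mf; rewrite /sl2_act big_seq; apply: multiaffine_sum => m /mf m1.
apply: multiaffineZ.
set P := \prod_(i < n) _.
have -> : P = \prod_(i < n)
   ((if m i == 0%N then g i 1 0 else g i 0 0) *: 'X_i
     + (if m i == 0%N then g i 1 1 else g i 0 1)%:MP).
  apply: eq_bigr => i _; move: (m1 i).
  by case: (m i) => [|[]] //= _; rewrite ?expr0 ?expr1 ?mul1r ?mulr1.
exact: multiaffine_prod.
Qed.

Lemma fpoly_vec_act (g : 'I_n -> 'M[K]_2) (s : 'S_n) a :
  fpoly (vec_act g s a) = poly_act g s (fpoly a).
Proof.
by apply/fcoefK/multiaffine_sl2_act/multiaffine_msym/multiaffine_fpoly.
Qed.

Lemma varcoefE (k : 'I_n) (d : nat) p :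
  (forall m : 'X_{1..n}, m \in msupp p -> (m k < d)%N) ->
  p = \sum_(j < d) varcoef k j p * 'X_k ^+ j.
Proof.
move=> pd; rewrite [LHS]mpolyE big_seq.
under [RHS]eq_bigr do rewrite /varcoef mulr_suml big_mkcond big_seq.
rewrite exchange_big /=; apply: eq_bigr => m /pd mk.
rewrite (bigD1 (Ordinal mk)) //= eqxx big1 => [|j]; last first.
  by rewrite -val_eqE /= eq_sym => /negPf->.
rewrite addr0 -scalerAl mpolyXn -mpolyXD; congr (_ *: 'X_[_]).
apply/mnmP => i; rewrite mnmDE mnmBE mulmnE mnm1E.
by case: (eqVneq k i) => [<-|_]; rewrite ?mul1n ?mul0n ?subnK ?subn0 ?addn0.
Qed.

Lemma varcoef_free (k : 'I_n) (j : nat) p m :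
  m \in msupp (varcoef k j p) -> m k = 0%N.
Proof.
apply: contraTeq => mk; rewrite mcoeff_msupp negbK raddf_sum /=.
rewrite big1 // => m' /eqP m'k; rewrite mcoeffZ mcoeffX.
case: eqP => [e|]; last by rewrite mulr0.
by move: mk; rewrite -e mnmBE mulmnE mnm1E eqxx mul1n m'k subnn.
Qed.

End Sanity.

Lemma sl2_act_meval (K : fieldType) (n : nat) (g : 'I_n -> 'M[K]_2)
    (f : {mpoly K[n]}) (v : 'I_n -> K) :
  multiaffine f -> (forall i, g i 1 0 * v i + g i 1 1 != 0) ->
  (sl2_act g f).@[v] =
    (\prod_(i < n) (g i 1 0 * v i + g i 1 1)) *
    f.@[fun i => (g i 0 0 * v i + g i 0 1) / (g i 1 0 * v i + g i 1 1)].
Proof.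
move=> mf nz; rewrite [f in RHS]mpolyE /sl2_act !raddf_sum /= mulr_sumr.
rewrite [LHS]big_seq [RHS]big_seq; apply: eq_bigr => m /mf m1.
rewrite !mevalZ mevalX mulrCA rmorph_prod /= -big_split /=; congr (_ * _).
apply: eq_bigr => i _.
rewrite mevalM !rmorphXn /= !mevalD !mevalZ !mevalXU !mevalC.
move: (m1 i); case: (m i) => [|[]] //= _; rewrite ?expr0 ?expr1 ?mul1r ?mulr1 //.
by rewrite mulrCA divff ?mulr1.
Qed.

(* Main.v *)
Require Import Defs.
From HB Require Import structures.
From mathcomp Require Import all_boot all_order all_algebra all_fingroup.
From mathcomp Require Import reals complex mpoly ring lra zify.

Set Implicit Arguments.
Unset Strict Implicit.
Unset Printing Implicit Defensive.

Import Order.TTheory GRing.Theory Num.Theory.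
Local Open Scope ring_scope.

(* Necessity: by the Pluecker relations, for the vector a of principal minors of a
Hermitian matrix, the Rayleigh difference is the squared modulus U^2 + V^2 of a
multiaffine complex polynomial; its discriminant in a third variable is -4 times
the square of a polynomial, of degree at most two in a fourth one, on which B, C
and D vanish. These properties are invariant under the group.

Sufficiency: C = D = 0 and (ii) on the whole orbit say that all the
hyperdeterminants, restricted to a line, are minus a square. One then constructs
the matrix on D + {e} by induction on D. After a generic translation, restrict
f_a to the line t in direction e: the induction hypothesis gives, for generic t,
a Hermitian matrix with minors (a_S + t a_Se) / (1 + t a_e) for S in D. The
square condition shows that, after conjugation by a diagonal matrix with entries
w_i (t), this family becomes polynomial in t: w_i is a factor of degree at most
one of a nonnegative quadratic polynomial w_i w_i^*, and the choice among w_i and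
w_i^* can be made such that w_i w_j^* divides the (i, j) entry for all i and j.
The quotients are affine in t, and at the point where 1 + t a_e = 0 they form a
matrix of rank one v v^*, where v is the missing row of the bordered matrix. *)

(** The minors leave the matrix undetermined at least up to conjugation by diagonal unitary
    matrices, so the matrices that the induction hypothesis gives at different points t do not fit
    together by themselves. Products of entries around cycles are free of the diagonal ambiguity.
    Hence each class of indices linked by nonzero entries gets a root k, and the (i, j) entry is
    replaced by N_ki N_ij N_jk. Its modulus and real part are polynomial in the minors; the square
    of its imaginary part is minus a hyperdeterminant, up to a known square, and this is where the
    square condition enters. The entries N_ki must be nonzero on the whole class, which is the
    reason for the generic translation. The price is a factor w_i = N_ki in each row, of which only
    the norm is known, up to the exchange of its two conjugate roots. That the exchanges can be made
    consistently is a statement on weighted directed graphs: the minors are divisible by the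
    products of the norms, which excludes negative cycles, and a choice of least total defect then
    has no defect. *)

Definition upd (I : eqType) (T : Type) (x : I -> T) (i : I) (u : T) : I -> T :=
  fun j => if j == i then u else x j.

(** * Multiaffine forms in homogeneous coordinates *)

Section MultiForm.
Variables (K : comNzRingType) (n : nat).
Implicit Types (a : {set 'I_n} -> K) (x w : 'I_n -> K) (S : {set 'I_n}).

(* [fpoly a] homogenized in each variable separately: x_i / w_i is the
   coordinate of a point of the i-th projective line, so that SL_2 acts linearly. *)
Definition mform a x w : K :=
  \sum_(S : {set 'I_n}) a S * \prod_i (if i \in S then w i else x i).

Lemma eq_mform a x x' w w' : x =1 x' -> w =1 w' -> mform a x w = mform a x' w'.
Proof.
move=> ex ew; apply: eq_bigr => S _; congr (_ * _).
by apply: eq_bigr => i _; rewrite ex ew.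
Qed.

Lemma mform_upd a x w i s t :
  mform a (upd x i s) (upd w i t) =
    s * mform a (upd x i 1) (upd w i 0) + t * mform a (upd x i 0) (upd w i 1).
Proof.
rewrite /mform !mulr_sumr -big_split; apply: eq_bigr => S _ /=.
have E u v : \prod_j (if j \in S then upd w i u j else upd x i v j) =
    (if i \in S then u else v) * \prod_(j < n | j != i) (if j \in S then w j else x j).
  rewrite (bigD1 i) //= /upd eqxx; congr (_ * _).
  by apply: eq_bigr => j /negPf->.
by rewrite !E; case: (i \in S); ring.
Qed.

(** At this 0/1 point every monomial but that of S vanishes. Identities between coefficients are
    thereby reduced to identities between values. *)
Lemma mform_set a S :
  mform a (fun i => (i \notin S)%:R) (fun i => (i \in S)%:R) = a S.
Proof.
rewrite /mform (bigD1 S) //= big1 ?mulr1 => [|i _]; last by case: (i \in S).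
rewrite big1 ?addr0 // => T neTS.
have [i iTS] : exists i, (i \in T) != (i \in S).
  apply/existsP; rewrite -[X in is_true X]negbK negb_exists; apply: contra neTS.
  move=> /forallP h; apply/eqP/setP => i; apply/eqP.
  by rewrite -[X in is_true X]negbK; exact: h.
rewrite (bigD1 i) //=; move: iTS.
by case: (i \in T); case: (i \in S) => //= _; rewrite mul0r mulr0.
Qed.

(** The coefficients of the transformed form are its values at 0/1 points, and g i sends (1, 0) and
    (0, 1) to its columns. *)
Definition sl2c (g : 'I_n -> 'M[K]_2) a S : K :=
  mform a (fun i => if i \in S then g i 0 1 else g i 0 0)
          (fun i => if i \in S then g i 1 1 else g i 1 0).

Lemma mform_act g a x w : mform (sl2c g a) x w =
  mform a (fun i => g i 0 0 * x i + g i 0 1 * w i)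
          (fun i => g i 1 0 * x i + g i 1 1 * w i).
Proof.
rewrite /mform; under [LHS]eq_bigr do rewrite mulr_suml.
rewrite exchange_big; apply: eq_bigr => T _ /=.
under eq_bigr do rewrite -mulrA.
rewrite -mulr_sumr; congr (_ * _).
transitivity (\prod_i ((if i \in T then g i 1 1 else g i 0 1) * w i +
                      (if i \in T then g i 1 0 else g i 0 0) * x i)); last first.
  by apply: eq_bigr => i _; case: (i \in T); rewrite addrC.
rewrite bigA_distr; apply: eq_bigr => S _; rewrite -big_split /=.
by apply: eq_bigr => i _; case: (i \in T); case: (i \in S).
Qed.

End MultiForm.

(** * Principal minors as coefficients of a determinant *)

Section PrincipalMinors.
Variables (K : comNzRingType).

Lemma det_mxsub_inj (m n : nat) (f : 'I_m -> 'I_n) (A : 'M[K]_n) :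
  injective f -> m = n -> \det (mxsub f f A) = \det A.
Proof.
move=> injf e; subst m.
have -> : mxsub f f A = perm_mx (perm injf) *m A *m (perm_mx (perm injf))^T.
  rewrite -row_permE tr_perm_mx -col_permE; apply/matrixP => i j.
  by rewrite !mxE !permE.
rewrite !det_mulmx det_tr det_perm mulrAC -expr2 sqrr_sign mul1r //.
Qed.

(** This is diag(x) + diag(w) A, the determinantal representation of the form of the principal
    minors of A; see [det_pencil]. *)
Definition pencil (n : nat) (A : 'M[K]_n) (x w : 'I_n -> K) : 'M[K]_n :=
  \matrix_(i, j) (x i *+ (i == j) + w i * A i j).

(** With S listed first the right-hand matrix is block triangular. All minors become determinants of
    the same size n, so that their Leibniz sums can be compared term by term. *)
Lemma principal_minorE n (A : 'M[K]_n) (S : {set 'I_n}) : principal_minor A S =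
  \det (\matrix_(i, j) (if i \in S then A i j else (i == j)%:R)).
Proof.
set B := \matrix_(i, j) _.
have ecard : (#|S| + #|~: S|)%N = n by rewrite cardsC card_ord.
pose f (u : 'I_(#|S| + #|~: S|)) : 'I_n :=
  match split u with inl k => enum_val k | inr k => enum_val k end.
have injf : injective f.
  move=> u v; rewrite /f; case: (split_ordP u) => i ->; case: (split_ordP v) => j ->.
  - by move/enum_val_inj->.
  - by move=> e; have := enum_valP i; rewrite e; have := enum_valP j; rewrite inE => /negPf->.
  - by move=> e; have := enum_valP i; rewrite e inE; have := enum_valP j => ->.
  - by move/enum_val_inj->.
rewrite -(det_mxsub_inj B injf ecard).
have -> : mxsub f f B = block_mx (mxsub (@enum_val _ (mem S)) (@enum_val _ (mem S)) A)
    (mxsub (@enum_val _ (mem S)) (@enum_val _ (mem (~: S))) A) 0 1%:M.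
  rewrite -[LHS]submxK; congr block_mx; apply/matrixP => i j; rewrite !mxE /f
    ?(unsplitK (inl _)) ?(unsplitK (inr _)) ?enum_valP //.
  - have := enum_valP i; rewrite inE => /negPf->.
    case: eqP => // e; have := enum_valP i; rewrite e inE.
    by rewrite enum_valP.
  - have := enum_valP i; rewrite inE => /negPf->.
    by rewrite (inj_eq enum_val_inj).
by rewrite det_ublock det1 mulr1.
Qed.

(** Row i is the sum of a multiple of the i-th unit row and of w_i times row i of A; expanding each
    Leibniz product sorts its terms by the set S of rows where the second summand is taken. *)
Lemma det_pencil n (A : 'M[K]_n) x w :
  \det (pencil A x w) = mform (principal_minor A) x w.
Proof.
rewrite /mform; under [RHS]eq_bigr do rewrite principal_minorE /determinant mulr_suml.
rewrite exchange_big /=; apply: eq_bigr => s _.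
under [RHS]eq_bigr do rewrite -mulrA -big_split.
rewrite -mulr_sumr; congr (_ * _).
under eq_bigr do rewrite mxE addrC.
rewrite bigA_distr; apply: eq_bigr => S _; apply: eq_bigr => i _.
by rewrite mxE; case: (i \in S) => /=; rewrite ?mulr_natl // mulrC.
Qed.

Lemma principal_minorT n (A : 'M[K]_n) S : principal_minor (A^T) S = principal_minor A S.
Proof. by rewrite /principal_minor -trmx_mxsub det_tr. Qed.

Lemma det_pencilC n (A : 'M[K]_n) x w :
  \det (\matrix_(i, j) (x i *+ (i == j) + A i j * w j)) = \det (pencil A x w).
Proof.
rewrite det_pencil -det_tr.
transitivity (\det (pencil A^T x w)).
  congr determinant; apply/matrixP => i j; rewrite !mxE mulrC eq_sym.
  by case: eqP => [->|].
by rewrite det_pencil; apply: eq_bigr => S _; rewrite principal_minorT.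
Qed.

Lemma det_2x2 (A : 'M[K]_2) : \det A = A 0 0 * A 1 1 - A 0 1 * A 1 0.
Proof.
rewrite (expand_det_row _ ord0) big_ord_recl big_ord1 /cofactor !det_mx11 !mxE /=.
have -> : lift ord0 ord0 = 1 :> 'I_2 by apply: val_inj.
have -> : lift 1 ord0 = 0 :> 'I_2 by apply: val_inj.
by rewrite expr0 expr1 mul1r mulN1r mulrN.
Qed.

End PrincipalMinors.

(** * Rayleigh differences of principal minors *)

Section Plucker.
Variables (K : comNzRingType) (n : nat).

Section Rows.
Variables (C : 'M[K]_n) (i j : 'I_n) (neij : i != j).
Implicit Types (u v : 'rV[K]_n).

Definition set_rows u v : 'M[K]_n :=
  \matrix_(k, l) (if k == i then u 0 l else if k == j then v 0 l else C k l).

(** Column i of the adjugate holds the cofactors along row i, which do not involve that row; hence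
    u' is arbitrary. *)
Lemma set_rows_adjl u u' v :
  (u *m \adj (set_rows u' v)) 0 i = \det (set_rows u v).
Proof.
rewrite (expand_det_row _ i) !mxE; apply: eq_bigr => l _; rewrite !mxE eqxx.
congr (_ * (_ * \det _)); apply/matrixP => r s; rewrite !mxE.
by rewrite eq_sym (negPf (neq_lift _ _)).
Qed.

Lemma set_rows_adjr u v v' :
  (v *m \adj (set_rows u v')) 0 j = \det (set_rows u v).
Proof.
rewrite (expand_det_row _ j) !mxE; apply: eq_bigr => l _; rewrite !mxE eqxx.
rewrite eq_sym (negPf neij); congr (_ * (_ * \det _)); apply/matrixP => r s.
by rewrite !mxE [lift j r == j]eq_sym (negPf (neq_lift _ _)).
Qed.

Lemma det_set_rows_swap u v : \det (set_rows v u) = - \det (set_rows u v).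
Proof.
have -> : set_rows v u = xrow i j (set_rows u v).
  apply/matrixP => k l; rewrite !mxE; case: tpermP => [->|->|/eqP/negPf-> /eqP/negPf->//].
    by rewrite !eqxx [j == i]eq_sym (negPf neij).
  by rewrite !eqxx [j == i]eq_sym (negPf neij).
by rewrite xrowE det_mulmx det_perm odd_tperm neij expr1 mulN1r.
Qed.

Lemma det_set_rows_eq0 u v k : k != i -> k != j ->
  \det (set_rows (row k C) v) = 0.
Proof.
move=> ki kj; apply: (@determinant_alternate _ _ _ i k); first by rewrite eq_sym.
by move=> l; rewrite !mxE eqxx (negPf ki) (negPf kj).
Qed.

(** Cramer's rule writes det(a, b) c as a combination of the rows of [set_rows a b]. Applying the
    linear form det(-, d) kills all of these rows except a and b. *)
Lemma plucker a b c d :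
  \det (set_rows a b) * \det (set_rows c d) =
  \det (set_rows c b) * \det (set_rows a d) + \det (set_rows a c) * \det (set_rows b d).
Proof.
set y := c *m \adj (set_rows a b).
have ey : y *m set_rows a b = \det (set_rows a b) *: c.
  by rewrite /y -mulmxA mul_adj_mx mul_mx_scalar.
rewrite -[\det (set_rows c d)](@set_rows_adjl c 0).
transitivity ((\det (set_rows a b) *: c *m \adj (set_rows 0 d)) 0 i).
  by rewrite -scalemxAl [RHS]mxE.
rewrite -ey -mulmxA mxE (bigD1 i) //= (bigD1 j) 1?eq_sym //= big1.
  rewrite addr0 /y set_rows_adjl set_rows_adjr; congr (_ * _ + _ * _).
    rewrite -(@set_rows_adjl a 0) !mxE; apply: eq_bigr => l _.
    by rewrite [set_rows a b i l]mxE eqxx.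
  rewrite -(@set_rows_adjl b 0) !mxE; apply: eq_bigr => l _.
  by rewrite [set_rows a b j l]mxE eqxx eq_sym (negPf neij).
move=> k /andP[ki kj].
suff -> : (set_rows a b *m \adj (set_rows 0 d)) k i = 0 by rewrite mulr0.
rewrite -[RHS](@det_set_rows_eq0 0 d k ki kj) -(@set_rows_adjl (row k C) 0) !mxE.
by apply: eq_bigr => l _; rewrite !mxE (negPf ki) (negPf kj).
Qed.

End Rows.
End Plucker.

Section Rayleigh.
Variables (K : comNzRingType) (n : nat).
Implicit Types (a : {set 'I_n} -> K) (x w : 'I_n -> K) (i j k : 'I_n).

Lemma updC (T : Type) (x : 'I_n -> T) i j u v : i != j ->
  upd (upd x i u) j v =1 upd (upd x j v) i u.
Proof. by move=> nij l; rewrite /upd; case: eqP => // ->; rewrite eq_sym (negPf nij). Qed.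

Lemma eq_upd (T : Type) (x y : 'I_n -> T) i u : x =1 y -> upd x i u =1 upd y i u.
Proof. by move=> e l; rewrite /upd e. Qed.

(** The coefficient of w_i if s is true, of x_i otherwise: s tells whether the sets S that
    contribute contain i. *)
Definition mcoef1 a i x w (s : bool) : K :=
  mform a (upd x i (~~ s)%:R) (upd w i s%:R).

Definition mcoef2 a i j x w (s t : bool) : K :=
  mcoef1 a i (upd x j (~~ t)%:R) (upd w j t%:R) s.

Definition mcoef3 a i j k x w (s t u : bool) : K :=
  mcoef2 a i j (upd x k (~~ u)%:R) (upd w k u%:R) s t.

Lemma mform_mcoef1 a i x w p r :
  mform a (upd x i p) (upd w i r) =
  p * mcoef1 a i x w false + r * mcoef1 a i x w true.
Proof. exact: mform_upd. Qed.

Lemma mform_mcoef2 a i j x w p q r s : i != j ->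
  mform a (upd (upd x j q) i p) (upd (upd w j s) i r) =
    p * (q * mcoef2 a i j x w false false + s * mcoef2 a i j x w false true)
  + r * (q * mcoef2 a i j x w true false + s * mcoef2 a i j x w true true).
Proof.
move=> nij; rewrite mform_mcoef1; congr (_ * _ + _ * _).
  rewrite /mcoef1 (eq_mform _ (updC _ _ _ _) (updC _ _ _ _)) 1?eq_sym //.
  rewrite mform_mcoef1; congr (_ * _ + _ * _);
  by rewrite /mcoef2 /mcoef1 (eq_mform _ (updC _ _ _ nij) (updC _ _ _ nij)).
rewrite /mcoef1 (eq_mform _ (updC _ _ _ _) (updC _ _ _ _)) 1?eq_sym //.
rewrite mform_mcoef1; congr (_ * _ + _ * _);
by rewrite /mcoef2 /mcoef1 (eq_mform _ (updC _ _ _ nij) (updC _ _ _ nij)).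
Qed.

(** Minus the determinant of a 2 x 2 array. Below, [hyp8] is Cayley's hyperdeterminant of a 2 x 2 x
    2 array, the discriminant of that determinant in the third direction. *)
Definition ray4 (T : bool -> bool -> K) : K :=
  T true false * T false true - T false false * T true true.

Definition hyp8 (T : bool -> bool -> bool -> K) : K :=
  (T true false false * T false true true + T false true false * T true false true
    - T false false true * T true true false - T false false false * T true true true) ^+ 2
  - 4%:R * (T true false false * T false true false - T false false false * T true true false)
      * (T true false true * T false true true - T false false true * T true true true).

(* In homogeneous coordinates, [ray] is the Rayleigh difference of [fpoly a] and
   [hyp] the discriminant of the latter in the variable k. *)
Definition ray a i j x w : K := ray4 (mcoef2 a i j x w).
Definition hyp a i j k x w : K := hyp8 (mcoef3 a i j k x w).

Lemma eq_mcoef2 a i j x x' w w' s t : x =1 x' -> w =1 w' ->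
  mcoef2 a i j x w s t = mcoef2 a i j x' w' s t.
Proof. by move=> ex ew; apply: eq_mform => l; rewrite /upd ?ex ?ew. Qed.

Lemma eq_ray a i j x x' w w' : x =1 x' -> w =1 w' -> ray a i j x w = ray a i j x' w'.
Proof. by move=> ex ew; rewrite /ray /ray4 !(eq_mcoef2 _ _ _ _ _ ex ew). Qed.

Lemma eq_hyp a i j k x x' w w' : x =1 x' -> w =1 w' -> hyp a i j k x w = hyp a i j k x' w'.
Proof.
move=> ex ew; rewrite /hyp /hyp8 /mcoef3.
by rewrite !(eq_mcoef2 a i j _ _ (eq_upd _ _ ex) (eq_upd _ _ ew)).
Qed.

Section Action.
Variable g : 'I_n -> 'M[K]_2.

Definition actx x w l : K := g l 0 0 * x l + g l 0 1 * w l.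
Definition actw x w l : K := g l 1 0 * x l + g l 1 1 * w l.

Lemma actx_upd x w i s t : actx (upd x i s) (upd w i t) =1
  upd (actx x w) i (g i 0 0 * s + g i 0 1 * t).
Proof. by move=> l; rewrite /actx /upd; case: eqP => // ->. Qed.

Lemma actw_upd x w i s t : actw (upd x i s) (upd w i t) =1
  upd (actw x w) i (g i 1 0 * s + g i 1 1 * t).
Proof. by move=> l; rewrite /actw /upd; case: eqP => // ->. Qed.

Lemma mcoef2_act a i j x w s t : i != j ->
  mcoef2 (sl2c g a) i j x w s t =
    let c := mcoef2 a i j (actx x w) (actw x w) in
    let p := if s then g i 0 1 else g i 0 0 in
    let r := if s then g i 1 1 else g i 1 0 in
    let q := if t then g j 0 1 else g j 0 0 in
    let v := if t then g j 1 1 else g j 1 0 in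
    p * (q * c false false + v * c false true) + r * (q * c true false + v * c true true).
Proof.
move=> nij; rewrite /mcoef2 /mcoef1 mform_act.
rewrite (eq_mform _ (actx_upd _ _ _ _ _) (actw_upd _ _ _ _ _)).
rewrite (eq_mform _ (eq_upd _ _ (actx_upd _ _ _ _ _)) (eq_upd _ _ (actw_upd _ _ _ _ _))).
rewrite mform_mcoef2 //=.
by case: s; case: t; rewrite ?mulr0 ?mulr1 ?add0r ?addr0.
Qed.

Lemma ray_act a i j x w : i != j ->
  ray (sl2c g a) i j x w = \det (g i) * \det (g j) * ray a i j (actx x w) (actw x w).
Proof.
move=> nij; rewrite /ray /ray4 !mcoef2_act // !det_2x2 /=.
set c := mcoef2 _ _ _ _ _; ring.
Qed.

Lemma hyp_act a i j k x w : i != j -> i != k -> j != k ->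
  hyp (sl2c g a) i j k x w =
  (\det (g i) * \det (g j) * \det (g k)) ^+ 2 * hyp a i j k (actx x w) (actw x w).
Proof.
move=> nij nik njk; rewrite /hyp.
set T := mcoef3 a i j k _ _.
have E s t u : mcoef3 (sl2c g a) i j k x w s t u =
    let p := if s then g i 0 1 else g i 0 0 in
    let r := if s then g i 1 1 else g i 1 0 in
    let q := if t then g j 0 1 else g j 0 0 in
    let v := if t then g j 1 1 else g j 1 0 in
    let y := if u then g k 0 1 else g k 0 0 in
    let z := if u then g k 1 1 else g k 1 0 in
    let c s t := y * T s t false + z * T s t true in
    p * (q * c false false + v * c false true) + r * (q * c true false + v * c true true).
  rewrite /mcoef3 mcoef2_act //=.
  have F s' t' : mcoef2 a i j (actx (upd x k (~~ u)%:R) (upd w k u%:R))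
      (actw (upd x k (~~ u)%:R) (upd w k u%:R)) s' t' =
     (if u then g k 0 1 else g k 0 0) * T s' t' false + (if u then g k 1 1 else g k 1 0) * T s' t' true.
    rewrite (eq_mcoef2 _ _ _ _ _ (actx_upd _ _ _ _ _) (actw_upd _ _ _ _ _)).
    have swap (z : 'I_n -> K) c d e : upd (upd (upd z k c) j d) i e =1 upd (upd (upd z j d) i e) k c.
      by move=> l; rewrite /upd; case: (eqVneq l k) => [->|_] //; rewrite eq_sym (negPf nik) eq_sym (negPf njk).
    rewrite /mcoef2 /mcoef1 (eq_mform _ (swap _ _ _ _) (swap _ _ _ _)) mform_mcoef1.
    rewrite /T /mcoef3 /mcoef2 /mcoef1 !(eq_mform _ (swap _ _ _ _) (swap _ _ _ _)).
    by case: (u); rewrite ?mulr0 ?mulr1 ?add0r ?addr0.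
  by rewrite !F.
rewrite /hyp8 !E !det_2x2 /=.
clearbody T; ring.
Qed.

End Action.

End Rayleigh.

Section RayMinors.
Variables (K : comNzRingType) (n : nat) (A : 'M[K]_n) (i j : 'I_n) (x w : 'I_n -> K).
Hypothesis nij : i != j.

Lemma mcoef2_principal_minor s t :
  mcoef2 (principal_minor A) i j x w s t =
  \det (set_rows (pencil A x w) i j (if s then row i A else delta_mx 0 i)
                 (if t then row j A else delta_mx 0 j)).
Proof.
rewrite /mcoef2 /mcoef1 -det_pencil; congr determinant; apply/matrixP => k l.
rewrite !mxE /upd; have [->|ki] := eqVneq k i.
  case: s => /=; rewrite !mxE /=; last by rewrite mul0r addr0 [l == i]eq_sym.
  by rewrite mul0rn add0r mul1r.
have [->|//] := eqVneq k j.
case: t => /=; rewrite !mxE /=; last by rewrite mul0r addr0 [l == j]eq_sym.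
by rewrite mul0rn add0r mul1r.
Qed.

Let x' := upd (upd x j 1) i 0.
Let w' := upd (upd w j 0) i 1.

(** This is the Pluecker relation for the i-th and j-th unit rows and rows of A. The factors are
    minors whose row and column sets differ by i and j; exchanging two columns or rows of A makes
    them principal, so that [det_pencil] applies to them too. *)
Lemma ray_principal_minor : ray (principal_minor A) i j x w =
  \det (pencil (xcol i j A) x' w') * \det (pencil (xrow i j A) x' w').
Proof.
have -> : pencil (xrow i j A) x' w' =
    set_rows (pencil A x w) i j (row j A) (delta_mx 0 j).
  apply/matrixP => k l; rewrite !mxE /x' /w' /upd; have [->|ki] := eqVneq k i.
    by rewrite mul0rn add0r mul1r tpermL.
  have [->|kj] := eqVneq k j; first by rewrite mul0r addr0 eq_sym.
  by rewrite tpermD // eq_sym.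
have -> : \det (pencil (xcol i j A) x' w') =
    \det (set_rows (pencil A x w) i j (delta_mx 0 i) (row i A)).
  have -> : pencil (xcol i j A) x' w' =
     xrow i j (xcol i j (set_rows (pencil A x w) i j (delta_mx 0 i) (row i A))).
    apply/matrixP => k l; rewrite !mxE /x' /w' /upd; have [->|ki] := eqVneq k i.
      by rewrite tpermL [j == i]eq_sym (negPf nij) eqxx mul0rn add0r mul1r.
    have [->|kj] := eqVneq k j.
      rewrite tpermR eqxx mul0r addr0 /=.
      by rewrite -(inj_eq (@perm_inj _ (tperm i j)) j l) tpermR eq_sym.
    have tk : tperm i j k = k by rewrite tpermD // eq_sym.
    rewrite tk (negPf ki) (negPf kj).
    suff -> : (k == tperm i j l) = (k == l) by [].
    by rewrite -{1}tk (inj_eq (@perm_inj _ (tperm i j))).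
  rewrite xrowE xcolE !det_mulmx det_perm odd_tperm nij expr1.
  by rewrite mulrN1 mulN1r opprK.
rewrite /ray /ray4 !mcoef2_principal_minor.
have := plucker (pencil A x w) nij (delta_mx 0 i) (delta_mx 0 j) (row i A) (row j A).
rewrite (@det_set_rows_swap _ _ _ i j nij (row j A) (delta_mx 0 j)) => ->.
by ring.
Qed.

End RayMinors.

Section Morphism.
Variables (K L : comNzRingType) (f : {rmorphism K -> L}) (n : nat).
Implicit Types (a : {set 'I_n} -> K) (x w : 'I_n -> K).

Lemma rmorph_mform a x w : f (mform a x w) = mform (f \o a) (f \o x) (f \o w).
Proof.
rewrite rmorph_sum; apply: eq_bigr => S _; rewrite rmorphM rmorph_prod.
by congr (_ * _); apply: eq_bigr => i _; case: ifP.
Qed.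

Lemma rmorph_ray a i j x w : f (ray a i j x w) = ray (f \o a) i j (f \o x) (f \o w).
Proof.
rewrite /ray /ray4 rmorphB !rmorphM /=.
have E s t : f (mcoef2 a i j x w s t) = mcoef2 (f \o a) i j (f \o x) (f \o w) s t.
  rewrite /mcoef2 /mcoef1 rmorph_mform; apply: eq_mform => l /=;
  by rewrite /upd; case: ifP => _; [|case: ifP => _]; rewrite ?rmorph_nat.
by rewrite !E.
Qed.

End Morphism.

Section HermitianSquares.
Variables (R : rcfType) (n : nat).

Lemma hermsymmxP (A : 'M[R[i]]_n) :
  reflect (forall i j, A i j = (A j i)^*%C) (A \is hermsymmx).
Proof.
apply: (iffP (is_hermitianmxP _ _ _)) => [e i j|e].
  by rewrite {1}e !mxE expr0 mul1r.
by apply/matrixP => i j; rewrite !mxE expr0 mul1r e.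
Qed.

Lemma conjc_det_pencil m (A : 'M[R[i]]_m) (i j : 'I_m) (x w : 'I_m -> R) :
  A \is hermsymmx ->
  (\det (pencil (xcol i j A) (fun k => (x k)%:C%C) (fun k => (w k)%:C%C)))^*%C =
  \det (pencil (xrow i j A) (fun k => (x k)%:C%C) (fun k => (w k)%:C%C)).
Proof.
move/is_hermitianmxP; rewrite expr0 scale1r => eA.
rewrite -det_pencilC -[X in X^*%C]det_tr -det_map_mx; congr determinant.
apply/matrixP => k l; rewrite !mxE rmorphD rmorphM rmorphMn /= oppr0 -![(_ +i* 0)%C]/(_%:C)%C.
rewrite [l == k]eq_sym mulrC; congr (_ + _ * _); first by case: eqP => [->|].
by rewrite [in RHS]eA !mxE.
Qed.

Lemma ray_sum_squares (A : 'M[R[i]]_n) (a : {set 'I_n} -> R) (i j : 'I_n) :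
  A \is hermsymmx -> (forall S, principal_minor A S = (a S)%:C%C) -> i != j ->
  exists u v : {set 'I_n} -> R, forall x w,
    ray a i j x w =
      mform u (upd (upd x j 1) i 0) (upd (upd w j 0) i 1) ^+ 2
    + mform v (upd (upd x j 1) i 0) (upd (upd w j 0) i 1) ^+ 2.
Proof.
move=> hA ea nij; pose b := principal_minor (xcol i j A).
(* The two factors of [ray_principal_minor] are conjugate at real points, so the Rayleigh difference
   is the squared modulus of one of them. *)
exists (fun S => complex.Re (b S)), (fun S => complex.Im (b S)) => x w.
set x' := upd _ i 0; set w' := upd _ i 1.
apply: complexI.
transitivity (ray (principal_minor A) i j (fun k => (x k)%:C%C) (fun k => (w k)%:C%C)).
  by rewrite (rmorph_ray (real_complex R)) /ray /ray4 /mcoef2 /mcoef1 /mform;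
     congr (_ * _ - _ * _); apply: eq_bigr => S _; rewrite ea.
rewrite ray_principal_minor //.
have ex : upd (upd (fun k => (x k)%:C%C) j 1) i 0 =1 (fun k => (x' k)%:C%C).
  by move=> k; rewrite /x' /upd; case: ifP => _; [|case: ifP => _].
have ew : upd (upd (fun k => (w k)%:C%C) j 0) i 1 =1 (fun k => (w' k)%:C%C).
  by move=> k; rewrite /w' /upd; case: ifP => _; [|case: ifP => _].
rewrite !det_pencil !(eq_mform _ ex ew) -!det_pencil -conjc_det_pencil //.
rewrite det_pencil -/b.
have -> : mform b (fun k => (x' k)%:C%C) (fun k => (w' k)%:C%C) =
  (mform (fun S => complex.Re (b S)) x' w')%:C%C
   + 'i%C * (mform (fun S => complex.Im (b S)) x' w')%:C%C.
  rewrite !(rmorph_mform (real_complex R)) /mform mulr_sumr -big_split.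
  apply: eq_bigr => S _ /=; rewrite {1}[b S]complexE mulrDl -mulrA.
  by congr (_ * _ + _ * (_ * _)); apply: eq_bigr => l _; case: ifP.
set p := mform _ _ _; set q := mform _ _ _; clearbody p q.
apply/eqP; rewrite eq_complex /=; apply/andP; split; apply/eqP; ring.
Qed.

End HermitianSquares.

(** * Evaluation of the conditions *)

Section PolyEval.
Variable (K : numDomainType).

Lemma poly_nonroot (p : {poly K}) : p != 0 -> exists t : nat, p.[t%:R] != 0.
Proof.
move=> p0.
have [/existsP[i ri]|] := boolP [exists i : 'I_(size p), p.[(i : nat)%:R] != 0].
  by exists i.
rewrite negb_exists => /forallP h; exfalso.
have := @max_poly_roots _ p [seq i%:R | i <- iota 0 (size p)] p0.
rewrite size_map size_iota ltnn => e; suff: false by []; apply: e.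
  rewrite all_map; apply/allP => i; rewrite mem_iota add0n => /andP[_ ip].
  by have := h (Ordinal ip); rewrite negbK.
by rewrite map_inj_uniq ?iota_uniq // => x y /eqP; rewrite eqr_nat => /eqP.
Qed.

Lemma poly_ext (p q : {poly K}) : (forall t, p.[t] = q.[t]) -> p = q.
Proof.
move=> e; apply/eqP; rewrite -subr_eq0; apply/negPn/negP => /poly_nonroot[t].
by rewrite hornerD hornerN e subrr eqxx.
Qed.

End PolyEval.

Section MpolyEval.
Variables (K : numDomainType) (n : nat).
Implicit Types (p : {mpoly K[n]}) (v : 'I_n -> K) (c : {set 'I_n} -> K).

Lemma meval_varcoef_upd k j p v t :
  (varcoef k j p).@[upd v k t] = (varcoef k j p).@[v].
Proof.
rewrite !mevalE !big_seq; apply: eq_bigr => m /varcoef_free mk; congr (_ * _).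
by apply: eq_bigr => l _; rewrite /upd; case: eqP => // ->; rewrite mk !expr0.
Qed.

(** Values determine a polynomial over an infinite domain. Coefficients in x_k are thus found from
    values on a line, without expanding p. *)
Lemma meval_varcoef k p v (Q : {poly K}) :
  (forall t, p.@[upd v k t] = Q.[t]) -> forall j, (varcoef k j p).@[v] = Q`_j.
Proof.
move=> e j; pose d := (msize p + j.+1)%N.
suff -> : Q = \poly_(l < d) (varcoef k l p).@[v].
  by rewrite coef_poly /d ltn_addl.
apply: poly_ext => t; rewrite -e horner_poly.
rewrite {1}(@varcoefE _ _ k d p) => [|m mp]; last first.
  rewrite /d (leq_trans _ (leq_addr _ _)) // (leq_ltn_trans _ (msize_mdeg_lt mp)) //.
  by rewrite mdegE (bigD1 k) //= leq_addr.
rewrite raddf_sum; apply: eq_bigr => l _ /=.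
rewrite mevalM rmorphXn /= mevalXU meval_varcoef_upd.
by rewrite /upd eqxx.
Qed.

Lemma mcoeff_varcoef k j p (m : 'X_{1..n}) : m k = 0%N ->
  (varcoef k j p)@_m = p@_(m + U_(k) *+ j).
Proof.
move=> mk; rewrite raddf_sum /=.
under eq_bigr do rewrite mcoeffZ mcoeffX.
have [mp|mp] := boolP (m + U_(k) *+ j \in msupp p)%MM; last first.
  rewrite [RHS]memN_msupp_eq0 // big_seq_cond big1 // => m' /andP[m'p /eqP m'k].
  case: eqP => [e|]; last by rewrite mulr0.
  case/negP: mp; suff -> : (m + U_(k) *+ j)%MM = m' by [].
  rewrite -e submK //; apply/mnm_lepP => l; rewrite mulmnE mnm1E.
  by case: eqP => [<-|]; rewrite ?mul1n ?m'k // mul0n.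
have jk : ((m + U_(k) *+ j)%MM k == j)%N by rewrite mnmDE mulmnE mnm1E eqxx mul1n mk add0n.
rewrite big_mkcond (bigD1_seq (m + U_(k) *+ j)%MM) ?msupp_uniq //=.
rewrite big1 ?addr0 => [|m' m'n].
  rewrite jk (_ : _ == m) ?mulr1 //; apply/eqP/mnmP => l.
  by rewrite mnmBE mnmDE addnK.
case: ifP => // /eqP m'k; case: eqP => [e|]; last by rewrite mulr0.
case/eqP: m'n; rewrite -e submK //; apply/mnm_lepP => l; rewrite mulmnE mnm1E.
by case: eqP => [<-|]; rewrite ?mul1n ?m'k // mul0n.
Qed.

End MpolyEval.

Section MpolyEvalZero.
Variables (K : numDomainType) (n : nat).
Implicit Types (p : {mpoly K[n]}) (v : 'I_n -> K) (c : {set 'I_n} -> K).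

Lemma mpoly_eval_eq0 p : (forall v, p.@[v] = 0) -> p = 0.
Proof.
move=> p0; apply/mpolyP => m; rewrite mcoeff0.
(* The variables are removed one at a time by passing to a coefficient; those outside s no longer
   occur in the monomial m'. *)
have H (s : seq 'I_n) q (m' : 'X_{1..n}) : uniq s -> (forall i, i \notin s -> m' i = 0%N) ->
    (forall v, q.@[v] = 0) -> q@_m' = 0.
  elim: s q m' => [|k s IHs] q m' /=.
    move=> _ m'0 q0; have -> : m' = 0%MM by apply/mnmP => i; rewrite mnmE m'0.
    rewrite -[RHS](q0 (fun _ => 0)) mevalE.
    have [q0m|q0m] := boolP (0%MM \in msupp q); last first.
      rewrite memN_msupp_eq0 // big_seq big1 // => m2 m2q.
      have [i m2i] : exists i, m2 i != 0%N.
        apply/existsP; rewrite -[X in is_true X]negbK negb_exists.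
        apply: contra q0m => /forallP h; suff <- : m2 = 0%MM by [].
        by apply/mnmP => i; rewrite mnmE; apply/eqP; rewrite -[X in is_true X]negbK.
      by rewrite (bigD1 i) //= expr0n (negPf m2i) mul0r mulr0.
    rewrite (bigD1_seq 0%MM) ?msupp_uniq //= big1 ?mulr1 => [|i _]; last by rewrite mnmE expr0.
    rewrite big1 ?addr0 // => m2 m2n.
    have [i m2i] : exists i, m2 i != 0%N.
      apply/existsP; rewrite -[X in is_true X]negbK negb_exists.
      apply: contra m2n => /forallP h; apply/eqP.
      by apply/mnmP => i; rewrite mnmE; apply/eqP; rewrite -[X in is_true X]negbK.
    by rewrite (bigD1 i) //= expr0n (negPf m2i) mul0r mulr0.
  move=> /andP[ks us] m'0 q0.
  pose m2 := [multinom (if i == k then 0%N else m' i) | i < n].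
  have m2k : m2 k = 0%N by rewrite mnmE eqxx.
  have -> : m' = (m2 + U_(k) *+ m' k)%MM.
    apply/mnmP => i; rewrite mnmDE mulmnE mnm1E mnmE eq_sym.
    by case: eqP => [->|]; rewrite ?mul1n ?mul0n ?addn0.
  rewrite -mcoeff_varcoef //; apply: IHs => // [i i_s|v].
    by rewrite mnmE; case: eqP => // /eqP ik; rewrite m'0 // inE negb_or ik.
  by rewrite (@meval_varcoef _ _ _ _ _ 0) ?coef0 // => t; rewrite q0 horner0.
by apply: (H (enum 'I_n)) => //; rewrite ?enum_uniq // => i; rewrite mem_enum.
Qed.

Lemma meval_fpoly c v : (fpoly c).@[v] = mform c v (fun _ => 1).
Proof.
rewrite /fpoly raddf_sum; apply: eq_bigr => S _ /=.
rewrite mevalZ rmorph_prod; congr (_ * _); rewrite big_mkcond; apply: eq_bigr => i _.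
by rewrite inE; case: (i \in S); rewrite /= ?mevalXU.
Qed.

Lemma mderiv_sum (I : Type) (r : seq I) (P : pred I) (F : I -> {mpoly K[n]}) i :
  (\sum_(x <- r | P x) F x)^`M(i) = \sum_(x <- r | P x) (F x)^`M(i).
Proof. exact: (big_morph _ (mderivD i) (mderiv0 _ i)). Qed.

Lemma meval_mderiv_fpoly c v i :
  ((fpoly c)^`M(i)).@[v] = mcoef1 c i v (fun _ => 1) false.
Proof.
rewrite fpolyE mderiv_sum raddf_sum; apply: eq_bigr => S _ /=.
rewrite mderivZ mderivX !mevalZ mevalX; congr (_ * _).
rewrite [RHS](bigD1 i) //= /upd eqxx mnmE.
case iS: (i \in S); rewrite /= ?mul0r // !mul1r.
rewrite (bigD1 i) //= mnmBE !mnmE eqxx iS expr0 mul1r.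
apply: eq_bigr => l li; rewrite mnmBE !mnmE eq_sym (negPf li) subn0.
by case: (l \in S).
Qed.

Lemma meval_mderiv2_fpoly c v i j : i != j ->
  ((fpoly c)^`M(i)^`M(j)).@[v] = mcoef2 c i j v (fun _ => 1) false false.
Proof.
move=> nij; rewrite fpolyE [_^`M(i)]mderiv_sum mderiv_sum raddf_sum; apply: eq_bigr => S _ /=.
rewrite mderivZ mderivX !mderivZ mderivX !mevalZ mevalX; congr (_ * _).
rewrite [RHS](bigD1 i) //= [X in _ = _ * X](bigD1 j) 1?eq_sym //= /upd !eqxx.
rewrite [j == i]eq_sym (negPf nij) mnmBE !mnmE (negPf nij) subn0.
case iS: (i \in S); rewrite /= ?mul0r //.
case jS: (j \in S); rewrite /= ?mul0r ?mulr0 // !mul1r.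
rewrite (bigD1 i) //= (bigD1 j) 1?eq_sym //= !mnmBE !mnmE eqxx iS jS /=.
rewrite eqxx (negPf nij) [j == i]eq_sym (negPf nij) !expr0 !mul1r.
apply: eq_bigr => l /andP[li lj]; rewrite !mnmBE !mnmE [i == l]eq_sym (negPf li).
by rewrite [j == l]eq_sym (negPf lj) !subn0; case: (l \in S).
Qed.

Lemma meval_rayleigh c v i j : i != j ->
  (rayleigh i j (fpoly c)).@[v] = ray c i j v (fun _ => 1).
Proof.
move=> nij; rewrite /rayleigh mevalB !mevalM !meval_mderiv_fpoly.
rewrite meval_mderiv2_fpoly // meval_fpoly.
have e1 (z : 'I_n -> K) : z =1 upd (upd z j (z j)) i (z i).
  by move=> l; rewrite /upd; case: eqP => [->|_] //; case: eqP => [->|].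
rewrite (eq_mform _ (e1 v) (e1 (fun _ => 1))) mform_mcoef2 //.
rewrite /mcoef1.
have e2 (z : 'I_n -> K) s : upd z i s =1 upd (upd z j (z j)) i s.
  by move=> l; rewrite /upd; case: (l == i) => //; case: eqP => [->|].
have e3 (z : 'I_n -> K) s : upd z j s =1 upd (upd z j s) i (z i).
  by move=> l; rewrite /upd; case: (eqVneq l i) => [->|_] //; rewrite (negPf nij).
rewrite (eq_mform _ (e2 v _) (e2 (fun _ => 1) _)) mform_mcoef2 //.
rewrite (eq_mform _ (e3 v _) (e3 (fun _ => 1) _)) mform_mcoef2 //.
rewrite /ray /ray4 /=; set C := mcoef2 _ _ _ _ _; ring.
Qed.

Lemma mcoef3_upd c i j k (x w : 'I_n -> K) (p r : K) s t : i != j -> i != k -> j != k ->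
  mcoef2 c i j (upd x k p) (upd w k r) s t =
  p * mcoef3 c i j k x w s t false + r * mcoef3 c i j k x w s t true.
Proof.
move=> nij nik njk.
have swap (z : 'I_n -> K) q d e : upd (upd (upd z k q) j d) i e =1 upd (upd (upd z j d) i e) k q.
  move=> l; rewrite /upd; case: (eqVneq l k) => [->|_] //.
  by rewrite eq_sym (negPf nik) eq_sym (negPf njk).
rewrite /mcoef3 /mcoef2 /mcoef1 !(eq_mform _ (swap _ _ _ _) (swap _ _ _ _)).
exact: mform_upd.
Qed.

Lemma meval_discr c v i j k : i != j -> i != k -> j != k ->
  (discr k (rayleigh i j (fpoly c))).@[v] = hyp c i j k v (fun _ => 1).
Proof.
move=> nij nik njk.
pose T := mcoef3 c i j k v (fun _ => 1).
pose Q : {poly K} := Poly [:: ray4 (fun s t => T s t true);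
  T true false true * T false true false + T true false false * T false true true
  - T false false true * T true true false - T false false false * T true true true;
  ray4 (fun s t => T s t false)].
have e t : (rayleigh i j (fpoly c)).@[upd v k t] = Q.[t].
  rewrite meval_rayleigh // /ray /ray4.
  have e1 : (fun _ : 'I_n => 1 : K) =1 upd (fun _ => 1) k 1 by move=> l; rewrite /upd; case: eqP.
  rewrite !(eq_mcoef2 c i j _ _ (fun _ => erefl) e1) !mcoef3_upd //.
  rewrite -/T horner_Poly /= /ray4; ring.
rewrite /discr mevalB !mevalM rmorph_nat !(meval_varcoef e) !coef_Poly /=.
rewrite /hyp /hyp8 -/T /ray4; clearbody T; ring.
Qed.

End MpolyEvalZero.

Section VecAct.
Variables (K : numDomainType) (n : nat).
Implicit Types (a c : {set 'I_n} -> K) (x w v : 'I_n -> K) (s : 'S_n).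

Definition perm_vec s a (S : {set 'I_n}) : K := a (s @^-1: S).

Lemma mform_perm_vec s a x w : mform (perm_vec s a) x w = mform a (x \o s) (w \o s).
Proof.
have sK (S : {set 'I_n}) : s @^-1: (s @: S) = S.
  by apply/setP => i; rewrite inE mem_imset //; exact: perm_inj.
rewrite /mform (reindex (fun S : {set 'I_n} => s @: S)) /=; last first.
  exists (fun S : {set 'I_n} => s @^-1: S) => S _; first exact: sK.
  by apply/setP => i; rewrite -{1}(permKV s i) mem_imset ?inE ?permKV //; exact: perm_inj.
apply: eq_bigr => S _; rewrite /perm_vec sK.
congr (_ * _); rewrite (reindex_inj (@perm_inj _ s)) /=.
by apply: eq_bigr => i _; rewrite mem_imset //; exact: perm_inj.
Qed.

Lemma msym_fpoly s a : msym s (fpoly a) = fpoly (perm_vec s a).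
Proof.
apply/eqP; rewrite -subr_eq0; apply/eqP/mpoly_eval_eq0 => v.
rewrite mevalB !meval_fpoly mform_perm_vec -[mform a _ _]meval_fpoly.
apply/eqP; rewrite subr_eq0; apply/eqP.
rewrite [fpoly a]mpolyE [msym _ _]raddf_sum !raddf_sum /=; apply: eq_bigr => m _ /=.
rewrite msymZ !mevalZ; congr (_ * _).
rewrite msymX !mevalX [RHS](reindex_inj (@perm_inj _ s^-1)) /=.
by apply: eq_bigr => i _; rewrite mnmE permKV.
Qed.

Lemma meval_sl2_act_fpoly (g : 'I_n -> 'M[K]_2) c v :
  (sl2_act g (fpoly c)).@[v] = mform c (actx g v (fun _ => 1)) (actw g v (fun _ => 1)).
Proof.
pose M (S : {set 'I_n}) := [multinom (i \notin S : nat) | i < n].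
(* The action is a sum over the support; listing the latter by the sets with nonzero coefficient
   turns it into the sum over all sets in [mform]. *)
have suppE : perm_eq (msupp (fpoly c)) [seq M T | T <- [seq T <- index_enum {set 'I_n} | c T != 0]].
  apply: uniq_perm; first exact: msupp_uniq.
    rewrite map_inj_uniq ?filter_uniq ?index_enum_uniq // => S T /mnmP e.
    by apply/setP => i; move: (e i); rewrite !mnmE; do 2!case: (i \in _).
  move=> m; apply/idP/mapP => [mf|[S + ->]]; last first.
    by rewrite mem_filter mcoeff_msupp => /andP[cS _]; rewrite -/(fcoef _ _) fpolyK.
  have e : m = M [set i | m i == 0%N].
    apply/mnmP => i; rewrite mnmE inE.
    by have := @multiaffine_fpoly _ _ c m mf i; case: (m i) => [|[]].
  exists [set i | m i == 0%N] => //; rewrite mem_filter mem_index_enum andbT.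
  by rewrite -(fpolyK c) /fcoef -/(M _) -e -mcoeff_msupp.
rewrite /sl2_act (perm_big _ suppE) /= big_map big_filter raddf_sum /=.
rewrite /mform big_mkcond; apply: eq_bigr => S _ /=.
case: eqP => /= [->|_]; first by rewrite mul0r.
rewrite mevalZ -/(fcoef _ _) fpolyK rmorph_prod; congr (_ * _).
apply: eq_bigr => i _; rewrite mnmE rmorphM !rmorphXn /= !mevalD !mevalZ !mevalXU !mevalC.
by rewrite /actx /actw !mulr1; case: (i \in S); rewrite /= ?expr0 ?expr1 ?mul1r ?mulr1.
Qed.

Lemma vec_actE (g : 'I_n -> 'M[K]_2) s a : vec_act g s a =1 sl2c g (perm_vec s a).
Proof.
move=> S; rewrite /vec_act /poly_act msym_fpoly -[RHS]fpolyK; congr (fcoef _ S).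
apply/eqP; rewrite -subr_eq0; apply/eqP/mpoly_eval_eq0 => v.
by rewrite mevalB meval_sl2_act_fpoly meval_fpoly mform_act subrr.
Qed.

End VecAct.

Lemma perm_map (T : finType) (s t : seq T) : size s = size t -> uniq s -> uniq t ->
  exists p : {perm T}, [seq p x | x <- s] = t.
Proof.
elim: s t => [|x s IHs] [|y t] //=; first by exists 1%g.
move=> [est] /andP[xs us] /andP[yt ut]; have [p ep] := IHs t est us ut.
exists (p * tperm (p x) y)%g; rewrite permM tpermL; congr (_ :: _).
rewrite -ep; apply/eq_in_map => z zs; rewrite permM tpermD //.
  by rewrite (inj_eq perm_inj); apply: contraNneq xs => ->.
by apply: contraNneq yt => ->; rewrite -ep map_f.
Qed.

Section Lines.
Variables (K : comNzRingType) (n : nat).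
Implicit Types (a c : {set 'I_n} -> K) (x w v : 'I_n -> K).

Lemma mcoef3_line c i j k l x w p r s t u : i != l -> j != l -> k != l ->
  mcoef3 c i j k (upd x l p) (upd w l r) s t u =
    p * mcoef3 c i j k (upd x l 1) (upd w l 0) s t u
  + r * mcoef3 c i j k (upd x l 0) (upd w l 1) s t u.
Proof.
move=> nil njl nkl.
have swap (z : 'I_n -> K) q b d e :
    upd (upd (upd (upd z l q) k b) j d) i e =1 upd (upd (upd (upd z k b) j d) i e) l q.
  move=> h; rewrite /upd; case: (eqVneq h l) => [->|_] //.
  by rewrite eq_sym (negPf nil) eq_sym (negPf njl) eq_sym (negPf nkl).
rewrite /mcoef3 /mcoef2 /mcoef1 !(eq_mform _ (swap _ _ _ _ _) (swap _ _ _ _ _)).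
exact: mform_upd.
Qed.

Lemma size_lin (p r : K) : (size (p%:P * 'X + r%:P)%R <= 2)%N.
Proof. by rewrite size_MXaddC; case: ifP => // _; rewrite ltnS size_polyC leq_b1. Qed.

Lemma size_mul_leq (p q : {poly K}) d e : (size p <= d.+1)%N -> (size q <= e.+1)%N ->
  (size (p * q)%R <= (d + e).+1)%N.
Proof.
move=> sp sq; apply: leq_trans (size_polyMleq _ _) _.
by rewrite -subn1 leq_subLR add1n -addSn -addnS leq_add.
Qed.

Lemma size_sub_leq (p q : {poly K}) d : (size p <= d)%N -> (size q <= d)%N ->
  (size (p - q)%R <= d)%N.
Proof.
by move=> sp sq; apply: leq_trans (size_polyD _ _) _; rewrite geq_max size_polyN sp.
Qed.

Lemma size_add_leq (p q : {poly K}) d : (size p <= d)%N -> (size q <= d)%N ->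
  (size (p + q)%R <= d)%N.
Proof. by move=> sp sq; apply: leq_trans (size_polyD _ _) _; rewrite geq_max sp. Qed.

Lemma eq_hyp8 (S T : bool -> bool -> bool -> K) :
  (forall s t u, S s t u = T s t u) -> hyp8 S = hyp8 T.
Proof. by move=> e; rewrite /hyp8 !e. Qed.

Definition hyp8_line (A B : bool -> bool -> bool -> K) : {poly K} :=
  @hyp8 {poly K} (fun s t u => (A s t u)%:P * 'X + (B s t u)%:P).

Lemma size_hyp8_line A B : (size (hyp8_line A B) <= 5)%N.
Proof.
have H s t u s' t' u' := size_mul_leq (size_lin (A s t u) (B s t u))
  (size_lin (A s' t' u') (B s' t' u')).
rewrite /hyp8_line /hyp8 expr2.
apply: size_sub_leq; first by apply: (@size_mul_leq _ _ 2 2);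
  do 2?apply: size_sub_leq; rewrite ?size_add_leq ?H.
apply: (@size_mul_leq _ _ 2 2); rewrite ?size_sub_leq ?H //.
by rewrite -polyC_natr -[2%N]/(0 + 2)%N; apply: size_mul_leq;
  rewrite ?size_sub_leq ?H // size_polyC leq_b1.
Qed.

Lemma horner_hyp8_line A B t :
  (hyp8_line A B).[t] = hyp8 (fun p q r => A p q r * t + B p q r).
Proof. by rewrite /hyp8_line /hyp8 -(polyC_natr _ 4) !hornerE. Qed.

Lemma hyp_line c i j k l x w (p0 p1 r0 r1 : K) : i != l -> j != l -> k != l ->
  exists2 Q : {poly K}, (size Q <= 5)%N &
    forall t, hyp c i j k (upd x l (p0 + p1 * t)) (upd w l (r0 + r1 * t)) = Q.[t].
Proof.
move=> nil njl nkl.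
pose X := mcoef3 c i j k (upd x l 1) (upd w l 0).
pose W := mcoef3 c i j k (upd x l 0) (upd w l 1).
exists (hyp8_line (fun s t u => p1 * X s t u + r1 * W s t u)
                  (fun s t u => p0 * X s t u + r0 * W s t u)).
  exact: size_hyp8_line.
move=> t; rewrite horner_hyp8_line; apply: eq_hyp8 => s q u.
by rewrite mcoef3_line // -/(X _ _ _) -/(W _ _ _); ring.
Qed.

End Lines.

Section Standard.
Variables (K : comNzRingType) (n : nat).
Implicit Types (a c : {set 'I_n} -> K).

Lemma mcoef3_10 a i j k s t u (S : {set 'I_n}) :
  (forall l, (l \in S) = (if l == i then s else if l == j then t else (l == k) && u)) ->
  mcoef3 a i j k (fun _ => 1) (fun _ => 0) s t u = a S.
Proof.
move=> eS; rewrite -(mform_set a); apply: eq_mform => l; rewrite eS /upd.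
  by case: (l == i) => //; case: (l == j) => //; case: (l == k).
by case: (l == i) => //; case: (l == j) => //; case: (l == k).
Qed.

(** The theorem speaks of the single point x = 1, w = 0; the group moves it to all the others. *)
Lemma HypDetE a i j k : i != j -> i != k -> j != k ->
  HypDet i j k a = hyp a i j k (fun _ => 1) (fun _ => 0).
Proof.
move=> nij nik njk; rewrite /HypDet /hyp /hyp8.
have H s t u := @mcoef3_10 a i j k s t u.
rewrite (H true true true [set i; j; k]) ?(H true true false [set i; j])
  ?(H true false true [set i; k]) ?(H false true true [set j; k])
  ?(H true false false [set i]) ?(H false true false [set j])
  ?(H false false true [set k]) ?(H false false false set0) //.
all: move=> l; rewrite !inE; case: (eqVneq l i) => [e|_];
  [by rewrite ?e ?(negPf nij) ?(negPf nik)|case: (eqVneq l j) => [e|_];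
  by rewrite ?e ?(negPf njk) ?andbT ?andbF].
Qed.

Lemma ray_standard a i j : i != j ->
  a [set i] * a [set j] - a set0 * a [set i; j] = ray a i j (fun _ => 1) (fun _ => 0).
Proof.
move=> nij; rewrite /ray /ray4.
have H s t (S : {set 'I_n}) : (forall l, (l \in S) = (if l == i then s else (l == j) && t)) ->
    mcoef2 a i j (fun _ => 1) (fun _ => 0) s t = a S.
  move=> eS; rewrite -(mform_set a); apply: eq_mform => l; rewrite eS /upd.
    by case: (l == i) => //; case: (l == j).
  by case: (l == i) => //; case: (l == j).
rewrite (H true true [set i; j]) ?(H true false [set i]) ?(H false true [set j])
  ?(H false false set0) //.
all: move=> l; rewrite !inE; case: (eqVneq l i) => [e|_];
  by rewrite ?e ?(negPf nij) ?andbT ?andbF.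
Qed.

End Standard.

Section PermAct.
Variables (K : numDomainType) (n : nat).
Implicit Types (a c : {set 'I_n} -> K) (x w : 'I_n -> K) (s : 'S_n).

Lemma upd_perm s x i u : upd x (s i) u \o s =1 upd (x \o s) i u.
Proof. by move=> l; rewrite /upd /= (inj_eq perm_inj). Qed.

Lemma mcoef2_perm_vec s a i j x w p q :
  mcoef2 (perm_vec s a) (s i) (s j) x w p q = mcoef2 a i j (x \o s) (w \o s) p q.
Proof.
rewrite /mcoef2 /mcoef1 mform_perm_vec; apply: eq_mform => l;
by rewrite upd_perm /upd; case: (l == i) => //=; rewrite (inj_eq perm_inj).
Qed.

Lemma ray_perm_vec s a i j x w :
  ray (perm_vec s a) (s i) (s j) x w = ray a i j (x \o s) (w \o s).
Proof. by rewrite /ray /ray4 !mcoef2_perm_vec. Qed.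

Lemma hyp_perm_vec s a i j k x w :
  hyp (perm_vec s a) (s i) (s j) (s k) x w = hyp a i j k (x \o s) (w \o s).
Proof.
apply: eq_hyp8 => p q u; rewrite /mcoef3 mcoef2_perm_vec.
by apply: eq_mcoef2; exact: upd_perm.
Qed.

Lemma ray_vec_act (g : 'I_n -> 'M[K]_2) s a i j x w : i != j ->
  (forall l, \det (g l) = 1) ->
  ray (vec_act g s a) (s i) (s j) x w = ray a i j (actx g x w \o s) (actw g x w \o s).
Proof.
move=> nij dg; rewrite -ray_perm_vec -[RHS]mul1r.
transitivity (ray (sl2c g (perm_vec s a)) (s i) (s j) x w).
  by rewrite /ray /ray4; congr (_ * _ - _ * _); apply: eq_bigr => S _; rewrite vec_actE.
by rewrite ray_act ?(inj_eq perm_inj) // !dg mulr1.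
Qed.

Lemma hyp_vec_act (g : 'I_n -> 'M[K]_2) s a i j k x w : i != j -> i != k -> j != k ->
  (forall l, \det (g l) = 1) ->
  hyp (vec_act g s a) (s i) (s j) (s k) x w =
  hyp a i j k (actx g x w \o s) (actw g x w \o s).
Proof.
move=> nij nik njk dg; rewrite -hyp_perm_vec -[RHS]mul1r.
transitivity (hyp (sl2c g (perm_vec s a)) (s i) (s j) (s k) x w).
  by apply: eq_hyp8 => p q u; apply: eq_bigr => S _; rewrite vec_actE.
by rewrite hyp_act ?(inj_eq perm_inj) // !dg !mulr1 expr1n.
Qed.

End PermAct.

(** * Sums of two squares and necessity *)

Section SumSquares.
Variables (K : numDomainType) (n : nat).
Implicit Types (a : {set 'I_n} -> K) (x w : 'I_n -> K) (U V : ('I_n -> K) -> ('I_n -> K) -> K).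

Definition ext2 U := forall x x' w w', x =1 x' -> w =1 w' -> U x w = U x' w'.

Definition multilin U k := forall x w p r,
  U (upd x k p) (upd w k r) =
  p * U (upd x k 1) (upd w k 0) + r * U (upd x k 0) (upd w k 1).

(** Lagrange's identity: a sum of squares of two linear forms in a pair of variables has
    discriminant -4 times the square of the determinant of the two forms. *)
Lemma hyp_sum_squares a i j k U V x w : i != j -> i != k -> j != k ->
  multilin U k -> multilin V k ->
  (forall x w, ray a i j x w = U x w ^+ 2 + V x w ^+ 2) ->
  hyp a i j k x w = - 4%:R *
   (U (upd x k 0) (upd w k 1) * V (upd x k 1) (upd w k 0)
    - U (upd x k 1) (upd w k 0) * V (upd x k 0) (upd w k 1)) ^+ 2.
Proof.
move=> nij nik njk mU mV e.
pose T := mcoef3 a i j k x w.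
have E p r := e (upd x k p) (upd w k r).
have {}E p r : ray4 (fun s t => p * T s t false + r * T s t true) =
     (p * U (upd x k 1) (upd w k 0) + r * U (upd x k 0) (upd w k 1)) ^+ 2
   + (p * V (upd x k 1) (upd w k 0) + r * V (upd x k 0) (upd w k 1)) ^+ 2.
  by rewrite -mU -mV -E /ray /ray4 !mcoef3_upd.
have := E 1 0; have := E 0 1; have := E 1 1.
rewrite !mul0r !mul1r !addr0 !add0r /ray4 /hyp /hyp8 -/T !mul1r !mul0r !addr0 !add0r.
set u0 := U _ _; set u1 := U _ _; set v0 := V _ _; set v1 := V _ _.
move=> e11 e01 e10.
(* The middle coefficient of the quadratic form is recovered by polarization from its values at (1,
   1), (0, 1) and (1, 0). *)
transitivity ((((u0 + u1) ^+ 2 + (v0 + v1) ^+ 2) - (u0 ^+ 2 + v0 ^+ 2) - (u1 ^+ 2 + v1 ^+ 2)) ^+ 2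
  - 4%:R * (u0 ^+ 2 + v0 ^+ 2) * (u1 ^+ 2 + v1 ^+ 2)); last by ring.
rewrite -e11 -e01 -e10; ring.
Qed.

End SumSquares.

Section Conditions.
Variables (K : numDomainType) (n : nat).
Implicit Types (a : {set 'I_n} -> K) (x w v : 'I_n -> K) (U V : ('I_n -> K) -> ('I_n -> K) -> K).

Lemma multilin_act (g : 'I_n -> 'M[K]_2) (s : 'S_n) U k : ext2 U -> multilin U k ->
  multilin (fun x w => U (actx g x w \o s) (actw g x w \o s)) (s k).
Proof.
move=> eU mU x w p r.
have ex p' r' : actx g (upd x (s k) p') (upd w (s k) r') \o s =1
    upd (actx g x w \o s) k (g (s k) 0 0 * p' + g (s k) 0 1 * r').
  by move=> l; rewrite -upd_perm /= actx_upd.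
have ew p' r' : actw g (upd x (s k) p') (upd w (s k) r') \o s =1
    upd (actw g x w \o s) k (g (s k) 1 0 * p' + g (s k) 1 1 * r').
  by move=> l; rewrite -upd_perm /= actw_upd.
rewrite !(eU _ _ _ _ (ex _ _) (ew _ _)) mU.
rewrite [in X in _ = X + _]mU [in X in _ = _ + X]mU; ring.
Qed.

Lemma multilin_mform_upd u (i j k : 'I_n) : k != i -> k != j ->
  multilin (fun x w => mform u (upd (upd x j 1) i 0) (upd (upd w j 0) i 1)) k.
Proof.
move=> ki kj x w p r /=.
have swap (z : 'I_n -> K) q d e : upd (upd (upd z k q) j d) i e =1 upd (upd (upd z j d) i e) k q.
  by move=> l; rewrite /upd; case: (eqVneq l k) => [->|_] //; rewrite (negPf ki) (negPf kj).
by rewrite !(eq_mform _ (swap _ _ _ _) (swap _ _ _ _)) mform_upd.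
Qed.

Lemma ext2_mform_upd u (i j : 'I_n) :
  ext2 (fun x w => mform u (upd (upd x j 1) i 0) (upd (upd w j 0) i 1)).
Proof. by move=> x x' w w' ex ew; apply: eq_mform => l; rewrite /upd ?ex ?ew. Qed.

Lemma quartic_conditions (c : {set 'I_n} -> K) (i j k l : 'I_n) U V :
  i != j -> i != k -> j != k -> k != l ->
  ext2 U -> ext2 V -> multilin U k -> multilin V k -> multilin U l -> multilin V l ->
  (forall x w, ray c i j x w = U x w ^+ 2 + V x w ^+ 2) ->
  let h := discr k (rayleigh i j (fpoly c)) in
  [/\ Bpoly l h = 0, Cpoly l h = 0 & Dpoly l h = 0].
Proof.
move=> nij nik njk nkl eU eV mUk mVk mUl mVl e h.
pose one : 'I_n -> K := fun _ => 1.
have lin W v p r t : ext2 W -> multilin W l ->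
    W (upd (upd v l t) k p) (upd one k r) =
    t * W (upd (upd v k p) l 1) (upd (upd one k r) l 0)
      + W (upd (upd v k p) l 0) (upd (upd one k r) l 1).
  move=> eW mW; rewrite -[X in _ = _ + X]mul1r -mW; apply: eW => m; rewrite /upd.
    by case: (eqVneq m k) => [->|//]; rewrite (negPf nkl).
  by case: (eqVneq m k) => [->|_]; rewrite ?(negPf nkl) // /one; case: eqP.
(* Q is -4 (al t^2 + be t + ga)^2, where the quadratic polynomial is the determinant of
   [hyp_sum_squares] on the line through v in direction l. *)
have H v : exists al be ga : K, let Q := Poly [:: - 4%:R * ga ^+ 2; - 8%:R * (be * ga);
     - 4%:R * (be ^+ 2 + 2%:R * (al * ga)); - 8%:R * (al * be); - 4%:R * al ^+ 2] in
    forall d, (varcoef l d h).@[v] = Q`_d.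
  pose X p r W := W (upd (upd v k p) l 1) (upd (upd one k r) l 0) : K.
  pose Y p r W := W (upd (upd v k p) l 0) (upd (upd one k r) l 1) : K.
  exists (X 0 1 U * X 1 0 V - X 1 0 U * X 0 1 V).
  exists (X 0 1 U * Y 1 0 V + Y 0 1 U * X 1 0 V - X 1 0 U * Y 0 1 V - Y 1 0 U * X 0 1 V).
  exists (Y 0 1 U * Y 1 0 V - Y 1 0 U * Y 0 1 V) => Q d.
  apply: meval_varcoef => t.
  rewrite meval_discr // (hyp_sum_squares _ _ nij nik njk mUk mVk e) !lin // -!/(X _ _ _) -!/(Y _ _ _).
  rewrite /Q horner_Poly /=; clearbody X Y; ring.
split; apply: mpoly_eval_eq0 => v; have [al [be [ga e']]] := H v.
- by rewrite /Bpoly mevalB !mevalM !e' !coef_Poly /=; ring.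
- rewrite /Cpoly !mevalD mevalN !mevalM !rmorph_nat !e' !coef_Poly /=; ring.
- rewrite /Dpoly !mevalD mevalN !mevalM !rmorph_nat !e' !coef_Poly /=; ring.
Qed.

End Conditions.

Section Forward.
Variables (R : rcfType) (n : nat).

Lemma restrict_first0 d : restrict_first d (0 : {mpoly R[n]}) = 0.
Proof. exact: raddf0. Qed.

(* For a Hermitian matrix the Rayleigh difference is U^2 + V^2 with U and V real
   and multiaffine in the other variables, and its discriminant in one of them is
   -4 times the square of a Wronskian. *)
Lemma minors_conditions (A : 'M[R[i]]_n) (a : {set 'I_n} -> R) :
  A \is hermsymmx -> (forall S, principal_minor A S = (a S)%:C%C) ->
  forall (g : 'I_n -> 'M[R]_2) (s : 'S_n), (forall i, \det (g i) = 1) ->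
  let a' := vec_act g s a in
  [/\ forall i1 i2 : 'I_n, i1 != i2 -> ray a' i1 i2 (fun _ => 1) (fun _ => 0) >= 0,
      forall i1 i2 i3 : 'I_n, i1 != i2 -> i1 != i3 -> i2 != i3 ->
        hyp a' i1 i2 i3 (fun _ => 1) (fun _ => 0) <= 0
    & forall i1 i2 i3 i4 : 'I_n, i1 != i2 -> i1 != i3 -> i2 != i3 ->
        i1 != i4 -> i2 != i4 -> i3 != i4 ->
        let h := discr i3 (rayleigh i1 i2 (fpoly a')) in
        [/\ Bpoly i4 h = 0, Cpoly i4 h = 0 & Dpoly i4 h = 0]].
Proof.
move=> hA ea g s dg a'.
have H (i1 i2 : 'I_n) : i1 != i2 -> exists U V, [/\ ext2 U, ext2 V,
   forall k, i1 != k -> i2 != k -> multilin U k /\ multilin V k &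
   forall x w, ray a' i1 i2 x w = U x w ^+ 2 + V x w ^+ 2].
  move=> n12; pose i := (s^-1)%g i1; pose j := (s^-1)%g i2.
  have nij : i != j by rewrite (inj_eq perm_inj).
  have [u [v e]] := ray_sum_squares hA ea nij.
  have e1 : i1 = s i by rewrite /i permKV.
  have e2 : i2 = s j by rewrite /j permKV.
  pose F u := fun x w : 'I_n -> R => mform u (upd (upd x j 1) i 0) (upd (upd w j 0) i 1).
  have eF u' : ext2 (F u') by exact: ext2_mform_upd.
  exists (fun x w => F u (actx g x w \o s) (actw g x w \o s)).
  exists (fun x w => F v (actx g x w \o s) (actw g x w \o s)); split.
  - by move=> x x' w w' ex ew; apply: eF => l /=; rewrite /actx /actw ex ew.
  - by move=> x x' w w' ex ew; apply: eF => l /=; rewrite /actx /actw ex ew.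
  - move=> k ki kj; rewrite -(permKV s k).
    have ki' : (s^-1)%g k != i by rewrite (inj_eq perm_inj) eq_sym.
    have kj' : (s^-1)%g k != j by rewrite (inj_eq perm_inj) eq_sym.
    by split; [apply: (multilin_act g s (eF u))|apply: (multilin_act g s (eF v))];
      exact: multilin_mform_upd.
  - by move=> x w; rewrite e1 e2 ray_vec_act // e.
split.
- move=> i1 i2 n12; have [U [V [_ _ _ ->]]] := H _ _ n12.
  by rewrite addr_ge0 // sqr_ge0.
- move=> i1 i2 i3 n12 n13 n23; have [U [V [eU eV m e]]] := H _ _ n12.
  have [mU mV] := m i3 n13 n23.
  rewrite (hyp_sum_squares _ _ n12 n13 n23 mU mV e) mulNr oppr_le0.
  by rewrite mulr_ge0 // sqr_ge0.
move=> i1 i2 i3 i4 n12 n13 n23 n14 n24 n34; have [U [V [eU eV m e]]] := H _ _ n12.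
have [mU3 mV3] := m i3 n13 n23; have [mU4 mV4] := m i4 n14 n24.
exact: quartic_conditions n12 n13 n23 n34 eU eV mU3 mV3 mU4 mV4 e.
Qed.

End Forward.

(** * The conditions on the whole orbit *)

Section Quartic.
Variable (R : rcfType).

(* If b_0 != 0, the equations C = D = 0 give b_3 and b_4 in terms of b_0, b_1, b_2;
   they are the values for b_0 times the square of a quadratic polynomial. The
   shift by u makes b_0 nonzero. *)
Lemma quartic_neg_square (Q : {poly R}) : (size Q <= 5)%N ->
  (forall t, Q.[t] <= 0) ->
  (forall u, let b j := (Q \Po (u%:P - 'X))`_j in
     b 1%N ^+ 3 - 4%:R * b 0%N * b 1%N * b 2%N + 8%:R * b 0%N ^+ 2 * b 3%N = 0
     /\ b 1%N ^+ 2 * b 2%N - 4%:R * b 0%N * b 2%N ^+ 2 + 2%:R * b 0%N * b 1%N * b 3%N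
          + 16%:R * b 0%N ^+ 2 * b 4%N = 0) ->
  exists s : {poly R}, forall t, Q.[t] = - s.[t] ^+ 2.
Proof.
move=> sQ Q_le0 HQ; have [->|/poly_nonroot[u Qu]] := eqVneq Q 0.
  by exists 0 => t; rewrite !horner0 expr0n oppr0.
have [] := HQ u%:R; set q := Q \Po _; set b := fun j => q`_j.
rewrite -/(b 0%N) -/(b 1%N) -/(b 2%N) -/(b 3%N) -/(b 4%N) => eC eD.
have b0E : b 0%N = Q.[u%:R].
  by rewrite /b -horner_coef0 horner_comp !hornerE subr0.
have b0 : b 0%N != 0 by rewrite b0E.
have b0_lt0 : b 0%N < 0 by rewrite lt_neqAle b0 b0E Q_le0.
have sq : (size q <= 5)%N.
  apply: leq_trans (size_comp_poly_leq _ _) _.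
  have -> : size (u%:R%:P - 'X : {poly R}) = 2%N by rewrite -size_polyN opprB size_XsubC.
  by rewrite muln1 -ltnS; case: (size Q) sQ.
pose c := Num.sqrt (- b 0%N).
have cE : c ^+ 2 = - b 0%N by rewrite sqr_sqrtr // oppr_ge0 ltW.
(* 1 + be z + ka z^2 is the expansion of the square root of q / b_0 to second order. *)
pose be := b 1%N / (2%:R * b 0%N).
pose ka := (b 2%N / b 0%N - b 1%N ^+ 2 / (4%:R * b 0%N ^+ 2)) / 2%:R.
exists ((c%:P * (1 + be%:P * 'X + ka%:P * 'X ^+ 2)) \Po (u%:R%:P - 'X)) => t.
have -> : Q.[t] = q.[u%:R - t].
  by rewrite horner_comp !hornerE; congr (Q.[_]); rewrite opprB addrC subrK.
rewrite [X in _ = - (X ^+ 2)]horner_comp.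
have -> : (u%:R%:P - 'X : {poly R}).[t] = u%:R - t by rewrite !hornerE.
set z := u%:R - t; have -> : (c%:P * (1 + be%:P * 'X + ka%:P * 'X ^+ 2)).[z] =
  c * (1 + be * z + ka * z ^+ 2) by rewrite !hornerE.
rewrite exprMn cE (horner_coef_wide _ sq) !big_ord_recl big_ord0 /= -!/(b _) /bump /=.
have e3 : b 3%N = (4%:R * b 0%N * b 1%N * b 2%N - b 1%N ^+ 3) / (8%:R * b 0%N ^+ 2).
  apply: (mulIf (_ : 8%:R * b 0%N ^+ 2 != 0)); first by rewrite mulf_neq0 ?expf_neq0 ?pnatr_eq0.
  rewrite divfK ?mulf_neq0 ?expf_neq0 ?pnatr_eq0 //; apply/eqP.
  by rewrite -subr_eq0 -eC; apply/eqP; ring.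
have e4 : b 4%N = (4%:R * b 0%N * b 2%N ^+ 2 - b 1%N ^+ 2 * b 2%N
     - 2%:R * b 0%N * b 1%N * b 3%N) / (16%:R * b 0%N ^+ 2).
  apply: (mulIf (_ : 16%:R * b 0%N ^+ 2 != 0)); first by rewrite mulf_neq0 ?expf_neq0 ?pnatr_eq0.
  rewrite divfK ?mulf_neq0 ?expf_neq0 ?pnatr_eq0 //; apply/eqP.
  by rewrite -subr_eq0 -eD; apply/eqP; ring.
rewrite e4 e3 /be /ka; field.
by rewrite b0.
Qed.

End Quartic.

Section Good.
Variables (R : rcfType) (n : nat).
Implicit Types (a : {set 'I_n} -> R) (y : 'I_n -> R).

(** Only the chart x = 1 is retained from the orbit; its origin y = 0 gives back the coefficients of
    a, and translations act on it. *)
Definition rayleigh_nonneg a := forall i j y, i != j -> 0 <= ray a i j (fun _ => 1) y.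

Definition hyperdet_neg_squares a := forall i j k l y,
  i != j -> i != k -> j != k -> i != l -> j != l -> k != l ->
  exists s : {poly R}, forall t,
    hyp a i j k (fun _ => 1) (upd y l t) = - s.[t] ^+ 2.

Definition mx22 (p q r s : R) : 'M[R]_2 :=
  \matrix_(i, j) (if i == 0 then if j == 0 then p else q else if j == 0 then r else s).

Lemma det_mx22 p q r s : \det (mx22 p q r s) = p * s - q * r.
Proof. by rewrite det_2x2 !mxE. Qed.

Lemma conditions_good a :
  (forall (g : 'I_n -> 'M[R]_2) (s : 'S_n),
     (forall i : 'I_n, \det (g i) = 1) ->
     let a' := vec_act g s a in
     [/\ forall i1 i2 : 'I_n, i1 = 0%N :> nat -> i2 = 1%N :> nat ->
           a' [set i1] * a' [set i2] - a' set0 * a' [set i1; i2] >= 0,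
         forall i1 i2 i3 : 'I_n,
           i1 = 0%N :> nat -> i2 = 1%N :> nat -> i3 = 2%N :> nat ->
           HypDet i1 i2 i3 a' <= 0
       & forall i1 i2 i3 i4 : 'I_n,
           i1 = 0%N :> nat -> i2 = 1%N :> nat -> i3 = 2%N :> nat ->
           i4 = 3%N :> nat ->
           let h := discr i3 (rayleigh i1 i2 (fpoly a')) in
           [/\ restrict_first 4 (Bpoly i4 h) = 0,
               restrict_first 4 (Cpoly i4 h) = 0
             & restrict_first 4 (Dpoly i4 h) = 0]]) ->
  rayleigh_nonneg a /\ hyperdet_neg_squares a.
Proof.
move=> H.
(* A lower unitriangular g moves the point x = 1, w = 0 to x = 1, w = y, and s brings the chosen
   indices to the first positions. *)
have low y (s : 'S_n) : let g := fun m => mx22 1 0 (y ((s^-1)%g m)) 1 in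
  [/\ forall i, \det (g i) = 1, actx g (fun _ => 1) (fun _ => 0) \o s =1 (fun _ => 1)
    & actw g (fun _ => 1) (fun _ => 0) \o s =1 y].
  split => i /=; first by rewrite det_mx22; ring.
    by rewrite /actx !mxE /=; ring.
  by rewrite /actw !mxE /= permK; ring.
have len (q : seq 'I_n) : uniq q -> (size q <= n)%N.
  by move=> uq; rewrite -(card_uniqP uq) -[n in (_ <= n)%N]card_ord max_card.
split=> [i j y nij|i j k l y nij nik njk nil njl nkl].
  have u2 : uniq [:: i; j] by rewrite /= inE nij.
  have n2 := len _ u2.
  pose i1 := Ordinal (ltnW n2 : 0 < n)%N; pose i2 := Ordinal (n2 : 1 < n)%N.
  have [//|//|s [e1 e2]] := @perm_map _ [:: i; j] [:: i1; i2] erefl.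
  have [dg ex ew] := low y s.
  have [/(_ i1 i2 erefl erefl) + _ _] := H _ s dg.
  by rewrite ray_standard // -[i1 in ray _ i1]e1 -[i2 in ray _ _ i2]e2 ray_vec_act // (eq_ray _ _ _ ex ew).
have u4 : uniq [:: i; j; k; l] by rewrite /= !inE !negb_or nij nik nil njk njl nkl.
have n4 := len _ u4.
pose i1 := Ordinal (ltnW (ltnW (ltnW n4)) : 0 < n)%N.
pose i2 := Ordinal (ltnW (ltnW n4) : 1 < n)%N.
pose i3 := Ordinal (ltnW n4 : 2 < n)%N; pose i4 := Ordinal (n4 : 3 < n)%N.
have [//|//|s [e1 e2 e3 e4]] := @perm_map _ [:: i; j; k; l] [:: i1; i2; i3; i4] erefl.
have [Q sQ eQ] := hyp_line a (fun _ => 1) y 1 0 0 1 nil njl nkl.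
have {}eQ t : hyp a i j k (fun _ => 1) (upd y l t) = Q.[t].
  rewrite -eQ; apply: eq_hyp => m; rewrite /upd; case: eqP => //= _.
    by rewrite mul0r addr0.
  by rewrite add0r mul1r.
have [sq esq] : exists s : {poly R}, forall t, Q.[t] = - s.[t] ^+ 2.
  apply: quartic_neg_square => // [t|u].
    rewrite -eQ; have [dg ex ew] := low (upd y l t) s.
    have [_ /(_ i1 i2 i3 erefl erefl erefl) + _] := H _ s dg.
    rewrite HypDetE // -[i1 in hyp _ i1]e1 -[i2 in hyp _ _ i2]e2 -[i3 in hyp _ _ _ i3]e3.
    by rewrite hyp_vec_act // (eq_hyp _ _ _ _ ex ew).
  (* The restricted equations can be evaluated at the origin for every n. This g sends the affine
     point with coordinate t at [i4] and 0 elsewhere to x = 1, with w equal to u - t at l and to y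
     elsewhere: hence the substitution u - X in [quartic_neg_square]. *)
  pose g := fun m => mx22 0 1 (-1) (upd y l u ((s^-1)%g m)).
  have dg m : \det (g m) = 1 by rewrite det_mx22; ring.
  have [_ _ /(_ i1 i2 i3 i4 erefl erefl erefl erefl)] := H g s dg.
  set h := discr i3 _ => -[_ eC eD].
  have e0 (p : {mpoly R[n]}) : restrict_first 4 p = 0 -> p.@[fun _ => 0] = 0.
    move=> ep; transitivity (restrict_first 4 p).@[fun _ => 0]; last by rewrite ep meval0.
    rewrite comp_mpoly_meval; apply: meval_eq => m.
    by rewrite tnth_mktuple; case: ifP => _; rewrite ?mevalXU ?meval0.
  have eb d : (varcoef i4 d h).@[fun _ => 0] = (Q \Po (u%:P - 'X))`_d.
    apply: meval_varcoef => t; rewrite /h meval_discr // horner_comp !hornerE -eQ.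
    rewrite -[i1 in hyp _ i1]e1 -[i2 in hyp _ _ i2]e2 -[i3 in hyp _ _ _ i3]e3.
    rewrite hyp_vec_act //; apply: eq_hyp => r /=.
      by rewrite /actx !mxE /=; ring.
    rewrite /actw !mxE /= permK /upd -e4 (inj_eq perm_inj).
    by case: (r == l); ring.
  have := e0 _ eC; rewrite /Cpoly !mevalD mevalN !mevalM !rmorph_nat !eb => {}eC.
  have := e0 _ eD; rewrite /Dpoly !mevalD mevalN !mevalM !rmorph_nat !eb => {}eD.
  by split; [rewrite -[RHS]eC|rewrite -[RHS]eD]; ring.
by exists sq => t; rewrite eQ esq.
Qed.

End Good.

(** * Orientation of the factors *)

Section NegativeCycle.
Variables (F : fieldType) (I : Type) (z : F) (P : I -> I -> {poly F}) (mu nu : I -> nat).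

Local Notation pi := ('X - z%:P).
(* If [mu i] and [nu j] are the multiplicities of the root z in w_i and in w_j^*,
   then [neg i j] is the failure at z of w_i w_j^* %| P i j; with the valuation of
   P i j minus that of w_i w_j^* as a weight, the arcs have weight at most 0. *)
Definition arc i j := ~~ (pi ^+ (mu i + nu j).+1 %| P i j).
Definition neg i j := ~~ (pi ^+ (mu i + nu j) %| P i j).

Lemma mup_prod (J : finType) (p : J -> {poly F}) : (forall r, p r != 0) ->
  (\prod_r p r != 0) && (mup z (\prod_r p r) == (\sum_r mup z (p r))%N).
Proof.
move=> p0; apply: (big_rec2 (fun q m => (q != 0) && (mup z q == m))).
  by rewrite oner_eq0 mupNroot ?rootE ?hornerC ?oner_eq0.
move=> r q m _ /andP[q0 /eqP em]; rewrite mulf_neq0 //=.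
by rewrite mupM // em.
Qed.

Lemma dvdp_prod (J : finType) (p : J -> {poly F}) (f : J -> nat) :
  (forall r, pi ^+ f r %| p r) -> pi ^+ (\sum_r f r) %| \prod_r p r.
Proof.
move=> h; apply: (big_rec2 (fun m q => pi ^+ m %| q)); first by rewrite expr0 dvd1p.
by move=> r m q _ dq; rewrite exprD dvdp_mul.
Qed.

(** By induction every value up to r is already taken: 0 by the last index, q + 1 by q < r. Only the
    step forward remains. *)
Lemma eq_shift_perm m (s : 'S_m.+1) : s ord_max = ord0 ->
  (forall r : 'I_m.+1, (s r <= r)%N \/ s r = r.+1 :> nat \/ r = ord_max) ->
  forall r : 'I_m.+1, r != ord_max -> s r = r.+1 :> nat.
Proof.
move=> s0 h [r ltr]; elim/ltn_ind: r ltr => r IHr ltr rm.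
have [le_sr|[//|e]] := h (Ordinal ltr); last by rewrite e eqxx in rm.
have rltm : (r < m)%N.
  by rewrite ltn_neqAle -ltnS ltr andbT; apply: contra rm => /eqP e; apply/eqP/val_inj.
case Es: (val (s (Ordinal ltr))) le_sr => [|q] /= le_sr.
  have : s (Ordinal ltr) = s ord_max by rewrite s0; apply: val_inj.
  by move/perm_inj => e; rewrite e eqxx in rm.
have qm : (q < m.+1)%N by rewrite (leq_trans le_sr) // ltnW.
have : s (Ordinal ltr) = s (Ordinal qm).
  apply: val_inj; rewrite Es /= IHr //.
  by apply: contraTneq (leq_trans le_sr (ltnW rltm)) => -[->]; rewrite ltnn.
by move/perm_inj => -[e]; move: le_sr; rewrite e ltnn.
Qed.

Hypothesis minors : forall m (c : 'I_m -> I), injective c ->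
  pi ^+ (\sum_r (mu (c r) + nu (c r))) %| \det (\matrix_(r, s) P (c r) (c s)).

(* In the determinant of a shortest negative cycle the term of the cycle is the
   only one whose valuation is below the bound in [minors]. *)
Lemma no_negative_cycle m (c : nat -> I) :
  (forall k, (k < m)%N -> arc (c k) (c k.+1)) -> neg (c m) (c 0%N) -> False.
Proof.
elim/ltn_ind: m c => m IHm c hc hneg.
(* A failure at a backward pair would close the shorter negative cycle from c_l to c_k. *)
have back k l : (l <= k)%N -> (k <= m)%N -> (k - l < m)%N ->
    pi ^+ (mu (c k) + nu (c l)) %| P (c k) (c l).
  move=> lk km lt; apply/negPn/negP => hn.
  apply: (IHm _ lt (fun j => c (l + j)%N)) => [j jk|]; last by rewrite addn0 subnKC.
  by rewrite addnS; apply: hc; lia.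
(* An arc that jumps ahead would be a shortcut in the cycle. *)
have forw k l : (k.+1 < l)%N -> (l <= m)%N ->
    pi ^+ (mu (c k) + nu (c l)).+1 %| P (c k) (c l).
  move=> kl lm; apply/negPn/negP => ha.
  apply: (IHm (m - (l - k.+1))%N _ (fun j => if (j <= k)%N then c j else c (j + (l - k.+1))%N)).
  - by lia.
  - move=> j jm; have [jk|jk|->] := ltngtP j k.
    + by apply: hc; lia.
    + by rewrite addSn; apply: hc; lia.
    + by have -> : (k.+1 + (l - k.+1))%N = l by lia.
  - have -> : (m - (l - k.+1) <= k)%N = false by lia.
    have -> : (m - (l - k.+1) + (l - k.+1))%N = m by lia.
    by rewrite leq0n.
(* The loop between two visits of a vertex can be cut out, leaving the closing failure in place. *)
have inj (k l : nat) : (k < l)%N -> (l <= m)%N -> c k = c l -> False.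
  move=> kl lm e; have [lltm|lgem] := ltnP l m; last first.
    have el : l = m by lia.
    apply: (IHm k _ c) => [|j jk|]; [by lia|by apply: hc; lia|].
    by rewrite e el.
  apply: (IHm (m - (l - k))%N _ (fun j => if (j <= k)%N then c j else c (j + (l - k))%N)).
  - by lia.
  - move=> j jm; have [jk|jk|->] := ltngtP j k.
    + by apply: hc; lia.
    + by rewrite addSn; apply: hc; lia.
    + rewrite e addSn; have -> : (k + (l - k))%N = l by lia.
      exact: hc.
  - have -> : (m - (l - k) <= k)%N = false by lia.
    have -> : (m - (l - k) + (l - k))%N = m by lia.
    by rewrite leq0n.
pose Q : 'M_(m.+1) := \matrix_(r, s) P (c r) (c s).
have injc : injective (fun r : 'I_m.+1 => c r).
  move=> r s e; apply: val_inj; have [rs|sr|//] := ltngtP (val r) (val s).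
    by case: (inj _ _ rs (ltn_ord s) e).
  by case: (inj _ _ sr (ltn_ord r) (esym e)).
have := minors injc.
pose g : 'S_(m.+1) := perm (@ordS_inj m.+1).
pose D (r s : 'I_m.+1) := (mu (c r) + nu (c s))%N.
pose kk (r : 'I_m.+1) := mup z (Q r (g r)).
have gmax : g ord_max = ord0 by apply: val_inj; rewrite permE /= modnn.
have glt (r : 'I_m.+1) : r != ord_max -> g r = r.+1 :> nat.
  move=> rm; rewrite permE /= modn_small // ltnS ltn_neqAle -ltnS ltn_ord andbT.
  by apply: contra rm => /eqP e; apply/eqP/val_inj.
have Q0 r : Q r (g r) != 0 /\ (kk r <= D r (g r))%N.
  suff h : ~~ (pi ^+ (D r (g r)).+1 %| Q r (g r)).
    have Qn0 : Q r (g r) != 0 by apply: contraNneq h => ->; rewrite dvdp0.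
    by split=> //; rewrite mup_leq.
  rewrite mxE /D; have [->|rm] := eqVneq r ord_max.
    by rewrite gmax; apply: contra hneg => /(dvdp_trans _); apply; rewrite dvdp_exp2l.
  by rewrite glt //; apply: hc; rewrite -ltnS -glt.
have kmax : (kk ord_max < D ord_max (g ord_max))%N.
  by rewrite mup_ltn ?(Q0 _).1 // mxE /D gmax.
have sumD (s : 'S_m.+1) : (\sum_r D r (s r) = \sum_r D r (g r))%N.
  rewrite /D !big_split /=; congr (_ + _)%N.
  transitivity (\sum_(r < m.+1) nu (c r))%N; first by rewrite [RHS](reindex_inj (@perm_inj _ s)).
  by rewrite [LHS](reindex_inj (@perm_inj _ g)).
have sumkk : (\sum_r kk r < \sum_r D r (g r))%N.
  rewrite (bigD1 ord_max) //= [X in (_ < X)%N](bigD1 ord_max) //= -addSn leq_add //.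
  by apply: leq_sum => r _; case: (Q0 r).
rewrite -[\det _]/(\det Q).
have -> : (\sum_(r < m.+1) (mu (c r) + nu (c r)) = \sum_r D r (g r))%N.
  by rewrite -(sumD 1%g); apply: eq_bigr => r _; rewrite perm1.
move/(dvdp_trans (dvdp_exp2l _ sumkk)).
rewrite /determinant (bigD1 g) //= dvdp_addl; last first.
  apply: (big_ind (fun q => pi ^+ _ %| q)) => [|p q|s sg];
    [exact: dvdp0|exact: dvdp_add|apply: dvdp_mull].
  (* A lower bound for the multiplicity of each factor in the term of s: exact where s follows the
     cycle g, given by [back] and [forw] elsewhere, with one more for a jump ahead. *)
  pose f r := (if s r == g r then kk r else D r (s r) + (r < s r))%N.
  have dvdf r : pi ^+ f r %| Q r (s r).
    rewrite /f; case: eqVneq => [->|ne].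
      by rewrite -mup_geq //; case: (Q0 r).
    rewrite mxE /D; case: ltnP => rs; rewrite ?addn1 ?addn0.
      apply: forw; last by rewrite -ltnS.
      rewrite ltn_neqAle rs andbT.
      have rm : r != ord_max by apply: contraTneq rs => ->; rewrite -leqNgt -ltnS.
      apply: contra ne => /eqP e; apply/eqP/val_inj.
      by rewrite /= -e (glt _ rm).
    apply: back => //; first by rewrite -ltnS.
    have [s0|s0] := posnP (s r); last by have := ltn_ord r; lia.
    rewrite s0 subn0 ltn_neqAle -ltnS ltn_ord andbT.
    apply: contra ne => /eqP e; have -> : r = ord_max by apply: val_inj.
    rewrite gmax; apply/eqP/val_inj; rewrite -[RHS]s0; congr (val (s _)).
    by apply: val_inj.
  apply: dvdp_trans (dvdp_prod dvdf); apply: dvdp_exp2l.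
  have sumU : (\sum_(r | s r != g r) D r (s r) = \sum_(r | s r != g r) D r (g r))%N.
    move: (sumD s); rewrite (bigID (fun r => s r == g r)) /=.
    rewrite [X in _ = X](bigID (fun r => s r == g r)) /=.
    rewrite (eq_bigr (fun r => D r (g r))) => [/addnI //|r /eqP-> //].
  rewrite (bigID (fun r => s r == g r)) [X in (_ <= X)%N](bigID (fun r => s r == g r)) /=.
  have -> : (\sum_(r | s r == g r) f r = \sum_(r | s r == g r) kk r)%N.
    by apply: eq_bigr => r e; rewrite /f e.
  rewrite -addnS leq_add2l.
  have -> : (\sum_(r | s r != g r) f r =
     \sum_(r | s r != g r) D r (g r) + \sum_(r | s r != g r) (r < s r))%N.
    rewrite -sumU -big_split /=; apply: eq_bigr => r /negPf ne.
    by rewrite /f ne.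
  have le_kkD : (\sum_(r | s r != g r) kk r <= \sum_(r | s r != g r) D r (g r))%N.
    by apply: leq_sum => r _; case: (Q0 r).
  (* Either s avoids the closing entry and gains its strict deficit, or it must jump ahead
     somewhere, since otherwise [eq_shift_perm] gives s = g. *)
  have [smax|smax] := eqVneq (s ord_max) (g ord_max); last first.
    rewrite (leq_trans _ (leq_addr _ _)) // (bigD1 ord_max) //=.
    rewrite [X in (_ < X)%N](bigD1 ord_max) //= -addSn leq_add //.
    by apply: leq_sum => r _; case: (Q0 r).
  suff: (0 < \sum_(r | s r != g r) (r < s r))%N.
    by move=> h; rewrite -addn1 leq_add.
  rewrite lt0n; apply: contra sg; rewrite sum_nat_eq0 => /forallP h0.
  have h (r : 'I_m.+1) : (s r <= r)%N \/ s r = r.+1 :> nat \/ r = ord_max.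
    have [|rm] := eqVneq r ord_max; first by right; right.
    have := h0 r; case: eqVneq => [-> _|_ /=]; first by right; left; exact: glt.
    by rewrite eqb0 -leqNgt; left.
  apply/eqP/permP => r; apply: val_inj.
  have [->|rm] := eqVneq r ord_max; first by rewrite smax.
  by rewrite /= glt // (eq_shift_perm _ h) // smax.
have /andP[p0 /eqP e] := mup_prod (fun r => (Q0 r).1).
rewrite mulr_sign; case: ifP => _; rewrite ?dvdpNr -mup_geq // e ltnn //.
Qed.

End NegativeCycle.

Section MupDvd.
Variable (F : closedFieldType).

Lemma mup_linear (p : {poly F}) r z : p != 0 -> (size p <= 2)%N -> root p r ->
  mup z p = (z == r).
Proof.
move=> p0 sp /factor_theorem[q ep].
have q0 : q != 0 by apply: contraNneq p0 => q0; rewrite ep q0 mul0r.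
have sq : (size q <= 1)%N.
  by move: sp; rewrite ep size_Mmonic ?monicXsubC // size_XsubC addn2.
rewrite ep mupMr; first by rewrite -['X - _]expr1 mup_XsubCX eq_sym; case: eqP.
rewrite (size1_polyC sq) rootC; apply: contraNneq q0 => e.
by rewrite (size1_polyC sq) e.
Qed.

Lemma dvdp_mup (p q : {poly F}) : p != 0 -> (forall z, ('X - z%:P) ^+ mup z p %| q) -> p %| q.
Proof.
have [->|q0] := eqVneq q 0; first by rewrite dvdp0.
move=> p0 h; have {}h z : (mup z p <= mup z q)%N by rewrite mup_geq.
have [s es] := closed_field_poly_normal p.
have lp : lead_coef p != 0 by rewrite lead_coef_eq0.
have {}h z : (count_mem z s <= mup z q)%N.
  by rewrite -mu_prod_XsubC -(mupMr _ (_ : ~~ root (lead_coef p)%:P z))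
     ?rootC // mul_polyC -es.
rewrite es dvdpZl //; elim: s q q0 h {es} => [|r s IHs] q q0 h.
  by rewrite big_nil dvd1p.
rewrite big_cons; have : (0 < mup r q)%N by apply: leq_trans (h r); rewrite /= eqxx.
rewrite -XsubC_dvd // => /dvdpP[q1 eq1].
have q10 : q1 != 0 by apply: contraNneq q0 => q10; rewrite eq1 q10 mul0r.
rewrite eq1 mulrC dvdp_mul // IHs // => z.
have := h z; rewrite eq1 mupM ?polyXsubC_eq0 //= -['X - _]expr1 mup_XsubCX.
by case: eqP => _; lia.
Qed.

End MupDvd.

Section Star.
Variable (R : rcfType).
Local Notation C := (R[i]).
Definition star (p : {poly C}) : {poly C} := map_poly conjc p.

Lemma starK p : star (star p) = p.
Proof. by apply/polyP => k; rewrite !coef_map /= conjcK. Qed.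

Lemma starM p q : star (p * q) = star p * star q.
Proof. exact: rmorphM. Qed.

Lemma star_eq0 p : (star p == 0) = (p == 0).
Proof. exact: map_poly_eq0. Qed.

Lemma size_star p : size (star p) = size p.
Proof. exact: size_map_poly. Qed.

Lemma root_star p z : root (star p) z = root p (z^*)%C.
Proof. exact: complex_root_conj. Qed.

Lemma dvdp_star p q : (star p %| star q) = (p %| q).
Proof. exact: dvdp_map. Qed.

Lemma star_XsubC z k : star (('X - z%:P) ^+ k) = ('X - ((z^*)%C)%:P) ^+ k.
Proof. by rewrite /star rmorphXn rmorphB /= map_polyX map_polyC. Qed.

Lemma mup_star p z : p != 0 -> mup z (star p) = mup (z^*)%C p.
Proof.
move=> p0; apply/eqP; rewrite eqn_leq; apply/andP; split.
  by rewrite mup_geq // -dvdp_star star_XsubC conjcK -mup_geq ?star_eq0.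
by rewrite mup_geq ?star_eq0 // -dvdp_star starK star_XsubC -mup_geq.
Qed.

End Star.

Section Orientation.
Variables (R : rcfType) (I : finType).
Local Notation C := (R[i]).
Variables (P : I -> I -> {poly C}) (l : I -> {poly C}) (rho : I -> I).
Hypothesis P_star : forall i j, P j i = star (P i j).
Hypothesis l_neq0 : forall i, l i != 0.
Hypothesis size_l : forall i, (size (l i) <= 2)%N.
Hypothesis P_rho : forall i j, P i j != 0 -> rho i = rho j.
Hypothesis P_root : forall i, i != rho i -> P i (rho i) = l i * star (l i).
Hypothesis l_root : forall i, l (rho i) = 1.
Hypothesis minors : forall m (c : 'I_m -> I), injective c ->
  \prod_r (l (c r) * star (l (c r))) %| \det (\matrix_(r, s) P (c r) (c s)).

Implicit Types (o : {ffun I -> bool}) (z : C).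

Definition orient o i : {poly C} := if o i then star (l i) else l i.

Lemma orient_neq0 o i : orient o i != 0.
Proof. by rewrite /orient; case: ifP; rewrite ?star_eq0. Qed.

Lemma size_orient o i : (size (orient o i) <= 2)%N.
Proof. by rewrite /orient; case: ifP; rewrite ?size_star. Qed.

Lemma orient_star o i : orient o i * star (orient o i) = l i * star (l i).
Proof. by rewrite /orient; case: ifP => // _; rewrite starK mulrC. Qed.

Lemma orient_root o i : orient o (rho i) = 1.
Proof. by rewrite /orient l_root /star rmorph1 if_same. Qed.

Section AtPoint.
Variables (o : {ffun I -> bool}) (z : C).
Let mu i := mup z (orient o i).
Let nu i := mup z (star (orient o i)).

(** The hypothesis [minors] involves the norms only, which are the same for all orientations; so
    none of them has a negative cycle. *)
Lemma orient_no_negative_cycle m (c : nat -> I) :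
  (forall k, (k < m)%N -> arc z P mu nu (c k) (c k.+1)) ->
  neg z P mu nu (c m) (c 0%N) -> False.
Proof.
apply: no_negative_cycle => k d injd; apply: dvdp_trans (minors injd).
apply: dvdp_prod => r; rewrite -(orient_star o) exprD.
by apply: dvdp_mul; rewrite -mup_geq // ?star_eq0 orient_neq0.
Qed.

End AtPoint.

Let muz o z i := mup z (orient o i).
Let nuz o z i := mup z (star (orient o i)).
Let bad o z i j := neg z P (muz o z) (nuz o z) i j.

Lemma muz_root o z i : muz o z (rho i) = 0%N.
Proof. by rewrite /muz orient_root mupNroot // rootE hornerC oner_eq0. Qed.

Lemma nuz_root o z i : nuz o z (rho i) = 0%N.
Proof.
by rewrite /nuz orient_root /star rmorph1 mupNroot // rootE hornerC oner_eq0.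
Qed.

Lemma bad_conj o z i j : bad o z i j = bad o (z^*)%C j i.
Proof.
rewrite /bad /neg P_star; congr (~~ _).
rewrite -[LHS]dvdp_star starK star_XsubC.
suff -> : (muz o z i + nuz o z j = muz o (z^*)%C j + nuz o (z^*)%C i)%N by [].
rewrite /muz /nuz (mup_star _ (orient_neq0 o j)) (mup_star _ (orient_neq0 o i)).
by rewrite conjcK addnC.
Qed.

(** At a real point the star symmetry makes (j, i) fail with (i, j), and the two form a negative
    cycle of length two. *)
Lemma bad_real o z i j : (z^*)%C = z -> ~~ bad o z i j.
Proof.
move=> ez; apply/negP => bij; have := bij; rewrite bad_conj ez => bji.
apply: (@orient_no_negative_cycle o z 1 (fun k : nat => if k is 0%N then i else j)) => //= k.
case: k => //= _; move: bij; rewrite /bad /neg /arc.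
by apply: contra => /(dvdp_trans _); apply; rewrite dvdp_exp2l.
Qed.

(** Truncated subtraction keeps surplus at one pair from compensating failure at another. Zero
    entries are divisible by everything and count for nothing. *)
Definition defect o z : nat :=
  (\sum_i \sum_j if P i j == 0%R then 0 else muz o z i + nuz o z j - mup z (P i j))%N.

Lemma mup_orient o i r z : root (orient o i) r -> muz o z i = (z == r).
Proof. by move=> rr; apply: mup_linear; rewrite ?orient_neq0 ?size_orient. Qed.

Lemma mup_star_orient o i r z : root (orient o i) r -> nuz o z i = (z == (r^*)%C).
Proof.
move=> rr; rewrite /nuz (mup_star _ (orient_neq0 o i)) [LHS](mup_orient _ rr).
by rewrite -(inj_eq (can_inj (@conjcK R))) conjcK.
Qed.

(* Let X be the set of indices reached from b by arcs at z; it does not contain a,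
   as this would close a negative cycle. Conjugating w_i for all i in X, or for all
   i outside X in the class of b if X contains the root, lowers the multiplicity
   required at (i, j) by one if j only is in X, and raises it by one if i only is
   in X, where (i, j) is not an arc. *)
Lemma defect_decrease o z a b : 0 < complex.Im z -> bad o z a b ->
  exists o', (defect o' z < defect o z)%N /\
    (forall z', z' != z -> z' != (z^*)%C -> defect o' z' = defect o z').
Proof.
move=> z_im bab; have nz : z != (z^*)%C.
  apply: contraTneq z_im => ez.
  have : complex.Im z = - complex.Im z by rewrite {1}ez; case: (z).
  by move=> e; rewrite -leNgt; lra.
pose mu := muz o z; pose nu := nuz o z.
pose e : rel I := arc z P mu nu.
pose X := [set i | connect e b i].
have Xb : b \in X by rewrite inE connect0.
have Xe i j : i \in X -> j \notin X -> ('X - z%:P) ^+ (mu i + nu j).+1 %| P i j.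
  rewrite !inE => bi; apply: contraR => eij; exact: connect_trans bi (connect1 eij).
have eP i j : e i j -> P i j != 0 by apply: contraNneq => ->; rewrite dvdp0.
have Pab : P a b != 0 by apply: contraNneq bab => ->; rewrite dvdp0.
have Xrho i : i \in X -> rho i = rho b.
  rewrite inE => /connectP[p pp ->]; elim: p b pp {Xb Xe Pab bab X} => //= y p IHp x /andP[exy yp].
  by rewrite IHp // (P_rho (eP _ _ exy)).
have aX : a \notin X.
  rewrite inE; apply/negP => /connectP[p pp ea].
  apply: (@orient_no_negative_cycle o z (size p) (fun k => nth b (b :: p) k)).
    by move=> k kp; have /(pathP b) := pp; exact.
  by rewrite -[size p]/(size (b :: p)).-1 nth_last /= -ea.
have rab : rho a = rho b by exact: P_rho.
pose r := rho b.
(* Inside the class of r, conjugating on X or on its complement changes the required multiplicities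
   alike; the version that leaves the root alone is taken, as its factor is 1. *)
pose Y := if r \in X then [set i | rho i == r] :\: X else X.
(* The entry between i and the root is the norm of w_i. As the pair that leaves X is not an arc,
   this norm has one more factor at z than required, which locates the root of w_i. *)
have HY i : i \in Y -> root (orient o i) (if r \in X then z else (z^*)%C).
  rewrite /Y; case: ifP => rX.
    rewrite !inE => /andP[iX /eqP ir].
    have nir : i != rho i by rewrite ir; apply: contraNneq iX => ->; move: rX; rewrite inE.
    have := Xe r i rX; rewrite inE iX => /(_ isT).
    rewrite P_star -ir P_root // starM starK mulrC -(orient_star o).
    rewrite -mup_geq ?mulf_neq0 ?star_eq0 ?orient_neq0 // mupM ?star_eq0 ?orient_neq0 //.
    rewrite /mu muz_root add0n.
    rewrite -addn1 addnC leq_add2r => h.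
    by rewrite -[root _ _]negbK; apply: contraTN h => /mupNroot->.
  move=> iX; have ir := Xrho _ iX.
  have nir : i != rho i by rewrite ir; apply: contraFneq rX => e0; rewrite /r -e0.
  have := Xe i r iX; rewrite rX => /(_ isT).
  rewrite /r -ir P_root // -(orient_star o).
  rewrite -mup_geq ?mulf_neq0 ?star_eq0 ?orient_neq0 // mupM ?star_eq0 ?orient_neq0 //.
  rewrite /nu nuz_root addn0.
  rewrite -addn1 leq_add2l => h; rewrite -[root _ _]negbK; apply: contraTN h => h.
  by rewrite mupNroot // root_star.
pose o' := [ffun i => (i \in Y) (+) o i].
have oN i : i \notin Y -> orient o' i = orient o i.
  by move=> /negPf iY; rewrite /orient ffunE iY.
have oY i : i \in Y -> orient o' i = star (orient o i).
  by move=> iY; rewrite /orient ffunE iY /=; case: (o i); rewrite /= ?starK.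
have muY z' i : i \in Y -> muz o' z' i = nuz o z' i.
  by move=> iY; rewrite /muz oY.
have nuY z' i : i \in Y -> nuz o' z' i = muz o z' i.
  by move=> iY; rewrite /nuz oY // starK.
have muN z' i : i \notin Y -> muz o' z' i = muz o z' i by move=> iY; rewrite /muz oN.
have nuN z' i : i \notin Y -> nuz o' z' i = nuz o z' i by move=> iY; rewrite /nuz oN.
exists o'; split; last first.
  move=> z' nzz nzc; rewrite /defect; apply: eq_bigr => i _; apply: eq_bigr => j _.
  have H k : (muz o' z' k = muz o z' k) /\ (nuz o' z' k = nuz o z' k).
    have [kY|kY] := boolP (k \in Y); last by rewrite muN // nuN.
    rewrite muY // nuY //; have rk := HY k kY.
    rewrite (mup_orient z' rk) (mup_star_orient z' rk).
    by case: ifP => _; rewrite ?conjcK (negPf nzz) (negPf nzc).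
  by case: (H i) => -> _; case: (H j) => _ ->.
have shift i j : P i j != 0 ->
    (muz o' z i + nuz o' z j + (j \in X) = mu i + nu j + (i \in X))%N.
  move=> Pij; have rij := P_rho Pij; rewrite /mu /nu.
  have [ir|ir] := eqVneq (rho i) r; last first.
    have NX k : rho k != r -> k \notin X by apply: contra => /Xrho->.
    have NY k : rho k != r -> k \notin Y.
      by move=> kr; rewrite /Y; case: ifP => _; rewrite ?NX // !inE (negPf kr) andbF.
    have jr : rho j != r by rewrite -rij.
    by rewrite muN ?nuN ?NY // (negPf (NX _ ir)) (negPf (NX _ jr)).
  have jr : rho j = r by rewrite -rij.
  have YE k : rho k = r -> (k \in Y) = (if r \in X then k \notin X else k \in X).
    by move=> kr; rewrite /Y; case: ifP => // _; rewrite !inE kr eqxx andbT.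
  have Hmu k : rho k = r -> (muz o' z k + (r \in X) = muz o z k + (k \in X))%N.
    move=> kr; have [kY|kY] := boolP (k \in Y); last first.
      by rewrite muN //; move: kY; rewrite YE //; case: (r \in X) => [/negPn->|/negPf->].
    rewrite muY //; have rk := HY k kY.
    rewrite (mup_orient z rk) (mup_star_orient z rk); move: kY; rewrite YE //.
    by case: (r \in X) => [/negPf->|->]; rewrite ?conjcK eqxx (negPf nz).
  have Hnu k : rho k = r -> (nuz o' z k + (k \in X) = nuz o z k + (r \in X))%N.
    move=> kr; have [kY|kY] := boolP (k \in Y); last first.
      by rewrite nuN //; move: kY; rewrite YE //; case: (r \in X) => [/negPn->|/negPf->].
    rewrite nuY //; have rk := HY k kY.
    rewrite (mup_orient z rk) (mup_star_orient z rk); move: kY; rewrite YE //.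
    by case: (r \in X) => [/negPf->|->]; rewrite ?conjcK eqxx (negPf nz).
  by have := Hmu i ir; have := Hnu j jr; lia.
have le_term i j : ((if P i j == 0%R then 0 else muz o' z i + nuz o' z j - mup z (P i j)) <=
    (if P i j == 0%R then 0 else muz o z i + nuz o z j - mup z (P i j)))%N.
  case: eqP => // /eqP Pij; have := shift i j Pij.
  have [iX|iX] := boolP (i \in X); have [jX|jX] := boolP (j \in X); rewrite -/(mu i) -/(nu j); try lia.
  by have := Xe i j iX jX; rewrite -mup_geq //; lia.
rewrite /defect (bigD1 a) //= [X in (_ < X)%N](bigD1 a) //= -addSn leq_add //; last first.
  by apply: leq_sum => i _; apply: leq_sum => j _; exact: le_term.
rewrite (bigD1 b) //= [X in (_ < X)%N](bigD1 b) //= -addSn leq_add //; last first.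
  by apply: leq_sum => j _; exact: le_term.
rewrite (negPf Pab); have := shift a b Pab; rewrite Xb (negPf aX).
by move: bab; rewrite /bad /neg -mup_ltn //; rewrite -/(mu a) -/(nu b); lia.
Qed.

(** These finitely many points include every point of the upper half-plane where a failure can
    occur. For a constant [l i], division by zero adds the harmless real point 0. *)
Definition upper_root i : C :=
  let r := - (l i)`_0 / (l i)`_1 in if complex.Im r < 0 then (r^*)%C else r.

Lemma upper_rootE i z : root (l i) z || root (l i) (z^*)%C -> 0 < complex.Im z ->
  upper_root i = z.
Proof.
move=> rz z_im.
have H r : root (l i) r -> - (l i)`_0 / (l i)`_1 = r.
  rewrite rootE (horner_coef_wide _ (size_l i)) !big_ord_recl big_ord0 /= addr0 expr0 mulr1 expr1.
  move=> /eqP e; have l1 : (l i)`_1 != 0.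
    apply: contraNneq (l_neq0 i) => l1; move: e; rewrite l1 mul0r addr0 => l0.
    by apply/eqP/polyP => -[|[|k]]; rewrite coef0 // nth_default // (leq_trans (size_l i)).
  by apply: (mulIf l1); rewrite divfK // mulrC; apply/eqP; rewrite eq_sym -addr_eq0 addrC e.
rewrite /upper_root; case/orP: rz => /H-> /=.
  by rewrite ltNge ltW.
have -> : complex.Im (z^*)%C = - complex.Im z by case: (z).
by rewrite oppr_lt0 z_im conjcK.
Qed.

Lemma upper_root_ge0 i : 0 <= complex.Im (upper_root i).
Proof.
have H (r : C) : 0 <= complex.Im (if complex.Im r < 0 then (r^*)%C else r).
  by case: ifPn => [|]; [case: r => x y /=; lra | rewrite -leNgt].
exact: H.
Qed.

(* Only the choice between [l i] and its conjugate is free; it is fixed by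
   minimizing the total defect over all roots. *)
Lemma orientation : exists w : I -> {poly C},
  (forall i, w i * star (w i) = l i * star (l i)) /\
  (forall i j, w i * star (w j) %| P i j).
Proof.
pose Phi o := (\sum_k defect o (upper_root k))%N.
have [o _ omin] := arg_minnP Phi (isT : xpredT [ffun=> false]).
exists (orient o); split=> [i|i j]; first exact: orient_star.
have nobad_up z i' j' : 0 < complex.Im z -> ~~ bad o z i' j'.
  move=> z_im; apply/negP => b; have [o' [lt_o' eq_o']] := defect_decrease z_im b.
  have [k kz] : exists k, upper_root k = z.
    have root_l k : root (orient o k) z || root (orient o k) (z^*)%C ->
        root (l k) z || root (l k) (z^*)%C.
      by rewrite /orient; case: ifP => // _; rewrite !root_star conjcK orbC.
    have [r1|r1] := boolP (root (orient o i') z).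
      by exists i'; apply: upper_rootE => //; apply: root_l; rewrite r1.
    have [r2|r2] := boolP (root (orient o j') (z^*)%C).
      by exists j'; apply: upper_rootE => //; apply: root_l; rewrite r2 orbT.
    move: b; rewrite /bad /neg /muz /nuz mupNroot // mupNroot ?root_star //.
    by rewrite addn0 expr0 dvd1p.
  (* Only the terms of Phi at z can change, and they drop: the conjugate of z lies in the lower
     half-plane and is no [upper_root]. *)
  have := omin o' isT; rewrite leqNgt /Phi => /negP[].
  rewrite (bigD1 k) //= [X in (_ < X)%N](bigD1 k) //= -addSn leq_add ?kz //.
  apply: leq_sum => k' _; have [->|ne] := eqVneq (upper_root k') z; first exact: ltnW.
  have [ec|nec] := eqVneq (upper_root k') (z^*)%C; last by rewrite (eq_o' _ ne nec) leqnn.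
  have := upper_root_ge0 k'; rewrite ec.
  by have -> : complex.Im (z^*)%C = - complex.Im z by [case: (z)]; lra.
apply: dvdp_mup => [|z]; first by rewrite mulf_neq0 ?star_eq0 ?orient_neq0.
rewrite mupM ?star_eq0 ?orient_neq0 //.
suff : ~~ bad o z i j by rewrite /bad /neg negbK.
have [z_im|z_im|z_im] := ltgtP 0 (complex.Im z); first exact: nobad_up.
  rewrite bad_conj; apply: nobad_up; case: (z) z_im => x y /=.
  by rewrite oppr_gt0.
by apply: bad_real; case: (z) z_im => x y /= <-; rewrite oppr0.
Qed.

End Orientation.

(** * Minors, rank one updates and translations *)

Section MinorLemmas.
Variables (K : comNzRingType) (n : nat).
Implicit Types (A B : 'M[K]_n) (S : {set 'I_n}).

Lemma principal_minor_eq A B S : {in S &, forall i j, A i j = B i j} ->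
  principal_minor A S = principal_minor B S.
Proof.
by move=> e; congr determinant; apply/matrixP => i j; rewrite !mxE e ?enum_valP.
Qed.

Lemma det_mxsub_image m (c : 'I_m -> 'I_n) A : injective c ->
  \det (mxsub c c A) = principal_minor A [set c r | r : 'I_m].
Proof.
move=> injc; set S := [set c r | r : 'I_m].
have cS r : c r \in S by apply: imset_f.
pose f r := enum_rank_in (cS r) (c r).
have fE r : enum_val (f r) = c r by rewrite enum_rankK_in.
have injf : injective f by move=> r s e; apply: injc; rewrite -!fE e.
have em : m = #|S| by rewrite card_imset // card_ord.
rewrite /principal_minor -(det_mxsub_inj _ injf em); congr determinant.
by apply/matrixP => r s; rewrite !mxE !fE.
Qed.

Lemma principal_minor0 A : principal_minor A set0 = 1.
Proof.
rewrite principal_minorE -[RHS](det1 K n); congr determinant.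
by apply/matrixP => i j; rewrite !mxE inE.
Qed.

Lemma principal_minor1 A i : principal_minor A [set i] = A i i.
Proof.
have injc : injective (fun _ : 'I_1 => i) by move=> r s _; rewrite !ord1.
have -> : [set i] = [set (fun _ : 'I_1 => i) r | r : 'I_1].
  apply/setP => k; rewrite inE; apply/eqP/imsetP => [->|[r _ ->]] //.
  by exists ord0.
by rewrite -(det_mxsub_image A injc) det_mx11 mxE.
Qed.

Lemma principal_minor2 A i j : i != j ->
  principal_minor A [set i; j] = A i i * A j j - A i j * A j i.
Proof.
move=> nij; pose c (r : 'I_2) := if r == 0 then i else j.
have injc : injective c.
  move=> [[|[]] //= hr] [[|[]] //= hs]; rewrite /c /= => e; apply: val_inj => //=;
  by move: nij; rewrite e eqxx.
have -> : [set i; j] = [set c r | r : 'I_2].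
  apply/setP => k; rewrite !inE; apply/orP/imsetP => [[/eqP->|/eqP->]|[r _ ->]].
  - by exists 0.
  - by exists 1.
  by rewrite /c; case: ifP => _; rewrite eqxx; [left|right].
by rewrite -(det_mxsub_image A injc) det_2x2 !mxE.
Qed.

Lemma det_3x3 (A : 'M[K]_3) (o0 := 0 : 'I_3) (o1 := 1 : 'I_3) (o2 := inord 2 : 'I_3) :
  \det A = A o0 o0 * (A o1 o1 * A o2 o2 - A o1 o2 * A o2 o1)
    - A o0 o1 * (A o1 o0 * A o2 o2 - A o1 o2 * A o2 o0)
    + A o0 o2 * (A o1 o0 * A o2 o1 - A o1 o1 * A o2 o0).
Proof.
rewrite (expand_det_row _ ord0) 2!big_ord_recl big_ord1.
rewrite /cofactor !det_2x2 !mxE /=.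
have e1 : lift ord0 ord0 = o1 by apply: val_inj.
have e2 : lift ord0 (lift ord0 ord0) = o2 :> 'I_3 by apply: val_inj; rewrite /= inordK.
have e2' : lift ord0 (1 : 'I_2) = o2 :> 'I_3 by apply: val_inj; rewrite /= inordK.
have e3 : lift o1 (0 : 'I_2) = o0 by apply: val_inj.
have e4 : lift o1 (1 : 'I_2) = o2 by apply: val_inj; rewrite /= inordK.
have e5 : lift o2 (0 : 'I_2) = o0 by apply: val_inj; rewrite /= /bump inordK.
have e6 : lift o2 (1 : 'I_2) = o1 by apply: val_inj; rewrite /= /bump inordK.
have e0 : ord0 = o0 by apply: val_inj.
rewrite e2 e1 e2' e3 e4 e5 e6 e0 /bump /= !addn0 !add0n; ring.
Qed.

Lemma principal_minor3 A i j k : i != j -> i != k -> j != k ->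
  principal_minor A [set i; j; k] =
    A i i * (A j j * A k k - A j k * A k j) - A i j * (A j i * A k k - A j k * A k i)
    + A i k * (A j i * A k j - A j j * A k i).
Proof.
move=> nij nik njk; pose c (r : 'I_3) := if r == 0 then i else if r == 1 then j else k.
have injc : injective c.
  move=> [[|[|[]]] //= hr] [[|[|[]]] //= hs]; rewrite /c /= => e; apply: val_inj => //=;
  by move: nij nik njk; rewrite e eqxx.
have c2 : c (inord 2) = k by rewrite /c -!val_eqE /= inordK.
have -> : [set i; j; k] = [set c r | r : 'I_3].
  apply/setP => l; rewrite !inE; apply/orP/imsetP => [[/orP[]/eqP->|/eqP->]|[r _ ->]].
  - by exists 0.
  - by exists 1.
  - by exists (inord 2).
  by rewrite /c; case: ifP => _; [|case: ifP => _]; rewrite eqxx ?orbT; [left|left|right].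
by rewrite -(det_mxsub_image A injc) det_3x3 !mxE c2.
Qed.

Lemma principal_minor_scale (u v : 'I_n -> K) A S :
  principal_minor (\matrix_(i, j) (u i * A i j * v j)) S =
  (\prod_(i in S) (u i * v i)) * principal_minor A S.
Proof.
have E (f : 'I_n -> K) : \prod_(i in S) f i = \prod_(k < #|S|) f (enum_val k).
  exact: big_enum_val.
rewrite big_split /= mulrAC (E u) (E v).
rewrite /principal_minor.
pose U := diag_mx (\row_(k < #|S|) u (enum_val k)).
pose V := diag_mx (\row_(k < #|S|) v (enum_val k)).
have -> : mxsub (@enum_val _ (mem S)) (@enum_val _ (mem S)) (\matrix_(i, j) (u i * A i j * v j))
   = U *m mxsub (@enum_val _ (mem S)) (@enum_val _ (mem S)) A *m V.
  by apply/matrixP => i j; rewrite mul_mx_diag mxE mul_diag_mx !mxE.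
rewrite !det_mulmx !det_diag; congr (_ * _ * _); apply: eq_bigr => k _; by rewrite mxE.
Qed.

Lemma principal_minor_row0 A S i : i \in S -> (forall j, A i j = 0) ->
  principal_minor A S = 0.
Proof.
move=> iS Ai0; rewrite principal_minorE (expand_det_row _ i) big1 // => j _.
by rewrite mxE iS Ai0 mul0r.
Qed.

End MinorLemmas.

Section FieldMinors.
Variables (K : fieldType) (n : nat).
Implicit Types (M : 'M[K]_n) (S : {set 'I_n}).

Lemma pencilE M x w :
  pencil M x w = diag_mx (\row_i x i) + diag_mx (\row_i w i) *m M.
Proof.
by apply/matrixP => i j; rewrite mul_diag_mx !mxE; case: eqP => [->|].
Qed.

Lemma principal_minor_setU1 M e t S : e \notin S ->
  let x := fun i => (i \notin S)%:R in
  \det (pencil M x (upd (fun i => (i \in S)%:R) e t)) =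
  principal_minor M S + t * principal_minor M (e |: S).
Proof.
move=> eS x; rewrite det_pencil.
have ex : x =1 upd x e 1 by move=> i; rewrite /upd /x; case: eqP => // ->; rewrite eS.
rewrite (eq_mform _ ex (fun _ => erefl)) mform_upd mul1r.
congr (_ + _ * _); rewrite -[RHS]mform_set; apply: eq_mform => i; rewrite /upd /x ?inE.
- by case: eqP => // ->; rewrite eS.
- by case: eqP => // ->; rewrite (negPf eS).
- by case: eqP.
- by case: eqP.
Qed.

(** The pencil of M for S with weight t at e is the pencil of the updated matrix for S times the
    pencil with weight t at e only, whose determinant is 1 + t M_ee. *)
Lemma rank_one_update M e t S : e \notin S -> 1 + t * M e e != 0 ->
  principal_minor M S + t * principal_minor M (e |: S) =
  (1 + t * M e e) *
  principal_minor (\matrix_(i, j) (M i j - t / (1 + t * M e e) * M i e * M e j)) S.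
Proof.
move=> eS; set lam := 1 + _; set Mt := \matrix_(i, j) _ => lam0.
rewrite -principal_minor_setU1 //; set x := fun i => _.
have elam : \det (pencil M (fun _ => 1) (upd (fun _ => 0) e t)) = lam.
  have e0 : e \notin set0 by rewrite inE.
  have := principal_minor_setU1 M t e0.
  rewrite principal_minor0 setU0 principal_minor1 -/lam => <-; congr determinant.
  apply/matrixP => i j; rewrite !mxE inE /=; congr (_ + _ * _).
  by rewrite /upd inE.
rewrite -elam mulrC -[principal_minor Mt S]mform_set -det_pencil -det_mulmx.
congr determinant; apply/matrixP => i j; rewrite [RHS]mxE.
rewrite (bigD1 j) //= [in X in _ + X](eq_bigr (fun k => pencil Mt x (fun i => (i \in S)%:R) i k *
    (if k == e then t * M e j else 0))) => [|k kj]; last first.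
  rewrite [pencil M _ _ k j]mxE (negPf kj) mulr0n add0r /upd; case: eqP => [->|] //.
  by rewrite mul0r.
have -> : pencil M (fun _ => 1) (upd (fun _ => 0) e t) j j = 1 + (if j == e then t * M e j else 0).
  by rewrite mxE eqxx /upd; case: eqP => [->|]; rewrite ?mul0r.
rewrite mulrDr mulr1 -addrA.
rewrite -(bigD1 j (P := predT) (F := fun k => pencil Mt x (fun i => (i \in S)%:R) i k *
    (if k == e then t * M e j else 0))) //=.
rewrite (bigD1 e) //= eqxx big1 ?addr0 => [|k /negPf ->]; last by rewrite mulr0.
rewrite !mxE /upd; case: (eqVneq i e) => [->|ie].
  rewrite /x eS (negPf eS) /= !mul0r !addr0; case: eqP => _ /=; ring.
rewrite mulr0n add0r -/(x i); set X := x i *+ _.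
case: (i \in S) => /=; last by ring.
by move: lam0; rewrite /lam => lam0; field.
Qed.

(** The pencil on the left factors as the pencil of M U^-1 for S times U = 1 - diag(c) M. *)
Lemma principal_minor_shift M c S :
  let U := pencil M (fun _ => 1) (fun i => - c i) in \det U != 0 ->
  mform (principal_minor M) (fun i => (i \notin S)%:R)
    (fun i => if i \in S then 1 else - c i) =
  \det U * principal_minor (M *m invmx U) S.
Proof.
move=> U U0; rewrite mulrC -[principal_minor (M *m _) S]mform_set -!det_pencil.
rewrite -det_mulmx; congr determinant; rewrite !pencilE mulmxDl -!mulmxA mulVmx ?unitmxE ?unitfE //.
rewrite mulmx1 /U pencilE mulmxDr !mul_diag_mx.
apply/matrixP => i j; rewrite !mxE.
by case: (i \in S); case: eqP => [->|_] /=; ring.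
Qed.

End FieldMinors.

Section HermitianMinors.
Variables (R : rcfType) (n : nat).
Local Notation C := (R[i]).

(** The adjoint V = 1 - M diag(c) of U satisfies V M = M U, so M U^-1 = V^-1 M is its own
    adjoint. *)
Lemma hermsymmx_shift (M : 'M[C]_n) (c : 'I_n -> R) :
  let U := pencil M (fun _ => 1) (fun i => - (c i)%:C%C) in \det U != 0 ->
  M \is hermsymmx -> M *m invmx U \is hermsymmx.
Proof.
move=> U U0 /hermsymmxP hM; apply/hermsymmxP => i j.
have Uu : U \in unitmx by rewrite unitmxE unitfE.
have star_mul (A B : 'M[C]_n) : map_mx conjc ((A *m B)^T) = map_mx conjc B^T *m map_mx conjc A^T.
  by rewrite trmx_mul map_mxM.
set N := M *m invmx U; suff e : N = map_mx conjc N^T by rewrite {1}e 2!mxE.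
have Ms : map_mx conjc M^T = M by apply/matrixP => k l; rewrite !mxE -hM.
have UM : map_mx conjc U^T *m M = M *m U.
  apply/matrixP => k l; rewrite !mxE.
  have -> : \sum_j0 (map_mx conjc U^T) k j0 * M j0 l =
     \sum_j0 ((k == j0)%:R - M k j0 * (c j0)%:C%C) * M j0 l.
    apply: eq_bigr => j0 _; congr (_ * _); rewrite 2!mxE [U j0 k]mxE (hM k j0).
    rewrite rmorphD rmorphM rmorphN rmorphMn rmorph1.
    rewrite eq_sym mulNr mulrC; congr (_ - _ * _); exact: conjc_real.
  have -> : \sum_j0 M k j0 * U j0 l =
     \sum_j0 M k j0 * ((j0 == l)%:R - (c j0)%:C%C * M j0 l).
    by apply: eq_bigr => j0 _; rewrite !mxE mulNr.
  rewrite (eq_bigr (fun j0 => (k == j0)%:R * M j0 l - M k j0 * (c j0)%:C%C * M j0 l)); last first.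
    by move=> j0 _; rewrite mulrBl.
  rewrite [RHS](eq_bigr (fun j0 => M k j0 * (j0 == l)%:R - M k j0 * (c j0)%:C%C * M j0 l)); last first.
    by move=> j0 _; rewrite mulrBr mulrA.
  rewrite !big_split /=; congr (_ + _).
  rewrite (bigD1 k) //= eqxx mul1r big1 ?addr0 => [|j0 /negPf]; last first.
    by rewrite eq_sym => ->; rewrite mul0r.
  rewrite (bigD1 l) //= eqxx mulr1 big1 ?addr0 // => j0 /negPf ->.
  by rewrite mulr0.
rewrite star_mul Ms.
have Vu : map_mx conjc U^T \in unitmx.
  by rewrite unitmxE unitfE det_map_mx det_tr fmorph_eq0.
have -> : map_mx conjc (invmx U)^T = invmx (map_mx conjc U^T).
  by rewrite trmx_inv map_invmx.
by rewrite /N -[M in RHS](mulmxK Uu) -UM mulmxA mulKmx.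
Qed.

(** The minors of order two fix the moduli, those of order three the phases. The vector v is a
    column with nonzero diagonal entry b, divided by the square root of b. *)
Lemma hermitian_rank_one (D : {set 'I_n}) (B : 'I_n -> 'I_n -> C) :
  (forall i j, B j i = (B i j)^*%C) ->
  (forall i, i \in D -> 0 <= B i i) ->
  {in D &, forall i j, i != j -> B i i * B j j - B i j * B j i = 0} ->
  (forall i j k, i \in D -> j \in D -> k \in D -> i != j -> i != k -> j != k ->
    B i i * (B j j * B k k - B j k * B k j) - B i j * (B j i * B k k - B j k * B k i)
    + B i k * (B j i * B k j - B j j * B k i) = 0) ->
  exists v : 'I_n -> C, {in D &, forall i j, B i j = v i * (v j)^*%C}.
Proof.
move=> hB B0 m2 m3.
have zero z : z * (z^*)%C = 0 -> z = 0 :> C.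
  by move/eqP; rewrite mulf_eq0 conjc_eq0 orbb => /eqP.
have [[i0 i0D bi0]|D0] : (exists2 i0, i0 \in D & B i0 i0 != 0) \/ (forall i, i \in D -> B i i = 0).
  have [/existsP[i0 /andP[i0D b]]|] := boolP [exists i, (i \in D) && (B i i != 0)].
    by left; exists i0.
  rewrite negb_exists => /forallP h; right => i iD; have := h i.
  by rewrite iD negbK => /eqP.
  pose b := B i0 i0; have b_ge0 : 0 <= b by exact: B0.
  pose s := sqrtC b; have s2 : s ^+ 2 = b by rewrite sqrtCK.
  have s0 : s != 0 by rewrite sqrtC_eq0.
  have s_real : (s^*)%C = s by apply: (conj_Creal (ger0_real _)); rewrite sqrtC_ge0.
  exists (fun i => B i i0 / s) => i j iD jD.
  rewrite rmorphM fmorphV /= s_real -hB mulrACA -invfM -expr2 s2.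
  suff: b * B i j = B i i0 * B i0 j by move=> <-; rewrite mulrAC divff ?mul1r.
  have m2' k l : k \in D -> l \in D -> B k k * B l l = B k l * B l k.
    move=> kD lD; have [->|kl] := eqVneq k l; first by [].
    by apply/eqP; rewrite -subr_eq0 m2.
  have [->|ij] := eqVneq i j; first by rewrite /b m2' // mulrC.
  have [->|ii0] := eqVneq i i0; first by [].
  have [->|ji0] := eqVneq j i0; first by rewrite mulrC.
  (* The squared modulus of b B_ij - B_i,i0 B_i0,j is expressed through principal minors of orders
     two and three, all zero. *)
  apply/eqP; rewrite -subr_eq0; apply/eqP/zero.
  have i0i : i0 != i by rewrite eq_sym.
  have i0j : i0 != j by rewrite eq_sym.
  have := m3 i0 i j i0D iD jD i0i i0j ij.
  rewrite rmorphB !rmorphM /= -!hB /b.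
  have := m2' i0 i i0D iD; have := m2' i0 j i0D jD; have := m2' i j iD jD.
  move: (B i0 i0) (B i i) (B j j) (B i i0) (B i0 i) (B j i0) (B i0 j) (B i j) (B j i).
  move=> b' Bii Bjj p p' q q' x x' e1 e2 e3 e4.
  have e5 : b' * (p * q' * x' + p' * q * x) = 2%:R * b' ^+ 2 * (Bii * Bjj).
    have : b' * (b' * (Bii * Bjj - x * x') - p' * (p * Bjj - x * q) + q' * (p * x' - Bii * q)) = 0.
      by rewrite e4 mulr0.
    rewrite -e1 subrr mulr0 sub0r => h.
    transitivity (b' * (p' * p * Bjj) + b' * (q' * q * Bii)); last by rewrite -e2 -e3; ring.
    by apply/eqP; rewrite -subr_eq0 -h; apply/eqP; ring.
  transitivity (b' ^+ 2 * (x * x') - b' * (p * q' * x' + p' * q * x) + (p' * p) * (q' * q)); first by ring.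
  by rewrite e5 -e1 -e2 -e3; ring.
exists (fun _ => 0) => i j iD jD; rewrite mul0r; apply: zero; rewrite -hB.
have [<-|ij] := eqVneq i j; first by rewrite D0 // mul0r.
by have /eqP := m2 i j iD jD ij; rewrite D0 // mul0r sub0r oppr_eq0 => /eqP.
Qed.

End HermitianMinors.

(** * Translations and generic points *)

Section Translation.
Variables (R : rcfType) (n : nat).
Implicit Types (a b : {set 'I_n} -> R) (x y z w : 'I_n -> R) (D S : {set 'I_n}).

Definition trans a y : {set 'I_n} -> R := sl2c (fun m => mx22 1 0 (y m) 1) a.

Lemma mform_trans a y x w :
  mform (trans a y) x w = mform a x (fun i => y i * x i + w i).
Proof.
rewrite mform_act; apply: eq_mform => i; rewrite !mxE /=.
  by rewrite mul0r addr0 mul1r.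
by rewrite mul1r.
Qed.

Lemma ray_trans a y i j z : i != j ->
  ray (trans a y) i j (fun _ => 1) z = ray a i j (fun _ => 1) (fun k => y k + z k).
Proof.
move=> nij; rewrite ray_act // !det_mx22 !mul0r !subr0 !mul1r.
apply: eq_ray => k; rewrite /actx /actw !mxE /=; ring.
Qed.

Lemma hyp_trans a y i j k z : i != j -> i != k -> j != k ->
  hyp (trans a y) i j k (fun _ => 1) z = hyp a i j k (fun _ => 1) (fun k => y k + z k).
Proof.
move=> nij nik njk; rewrite hyp_act // !det_mx22 !mul0r !subr0 !mul1r expr1n mul1r.
apply: eq_hyp => l; rewrite /actx /actw !mxE /=; ring.
Qed.

Lemma rayleigh_nonneg_trans a y : rayleigh_nonneg a -> rayleigh_nonneg (trans a y).
Proof. by move=> h i j z nij; rewrite ray_trans //; exact: h. Qed.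

Lemma hyperdet_neg_squares_trans a y :
  hyperdet_neg_squares a -> hyperdet_neg_squares (trans a y).
Proof.
move=> h i j k l z nij nik njk nil njl nkl.
have [s es] := h i j k l (fun m => y m + z m) nij nik njk nil njl nkl.
exists (s \Po ('X + (y l)%:P)) => t; rewrite hyp_trans //.
rewrite horner_comp !hornerE -es; apply: eq_hyp => m //.
by rewrite /upd; case: eqP => [->|] //; rewrite addrC.
Qed.

Lemma mform_scale c a x w : mform (fun S => c * a S) x w = c * mform a x w.
Proof. by rewrite /mform mulr_sumr; apply: eq_bigr => S _; rewrite mulrA. Qed.

Lemma ray_scale k a i j z : ray (fun S => k * a S) i j (fun _ => 1) z =
  k ^+ 2 * ray a i j (fun _ => 1) z.
Proof. by rewrite /ray /ray4 /mcoef2 /mcoef1 !mform_scale; ring. Qed.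

Lemma rayleigh_nonneg_scale c a :
  rayleigh_nonneg a -> rayleigh_nonneg (fun S => c * a S).
Proof. by move=> h i j y nij; rewrite ray_scale mulr_ge0 ?sqr_ge0 // h. Qed.

Lemma hyperdet_neg_squares_scale c a :
  hyperdet_neg_squares a -> hyperdet_neg_squares (fun S => c * a S).
Proof.
move=> h i j k l y nij nik njk nil njl nkl.
have [s es] := h i j k l y nij nik njk nil njl nkl.
exists (c%:P ^+ 2 * s) => t; rewrite hornerM -polyC_exp hornerC.
rewrite exprMn -mulrN -es /hyp /hyp8 /mcoef3 /mcoef2 /mcoef1 !mform_scale; ring.
Qed.

Lemma trans_upd a e t S : e \notin S ->
  trans a (upd (fun _ => 0) e t) S = a S + t * a (e |: S).
Proof.
move=> eS; rewrite /trans /sl2c.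
transitivity (mform a (upd (fun i => (i \notin S)%:R) e 1)
                      (upd (fun i => (i \in S)%:R) e t)).
  apply: eq_mform => i; rewrite !mxE /= /upd.
    by case: eqP => [->|_]; rewrite ?(negPf eS) //; case: (i \in S).
  by case: eqP => [->|_]; rewrite ?(negPf eS) //; case: (i \in S).
rewrite mform_upd mul1r; congr (_ + _ * _); rewrite -[RHS](mform_set a);
  apply: eq_mform => i; rewrite /upd ?inE.
- by case: eqP => // ->; rewrite eS.
- by case: eqP => // ->; rewrite (negPf eS).
- by case: eqP.
- by case: eqP.
Qed.

Lemma mform_supp (K : comNzRingType) (p q : {set 'I_n} -> K) (x w : 'I_n -> K) D :
  (forall i, i \notin D -> w i = 0) -> (forall S, S \subset D -> p S = q S) ->
  mform p x w = mform q x w.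
Proof.
move=> w0 e; apply: eq_bigr => S _; have [/e->//|] := boolP (S \subset D).
move=> /subsetPn[i iS /w0 wi].
by rewrite (bigD1 i) //= iS wi !mul0r !mulr0.
Qed.

(** The matrix keeps size n whatever D is, so the induction on D never changes the index type. *)
Definition realizable D a := exists M : 'M[R[i]]_n,
  M \is hermsymmx /\ forall S, S \subset D -> principal_minor M S = (a S)%:C%C.

(* Translating the diagonal by c turns M into M (1 - diag(c) M)^-1. *)
Lemma realizable_shift D a c : a set0 = 1 -> (forall i, i \notin D -> c i = 0) ->
  let F := mform a (fun _ => 1) c in F != 0 ->
  realizable D (fun S => F^-1 * trans a c S) -> realizable D a.
Proof.
move=> a0 cD F F0 [M [hM eM]].
pose cC i : R[i] := (c i)%:C%C.
have H x w : (forall i, i \notin D -> w i = 0) ->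
    mform (principal_minor M) (fun i => (x i)%:C%C) (fun i => (w i)%:C%C) =
    (F^-1 * mform a x (fun i => c i * x i + w i))%:C%C.
  move=> wD; rewrite -mform_trans -mform_scale (rmorph_mform (real_complex R)).
  by apply: mform_supp eM => i /wD ->.
pose U := pencil M (fun _ => 1) (fun i => - cC i).
have detU : \det U = (F^-1)%:C%C.
  rewrite det_pencil; transitivity (F^-1 * mform a (fun _ => 1) (fun i => c i * 1 + - c i))%:C%C.
    rewrite -H => [|i /cD->]; last by rewrite oppr0.
    by apply: eq_mform => i //; rewrite rmorphN.
  suff -> : mform a (fun _ => 1) (fun i => c i * 1 + - c i) = 1 by rewrite mulr1.
  rewrite -[RHS]a0 -[RHS](mform_set a).
  by apply: eq_mform => i; rewrite ?inE //= mulr1 subrr.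
have U0 : \det U != 0 by rewrite detU fmorph_eq0 invr_eq0.
exists (M *m invmx U); split; first exact: hermsymmx_shift.
move=> S SD; apply: (mulfI U0); rewrite -principal_minor_shift // detU -rmorphM.
transitivity (F^-1 * mform a (fun i => (i \notin S)%:R)
    (fun i => c i * (i \notin S)%:R + (if i \in S then 1 else - c i)))%:C%C.
  rewrite -H => [|i iD]; last first.
    by case: ifP => iS; [rewrite (subsetP SD) in iD|rewrite cD ?oppr0].
  by apply: eq_mform => i; [case: (i \in S)|case: (i \in S); rewrite // rmorphN].
congr (_ * _)%:C%C; rewrite -[RHS](mform_set a); apply: eq_mform => i //.
by case: (i \in S) => /=; ring.
Qed.

End Translation.

Section GenericPoint.
Variables (R : rcfType) (n : nat).
Implicit Types (a : {set 'I_n} -> R) (u v z : 'I_n -> R) (p : ('I_n -> R) -> R).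

(** Polynomial restrictions to lines are all that is needed to move a point off finitely many zero
    sets. *)
Definition line_poly p := forall u v, exists q : {poly R},
  forall t, p (fun i => u i + t * v i) = q.[t].

Lemma line_poly_mform a x (f g : 'I_n -> R) :
  line_poly (fun z => mform a x (fun i => f i * z i + g i)).
Proof.
move=> u v; exists (mform (fun S => (a S)%:P) (fun i => (x i)%:P)
  (fun i => (f i * v i)%:P * 'X + (f i * u i + g i)%:P)) => t.
rewrite -[RHS]/(horner_eval t _) rmorph_mform.
rewrite /mform; apply: eq_bigr => S _; rewrite /= /horner_eval hornerC; congr (_ * _).
by apply: eq_bigr => i _; case: ifP => _; rewrite /= /horner_eval !hornerE //=; ring.
Qed.

Lemma line_poly_ray a i j : line_poly (fun z => ray a i j (fun _ => 1) z).
Proof.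
move=> u v.
have H s t : line_poly (fun z => mcoef2 a i j (fun _ => 1) z s t).
  move=> u' v'; have [q e] := line_poly_mform a
    (upd (upd (fun _ => 1) j (~~ t)%:R) i (~~ s)%:R) (upd (upd (fun _ => 1) j 0) i 0)
    (upd (upd (fun _ => 0) j t%:R) i s%:R) u' v'.
  exists q => t'; rewrite -e; apply: eq_mform => // k; rewrite /upd.
  by case: (k == i); [|case: (k == j)]; rewrite ?mul0r ?add0r ?mul1r ?addr0.
have [q1 e1] := H true false u v; have [q2 e2] := H false true u v.
have [q3 e3] := H false false u v; have [q4 e4] := H true true u v.
exists (q1 * q2 - q3 * q4) => t; rewrite !hornerE -e1 -e2 -e3 -e4.
by rewrite /ray /ray4.
Qed.

(** On the line from a point c good for s to a point c1 with P j c1 nonzero, each function to be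
    kept nonzero is a nonzero polynomial in t; any common nonroot will do. *)
Lemma generic_point_seq (J : eqType) (P : J -> ('I_n -> R) -> R) (D : {set 'I_n}) (s : seq J) :
  (forall j, line_poly (P j)) -> (forall j z z', z =1 z' -> P j z = P j z') ->
  exists2 c : 'I_n -> R, forall i, i \notin D -> c i = 0 &
    {in s, forall j, P j c != 0 \/ forall z, (forall i, i \notin D -> z i = 0) -> P j z = 0}.
Proof.
move=> lP eP; elim: s => [|j s [c cD IH]]; first by exists (fun _ => 0).
have [[c1 [c1D Pc1]]|N] := boolp.EM (exists c1 : 'I_n -> R,
    (forall i, i \notin D -> c1 i = 0) /\ P j c1 != 0); last first.
  exists c => // k; rewrite inE => /orP[/eqP->|/IH//].
  right=> z zD; apply/eqP/negPn/negP => Pz; apply: N.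
  by exists z.
pose L t i := c i + t * (c1 i - c i).
have nz k t0 : P k (L t0) != 0 ->
    exists2 q : {poly R}, q != 0 & forall t, q.[t] != 0 -> P k (L t) != 0.
  move=> Pk; have [q eq] := lP k c (fun i => c1 i - c i); exists q => [|t].
    by apply: contraNneq Pk => q0; rewrite /L eq q0 horner0.
  by rewrite /L eq.
have [Q Q0 HQ] : exists2 Q : {poly R}, Q != 0 & forall t, Q.[t] != 0 ->
    {in s, forall k, P k (L t) != 0 \/
       forall z, (forall i, i \notin D -> z i = 0) -> P k z = 0}.
  elim: (s) IH => [_|k s' IHs IH]; first by exists 1; rewrite ?oner_eq0.
  have [k' k's|Q Q0 HQ] := IHs; first by apply: IH; rewrite inE k's orbT.
  have [Pk|Pk] := IH k (mem_head _ _); last first.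
    exists Q => // t /HQ h k'; rewrite inE => /orP[/eqP->|/h//].
    by right.
  have [|q q0 hq] := nz k 0; first by rewrite (eP k _ c) // => i; rewrite /L mul0r addr0.
  exists (q * Q) => [|t]; first by rewrite mulf_neq0.
  rewrite hornerM mulf_eq0 negb_or => /andP[/hq Pkt /HQ h] k'.
  by rewrite inE => /orP[/eqP->|/h//]; left.
have [|q q0 hq] := nz j 1.
  by rewrite (eP j _ c1) // => i; rewrite /L mul1r addrC subrK.
have [t] := poly_nonroot (mulf_neq0 q0 Q0).
rewrite hornerM mulf_eq0 negb_or => /andP[/hq Pjt /HQ h].
exists (L t%:R) => [i iD|k].
  by rewrite /L cD // c1D // subrr mulr0 addr0.
by rewrite inE => /orP[/eqP->|/h//]; left.
Qed.

(** For the vector translated by c these are the coefficient of the empty set, the Rayleigh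
    differences at the origin and the coefficient of {e}: the first is to be normalized to 1, the
    second decide which entries vanish, the third gives 1 + t a_e a root. *)
Lemma generic_point a (D : {set 'I_n}) (e : 'I_n) : a set0 = 1 ->
  let slice z := forall i : 'I_n, i \notin D -> z i = 0 in
  exists c : 'I_n -> R, [/\ slice c, mform a (fun _ => 1) c != 0,
    forall i j, ray a i j (fun _ => 1) c != 0 \/
                forall z, slice z -> ray a i j (fun _ => 1) z = 0
  & mform a (upd (fun _ => 1) e 0) (upd c e 1) != 0 \/
    forall z, slice z -> mform a (upd (fun _ => 1) e 0) (upd z e 1) = 0].
Proof.
move=> a0 slice.
pose P (o : option (option ('I_n * 'I_n))) z := match o with
  | None => mform a (fun _ => 1) z
  | Some None => mform a (upd (fun _ => 1) e 0) (upd z e 1)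
  | Some (Some (i, j)) => ray a i j (fun _ => 1) z end.
have lP o : line_poly (P o).
  case: o => [[[i j]|]|] u v /=; first exact: line_poly_ray.
    have [q eq] := line_poly_mform a (upd (fun _ => 1) e 0) (upd (fun _ => 1) e 0)
       (upd (fun _ => 0) e 1) u v.
    exists q => t; rewrite -eq; apply: eq_mform => // i; rewrite /upd.
    by case: (i == e); rewrite ?mul0r ?add0r ?mul1r ?addr0.
  have [q eq] := line_poly_mform a (fun _ => 1) (fun _ => 1) (fun _ => 0) u v.
  by exists q => t; rewrite -eq; apply: eq_mform => // i; rewrite mul1r addr0.
have eP o z z' : z =1 z' -> P o z = P o z'.
  move=> ez; case: o => [[[i j]|]|] /=; first exact: eq_ray.
    by apply: eq_mform => // i; rewrite /upd ez.
  exact: eq_mform.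
have [c cD hc] := generic_point_seq D (enum {: option (option ('I_n * 'I_n))}) lP eP.
have {}hc o := hc o (mem_enum _ o).
exists c; split=> //.
- have [//|/(_ (fun _ => 0) (fun _ _ => erefl)) /=] := hc None.
  have -> : mform a (fun _ => 1) (fun _ => 0) = a set0.
    by rewrite -[RHS](mform_set a); apply: eq_mform => i; rewrite inE.
  by rewrite a0 => /eqP; rewrite oner_eq0.
- by move=> i j; exact: (hc (Some (Some (i, j)))).
exact: (hc (Some None)).
Qed.

End GenericPoint.

Section NonnegQuadratic.
Variable (R : rcfType).

Lemma nonneg_quadratic (q : {poly R}) : (size q <= 3)%N -> (forall t, 0 <= q.[t]) ->
  exists l : {poly R[i]}, (size l <= 2)%N /\ l * star l = map_poly (real_complex R) q.
Proof.
move=> sq q_ge0; pose c k := q`_k.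
have qE t : q.[t] = c 0%N + c 1%N * t + c 2%N * t ^+ 2.
  rewrite (horner_coef_wide _ sq) !big_ord_recl big_ord0 /= /bump /= /c; ring.
have {}q_ge0 t : 0 <= c 0%N + c 1%N * t + c 2%N * t ^+ 2 by rewrite -qE.
have [b [g [h [e0 e1 e2]]]] : exists b g h : R,
    [/\ c 0%N = b ^+ 2 + h ^+ 2, c 1%N = 2%:R * b * g & c 2%N = g ^+ 2].
  have c0 : 0 <= c 0%N by have := q_ge0 0; rewrite mulr0 addr0 expr0n mulr0 addr0.
  have [c2|c2|c2] := ltgtP (c 2%N) 0.
  (* Here T >= 1, and q(T) + q(-T) <= 2 c_2 < 0. *)
  - exfalso; pose T := 1 - c 0%N / c 2%N.
    have c2T : c 2%N * T = c 2%N - c 0%N by rewrite /T mulrBr mulr1 mulrCA divff ?mulr1 ?lt_eqF.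
    have T1 : 1 <= T by rewrite lerBrDr gerDl mulr_ge0_le0 // invr_le0 ltW.
    have := q_ge0 T; have := q_ge0 (- T); rewrite sqrrN expr2 mulrA c2T => h1 h2.
    nra.
  - have s0 : Num.sqrt (c 2%N) != 0 by rewrite sqrtr_eq0 -ltNge.
    have s2 : Num.sqrt (c 2%N) ^+ 2 = c 2%N by rewrite sqr_sqrtr // ltW.
    pose b := c 1%N / (2%:R * Num.sqrt (c 2%N)).
    have disc : 0 <= c 0%N - b ^+ 2.
      have := q_ge0 (- c 1%N / (2%:R * c 2%N)).
      suff -> : c 0%N + c 1%N * (- c 1%N / (2%:R * c 2%N)) + c 2%N * (- c 1%N / (2%:R * c 2%N)) ^+ 2
        = c 0%N - b ^+ 2 by [].
      rewrite /b -[in LHS]s2; field.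
      by rewrite s0.
    exists b, (Num.sqrt (c 2%N)), (Num.sqrt (c 0%N - b ^+ 2)); split.
    + by rewrite [X in _ + X]sqr_sqrtr // addrC subrK.
    + rewrite /b; field; by rewrite s0.
    + by rewrite s2.
  - exists 0, 0, (Num.sqrt (c 0%N)); split.
    + by rewrite sqr_sqrtr // expr0n add0r.
    + rewrite mulr0; apply/eqP/negPn/negP => c1.
      have := q_ge0 (- (c 0%N + 1) / c 1%N); rewrite c2 mul0r addr0.
      by rewrite mulrCA divff // mulr1; lra.
    + by rewrite c2 expr0n.
exists ((g%:C%C)%:P * 'X + (b +i* h)%C%:P); split; first exact: size_lin.
apply/polyP => k.
rewrite /star rmorphD rmorphM /= map_polyX !map_polyC /= oppr0 -[(g +i* 0)%C]/(g%:C%C).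
have -> : (g%:C%C%:P * 'X + (b +i* h)%C%:P) * (g%:C%C%:P * 'X + (b -i* h)%C%:P) =
  (g ^+ 2)%:C%C%:P * 'X^2 + (2%:R * b * g)%:C%C%:P * 'X + (b ^+ 2 + h ^+ 2)%:C%C%:P :> {poly R[i]}.
  have -> : (g ^+ 2)%:C%C = g%:C%C ^+ 2 :> R[i] by rewrite rmorphXn.
  have -> : (2%:R * b * g)%:C%C = ((b +i* h)%C + (b -i* h)%C) * g%:C%C :> R[i].
    by apply/eqP; rewrite eq_complex /=; apply/andP; split; apply/eqP; ring.
  have -> : (b ^+ 2 + h ^+ 2)%:C%C = (b +i* h)%C * (b -i* h)%C :> R[i].
    by apply/eqP; rewrite eq_complex /=; apply/andP; split; apply/eqP; ring.
  by rewrite !(polyCM, polyCD, polyC_exp); ring.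
rewrite coef_map /= !coefD !coefCM coefXn coefX coefC -e0 -e1 -e2.
case: k => [|[|[|k]]] /=; rewrite ?mulr0 ?mulr1 ?add0r ?addr0 //.
by rewrite nth_default ?rmorph0 // (leq_trans sq).
Qed.

End NonnegQuadratic.

(** * The Hermitian pencil on a generic line *)

Section Pencil.
Variables (R : rcfType) (n : nat).
Implicit Types (S : {set 'I_n}).
Variables (a : {set 'I_n} -> R) (D : {set 'I_n}) (e : 'I_n).
Hypothesis a0 : a set0 = 1.
Hypothesis a_nonneg : rayleigh_nonneg a.
Hypothesis a_squares : hyperdet_neg_squares a.
Hypothesis eD : e \notin D.
Hypothesis realizableD : forall b : {set 'I_n} -> R, b set0 = 1 -> rayleigh_nonneg b ->
  hyperdet_neg_squares b -> realizable D b.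
Hypothesis generic0 : {in D &, forall i j, i != j ->
  ray a i j (fun _ => 1) (fun _ => 0) != 0 \/
  forall z, (forall i, i \notin e |: D -> z i = 0) -> ray a i j (fun _ => 1) z = 0}.

Definition minor_line S : {poly R} := (a (e |: S))%:P * 'X + (a S)%:P.

Let tr t := trans a (upd (fun _ => 0) e t).

Lemma horner_minor_line S t : (minor_line S).[t] = a S + t * a (e |: S).
Proof. by rewrite /minor_line !hornerE addrC mulrC. Qed.

Lemma notin_sub S : S \subset D -> e \notin S.
Proof. by move=> SD; apply: contra eD; exact: (subsetP SD). Qed.

Lemma trans_line S t : S \subset D -> tr t S = (minor_line S).[t].
Proof. by move=> /notin_sub eS; rewrite /tr trans_upd // horner_minor_line. Qed.

(** The induction hypothesis applies after division by lam = 1 + t a_e. Multiplying its matrix by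
    lam clears the denominators and leaves the power of lam. *)
Lemma realize_at t : (minor_line set0).[t] != 0 -> exists2 N : 'M[R[i]]_n, N \is hermsymmx &
  forall S, S \subset D -> S != set0 ->
    principal_minor N S = ((minor_line S).[t] * (minor_line set0).[t] ^+ #|S|.-1)%:C%C.
Proof.
move=> lam0; set lam := (minor_line set0).[t] in lam0 *.
have [||| M [hM eM]] := realizableD (b := fun S => lam^-1 * tr t S).
- by rewrite trans_line ?sub0set // mulVf.
- exact/rayleigh_nonneg_scale/rayleigh_nonneg_trans.
- exact/hyperdet_neg_squares_scale/hyperdet_neg_squares_trans.
exists (\matrix_(i, j) (lam%:C%C * M i j * 1)) => [|S SD S0].
  apply/hermsymmxP => i j; rewrite !mxE !mulr1.
  move/hermsymmxP: hM => ->; rewrite rmorphM /= -/(conjc _).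
  by rewrite oppr0.
rewrite (principal_minor_scale (fun _ => lam%:C%C) (fun _ => 1)) eM // trans_line //.
rewrite mulr1 prodr_const -rmorphXn -rmorphM; congr (_%:C)%C.
have -> : #|S| = #|S|.-1.+1 by rewrite prednK // card_gt0.
by rewrite /= exprS mulrACA divff // mul1r mulrC.
Qed.

(* At a point t, [edge i j] is N i j * N j i and [triangle k i j] is twice the real
   part of N k i * N i j * N j k, for the matrix N of [realize_at]. *)
Definition edge i j : {poly R} :=
  minor_line [set i] * minor_line [set j] - minor_line set0 * minor_line [set i; j].

Lemma horner_edgeE i j t : (edge i j).[t] =
  (minor_line [set i]).[t] * (minor_line [set j]).[t] - (minor_line set0).[t] * (minor_line [set i; j]).[t].
Proof. by rewrite /edge hornerD hornerN !hornerM. Qed.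

Lemma edgeC i j : edge i j = edge j i.
Proof. by rewrite /edge setUC; ring. Qed.

Lemma sub1D i : i \in D -> [set i] \subset D.
Proof. by rewrite sub1set. Qed.

Lemma sub2D i j : i \in D -> j \in D -> [set i; j] \subset D.
Proof. by move=> iD jD; rewrite subUset !sub1set iD. Qed.

Lemma sub3D i j k : i \in D -> j \in D -> k \in D -> [set i; j; k] \subset D.
Proof. by move=> iD jD kD; rewrite subUset sub2D // sub1set. Qed.

Lemma horner_edge t : {in D &, forall i j, i != j ->
  (edge i j).[t] = ray a i j (fun _ => 1) (upd (fun _ => 0) e t)}.
Proof.
move=> i j iD jD nij.
have -> : ray a i j (fun _ => 1) (upd (fun _ => 0) e t) = ray (tr t) i j (fun _ => 1) (fun _ => 0).
  by rewrite /tr ray_trans //; apply: eq_ray => k //; rewrite addr0.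
rewrite -ray_standard // !trans_line ?sub0set ?sub1D ?sub2D // /edge !hornerE.
by ring.
Qed.

Lemma edge_ge0 t : {in D &, forall i j, i != j -> 0 <= (edge i j).[t]}.
Proof. by move=> i j iD jD nij; rewrite horner_edge //; exact: a_nonneg. Qed.

Definition triangle k i j : {poly R} :=
  minor_line set0 ^+ 2 * minor_line [set k; i; j] - minor_line [set k] * minor_line [set i] * minor_line [set j]
  + minor_line [set k] * edge i j + minor_line [set i] * edge k j + minor_line [set j] * edge k i.

Lemma triangleC k i j : triangle k i j = triangle k j i.
Proof. by rewrite /triangle setUAC (edgeC i j); ring. Qed.

(** For the product z around the triangle the left side is 4 |z|^2 - (2 Re z)^2, the square of 2 Im
    z; identically it is minus the hyperdeterminant times the square of [minor_line set0]. *)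
Lemma triangle_square k i j : k \in D -> i \in D -> j \in D -> k != i -> k != j -> i != j ->
  exists s : {poly R}, forall t,
    4%:R * ((edge k i).[t] * (edge i j).[t] * (edge k j).[t]) - (triangle k i j).[t] ^+ 2 =
    ((minor_line set0).[t] * s.[t]) ^+ 2.
Proof.
move=> kD iD jD nki nkj nij.
have ne l : l \in D -> l != e by apply: contraTneq => ->.
have [s es] := a_squares (fun _ => 0) nki nkj nij (ne k kD) (ne i iD) (ne j jD).
exists s => t; rewrite exprMn -[s.[t] ^+ 2]opprK -es.
have -> : hyp a k i j (fun _ => 1) (upd (fun _ => 0) e t) = HypDet k i j (tr t).
  rewrite HypDetE // /tr hyp_trans //; apply: eq_hyp => l //.
  by rewrite addr0.
rewrite /HypDet !trans_line ?sub0set ?sub1D ?sub2D ?sub3D //.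
rewrite /triangle /edge !(hornerD, hornerN, hornerM, horner_exp) .
set a1 := (minor_line [set k]).[t]; set a2 := (minor_line [set i]).[t]; set a3 := (minor_line [set j]).[t].
set a12 := (minor_line [set k; i]).[t]; set a13 := (minor_line [set k; j]).[t].
set a23 := (minor_line [set i; j]).[t]; set a123 := (minor_line [set k; i; j]).[t].
set aa := (minor_line set0).[t]; ring.
Qed.

Lemma edge_neq0 : {in D &, forall i j, i != j -> edge i j != 0 -> (edge i j).[0] != 0}.
Proof.
move=> i j iD jD nij; apply: contra => /eqP q0; apply/eqP/poly_ext => t.
rewrite horner0; move: q0; rewrite !horner_edge //.
have [|h _] := generic0 iD jD nij.
  move=> h q0; case/eqP: h; rewrite -[RHS]q0; apply: eq_ray => // k.
  by rewrite /upd; case: eqP.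
apply: h => k; rewrite !inE negb_or => /andP[ke _].
by rewrite /upd (negPf ke).
Qed.

(** If the edge i k vanished, genericity would make its Rayleigh difference vanish on the whole
    slice, in particular its u^2 coefficient under translation by u at j. With N_ik = 0 that
    coefficient is |N_ij|^2 |N_jk|^2. So every class is a clique, and each vertex is adjacent to its
    root. *)
Lemma edge_trans i j k : i \in D -> j \in D -> k \in D -> i != j -> j != k -> i != k ->
  edge i j != 0 -> edge j k != 0 -> edge i k != 0.
Proof.
move=> iD jD kD nij njk nik qij qjk; apply/negP => /eqP qik.
have slice0 z : (forall l, l \notin e |: D -> z l = 0) -> ray a i k (fun _ => 1) z = 0.
  have [|h] := generic0 iD kD nik; last exact: h.
  have := horner_edge 0 iD kD nik; rewrite qik horner0 => h /eqP[].
  by rewrite h; apply: eq_ray => // l; rewrite /upd; case: eqP.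
have lam : (minor_line set0).[0] = 1 by rewrite horner_minor_line mul0r addr0.
have [|N hN eN] := @realize_at 0; first by rewrite lam oner_eq0.
have {}eN S : S \subset D -> S != set0 -> principal_minor N S = (a S)%:C%C.
  by move=> SD S0; rewrite eN // lam expr1n mulr1 horner_minor_line mul0r addr0.
have ne0 (S : {set 'I_n}) l : l \in S -> S != set0 by move=> lS; apply/set0Pn; exists l.
have e1 l : l \in D -> N l l = (a [set l])%:C%C.
  by move=> lD; rewrite -principal_minor1 eN ?sub1D // (ne0 _ l) ?inE.
have e2 l m : l \in D -> m \in D -> l != m ->
    N l l * N m m - N l m * N m l = (a [set l; m])%:C%C.
  by move=> lD mD nlm; rewrite -principal_minor2 // eN ?sub2D // (ne0 _ l) ?inE ?eqxx.
have e3 := principal_minor3 N nij nik njk.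
rewrite eN ?sub3D // in e3; last by rewrite (ne0 _ i) // !inE eqxx.
have x_ik : N i k * N k i = 0.
  have /eqP : (edge i k).[0] = 0 by rewrite qik horner0.
  rewrite horner_edgeE lam mul1r !horner_minor_line !mul0r !addr0 => /eqP h.
  have := e2 i k iD kD nik; rewrite !e1 // => h2.
  have : (a [set i] * a [set k] - a [set i; k])%:C%C = 0 :> R[i] by rewrite h.
  by rewrite rmorphB rmorphM /= -h2 => <-; ring.
have Nik : N i k = 0.
  move: x_ik; move/hermsymmxP: hN => hN; rewrite (hN k i) => /eqP.
  by rewrite mulf_eq0 conjc_eq0 orbb => /eqP.
have Nki : N k i = 0 by move/hermsymmxP: hN => ->; rewrite Nik conjc0.
have coef2 : a [set i; j] * a [set j; k] - a [set j] * a [set i; j; k] = 0.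
  have H u : (a [set i] + u * a [set i; j]) * (a [set k] + u * a [set j; k])
      - (1 + u * a [set j]) * (a [set i; k] + u * a [set i; j; k]) = 0.
    have <- := slice0 (upd (fun _ => 0) j u).
      have -> : ray a i k (fun _ => 1) (upd (fun _ => 0) j u) =
          ray (trans a (upd (fun _ => 0) j u)) i k (fun _ => 1) (fun _ => 0).
        by rewrite ray_trans //; apply: eq_ray => l //; rewrite addr0.
      have ji : j \notin [set i] by rewrite inE eq_sym.
      have jk : j \notin [set k] by rewrite inE.
      have jik : j \notin [set i; k] by rewrite !inE negb_or eq_sym nij njk.
      have j0 : j \notin set0 by rewrite inE.
      rewrite -ray_standard // (trans_upd _ _ ji) (trans_upd _ _ jk) (trans_upd _ _ jik) (trans_upd _ _ j0).
      rewrite setU0 a0 [j |: [set i]]setUC.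
      by have -> : j |: [set i; k] = [set i; j; k] by rewrite setUA [j |: [set i]]setUC.
    by move=> l; rewrite !inE /upd => h; case: eqP => // e'; rewrite e' jD orbT in h.
  have := H 0; have := H 1; have := H (-1).
  by move=> h1 h2 h3; nra.
have : (a [set i; j] * a [set j; k] - a [set j] * a [set i; j; k])%:C%C = 0 :> R[i].
  by rewrite coef2.
rewrite rmorphB !rmorphM /= e3 -!e2 // -!e1 // Nik Nki => h.
have : (N i j * N j i) * (N j k * N k j) = 0.
  by rewrite -[RHS]h; ring.
have x0 l m : l \in D -> m \in D -> l != m -> edge l m != 0 -> N l m * N m l != 0.
  move=> lD mD nlm /(edge_neq0 lD mD nlm); apply: contraNneq => x0.
  rewrite horner_edgeE lam mul1r !horner_minor_line !mul0r !addr0.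
  have := e2 l m lD mD nlm; rewrite x0 subr0 !e1 // -rmorphM => /complexI ->.
  by rewrite subrr.
by apply/eqP/mulf_neq0; apply: x0.
Qed.

Definition linked i j := (i == j) || [&& i \in D, j \in D & edge i j != 0].

Lemma linked_sym i j : linked i j = linked j i.
Proof. by rewrite /linked eq_sym edgeC andbCA. Qed.

Lemma linked_trans i j k : linked i j -> linked j k -> linked i k.
Proof.
rewrite /linked; have [->//|nij] := eqVneq i j; have [->//|njk] := eqVneq j k.
  by move=> /= ->; rewrite orbT.
have [//|nik] := eqVneq i k => /= /and3P[iD jD qij] /and3P[_ kD qjk].
by rewrite iD kD; exact: (edge_trans iD jD kD).
Qed.

Definition rho i := odflt i [pick j | linked i j].

Lemma linked_rho i : linked i (rho i).
Proof. by rewrite /rho; case: pickP => [j //|/(_ i)]; rewrite /linked eqxx. Qed.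

Lemma linked_rho_eq i j : linked i j -> rho i = rho j.
Proof.
move=> eij; rewrite /rho.
have -> : [pick k | linked i k] = [pick k | linked j k].
  apply: eq_pick => k; apply/idP/idP; last exact: linked_trans.
  by apply: linked_trans; rewrite linked_sym.
case: pickP => [//|/(_ j)]; by rewrite /linked eqxx.
Qed.

Lemma rhoK i : rho (rho i) = rho i.
Proof. by apply/esym/linked_rho_eq/linked_rho. Qed.

Lemma rhoD i : i != rho i -> [/\ i \in D, rho i \in D & edge (rho i) i != 0].
Proof.
have := linked_rho i; rewrite /linked => /orP[/eqP <-|]; first by rewrite eqxx.
by rewrite edgeC => /and3P[-> -> ->].
Qed.

Local Notation C := (R[i]).
Local Notation cp := (map_poly (real_complex R)).

Lemma star_real p : star (cp p) = cp p.
Proof. by apply/polyP => k; rewrite !coef_map /= oppr0. Qed.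

Lemma horner_real p t : (cp p).[(t%:C)%C] = (p.[t])%:C%C.
Proof. exact: horner_map. Qed.

Definition norm_at i : {poly C} := if i == rho i then 1 else cp (edge (rho i) i).

Lemma star_norm_at i : star (norm_at i) = norm_at i.
Proof. by rewrite /norm_at; case: ifP => _; rewrite ?star_real // /star rmorph1. Qed.

Lemma norm_at_neq0 i : norm_at i != 0.
Proof.
rewrite /norm_at; case: ifPn => [_|/rhoD[_ _ q0]]; first exact: oner_neq0.
by rewrite map_poly_eq0.
Qed.

Lemma size_edge i j : (size (edge i j) <= 3)%N.
Proof.
have H S : (size (minor_line S) <= 2)%N by exact: size_lin.
by apply: size_sub_leq; apply: (@size_mul_leq _ _ _ 1 1).
Qed.

Lemma norm_at_factor : exists l : 'I_n -> {poly C}, forall i,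
  [/\ (size (l i) <= 2)%N, l i * star (l i) = norm_at i & i = rho i -> l i = 1].
Proof.
apply: (@fin_all_exists _ (fun=> {poly C}) (fun i l =>
  [/\ (size l <= 2)%N, l * star l = norm_at i & i = rho i -> l = 1])) => i.
rewrite /norm_at; have [e'|ne] := eqVneq i (rho i).
  by exists 1; rewrite size_poly1 /star rmorph1 mulr1.
have [iD rD _] := rhoD ne.
have [|l [sl el]] := nonneg_quadratic (size_edge (rho i) i).
  by move=> t; apply: edge_ge0; rewrite // eq_sym.
by exists l; split=> // /eqP; rewrite (negPf ne).
Qed.

Definition generic_pair i j :=
  [&& i \in D, j \in D, rho i == rho j, i != j, i != rho i & j != rho j].

Lemma imag_part : exists s : 'I_n * 'I_n -> {poly R}, forall p,
  generic_pair p.1 p.2 -> forall t, let k := rho p.1 in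
    4%:R * ((edge k p.1).[t] * (edge p.1 p.2).[t] * (edge k p.2).[t]) - (triangle k p.1 p.2).[t] ^+ 2 =
    ((minor_line set0).[t] * (s p).[t]) ^+ 2.
Proof.
apply: (@fin_all_exists _ (fun=> {poly R}) (fun p s => generic_pair p.1 p.2 ->
  forall t, let k := rho p.1 in
    4%:R * ((edge k p.1).[t] * (edge p.1 p.2).[t] * (edge k p.2).[t]) - (triangle k p.1 p.2).[t] ^+ 2 =
    ((minor_line set0).[t] * s.[t]) ^+ 2)) => -[i j] /=; have [g|_] := boolP (generic_pair i j); last by exists 0.
have /and5P[iD jD /eqP rij nij /andP[ni nj]] := g.
have [_ kD _] := rhoD ni.
have [||s es] := triangle_square kD iD jD _ _ nij; first by rewrite eq_sym.
  by rewrite rij eq_sym.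
by exists s.
Qed.

Section Signs.
Variable s : 'I_n * 'I_n -> {poly R}.
Hypothesis s_triangle : forall p, generic_pair p.1 p.2 -> forall t, let k := rho p.1 in
    4%:R * ((edge k p.1).[t] * (edge p.1 p.2).[t] * (edge k p.2).[t]) - (triangle k p.1 p.2).[t] ^+ 2 =
    ((minor_line set0).[t] * (s p).[t]) ^+ 2.
Implicit Types (eps : {ffun 'I_n * 'I_n -> bool}).

(** Exchanging i and j conjugates the entry, so one sign per unordered pair is stored, at the
    increasing pair. *)
Definition signed_imag eps (i j : 'I_n) : {poly R} :=
  if (i < j)%N then (-1) ^+ eps (i, j) * s (i, j) else - ((-1) ^+ eps (j, i) * s (j, i)).

Lemma signed_imag_anti eps i j : i != j -> signed_imag eps j i = - signed_imag eps i j.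
Proof. by rewrite -val_eqE /signed_imag; case: ltngtP => //= _ _; rewrite opprK. Qed.

(* At a point t, this is to be w_i * N i j * w_j^* where N is the matrix of
   [realize_at], w_i = N (rho i) i if i is not a root and 1 if it is. The moduli and
   the real parts of these products are polynomial in the minors; only the signs
   [eps] of the imaginary parts remain to be chosen. *)
Definition entry eps i j : {poly C} :=
  if ~~ [&& i \in D, j \in D & rho i == rho j] then 0
  else if i == j then cp (minor_line [set i]) * norm_at i
  else if i == rho i then norm_at j
  else if j == rho j then norm_at i
  else (2%:R^-1)%:P * (cp (triangle (rho i) i j) + ('i%C)%:P * cp (minor_line set0 * signed_imag eps i j)).

Lemma entry_star eps i j : entry eps j i = star (entry eps i j).
Proof.
rewrite /entry andbCA [rho j == _]eq_sym.
case: ifPn => [_|]; first by rewrite /star rmorph0.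
rewrite negbK => /and3P[_ _ /eqP rij].
have [->|nij] := eqVneq i j; first by rewrite starM star_real star_norm_at.
rewrite -rij.
have [e1|n1] := eqVneq i (rho i); have [e2|n2] := eqVneq j (rho i).
- by move: nij; rewrite e1 e2 eqxx.
- by rewrite star_norm_at.
- by rewrite star_norm_at.
have starC (c : C) : star c%:P = (c^*%C)%:P by rewrite /star map_polyC.
have starD (p q : {poly C}) : star (p + q) = star p + star q by rewrite /star rmorphD.
rewrite starM starD [star (_ * cp (_ * signed_imag _ _ _))]starM !star_real !starC.
have cpN p : cp (- p) = - cp p by rewrite rmorphN.
rewrite -triangleC signed_imag_anti // mulrN cpN mulrN.
have -> : ('i%C : C)^*%C = - 'i%C by apply/eqP; rewrite eq_complex /= oppr0 !eqxx.
have -> : ((2%:R^-1 : C)^*)%C = 2%:R^-1 by rewrite fmorphV rmorph_nat.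
by rewrite polyCN mulNr.
Qed.

Definition target (S : {set 'I_n}) : {poly C} :=
  (\prod_(i in S) norm_at i) * cp (minor_line S * minor_line set0 ^+ #|S|.-1).

Lemma entry_minors_at t : (minor_line set0).[t] != 0 -> exists eps,
  forall S, S \subset D -> S != set0 ->
    (principal_minor (\matrix_(i, j) entry eps i j) S).[(t%:C)%C] = (target S).[(t%:C)%C].
Proof.
move=> lam0; have [N hN eN] := realize_at lam0.
have {}hN : forall i j, N i j = (N j i)^*%C by apply/hermsymmxP.
have ne0 (S : {set 'I_n}) l : l \in S -> S != set0 by move=> lS; apply/set0Pn; exists l.
have F1 i : i \in D -> N i i = (minor_line [set i]).[t]%:C%C.
  by move=> iD; rewrite -principal_minor1 eN ?sub1D ?(ne0 _ i) ?inE // cards1 expr0 mulr1.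
have F2 i j : i \in D -> j \in D -> i != j -> N i j * N j i = (edge i j).[t]%:C%C.
  move=> iD jD nij; have := principal_minor2 N nij.
  rewrite eN ?sub2D ?(ne0 _ i) ?inE ?eqxx // cards2 nij expr1 !F1 // horner_edgeE => h.
  rewrite rmorphB !rmorphM; rewrite rmorphM in h.
  by rewrite [X in _ = _ - X]mulrC h; ring.
have F3 k i j : k \in D -> i \in D -> j \in D -> k != i -> k != j -> i != j ->
    N k i * N i j * N j k + N k j * N j i * N i k = (triangle k i j).[t]%:C%C.
  move=> kD iD jD nki nkj nij; have := principal_minor3 N nki nkj nij.
  have c3 : #|[set k; i; j]| = 3%N.
    by rewrite setUC cardsU1 !inE negb_or ![j == _]eq_sym nkj nij cards2 nki.
  rewrite eN ?sub3D ?(ne0 _ k) ?inE ?eqxx // c3 /=.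
  have -> : (triangle k i j).[t] = (minor_line [set k; i; j]).[t] * (minor_line set0).[t] ^+ 2
     - (minor_line [set k]).[t] * (minor_line [set i]).[t] * (minor_line [set j]).[t]
     + (minor_line [set k]).[t] * (edge i j).[t] + (minor_line [set i]).[t] * (edge k j).[t]
     + (minor_line [set j]).[t] * (edge k i).[t].
    rewrite /triangle; move: (edge i j) (edge k j) (edge k i) => q1 q2 q3.
    by rewrite !(hornerD, hornerN, horner_exp, hornerM); ring.
  rewrite !rmorphD rmorphN !rmorphM /= => ->.
  by rewrite -!F1 // -!F2 //; ring.
pose T i j := N (rho i) i * N i j * N j (rho i).
(* T i j and its conjugate have prescribed sum and product, hence a difference with prescribed
   square; eps records which of the two square roots occurs. *)
pose eps := [ffun p : 'I_n * 'I_n => T p.1 p.2 - (T p.1 p.2)^*%C !=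
   'i%C * ((minor_line set0).[t] * (s p).[t])%:C%C].
have TJ i j : rho i = rho j -> (T i j)^*%C = T j i.
  by move=> rij; rewrite /T !rmorphM /= -!hN rij; ring.
have T_eps i j : generic_pair i j ->
    T i j - (T i j)^*%C = (-1) ^+ eps (i, j) * ('i%C * ((minor_line set0).[t] * (s (i, j)).[t])%:C%C).
  move=> g; rewrite /eps ffunE /=; case: eqP => [->|/eqP ne]; first by rewrite expr0 mul1r.
  have /and5P[iD jD /eqP rij nij /andP[ni nj]] := g.
  have [_ kD _] := rhoD ni.
  have nki : rho i != i by rewrite eq_sym.
  have nkj : rho i != j by rewrite rij eq_sym.
  have e1 : T i j + (T i j)^*%C = (triangle (rho i) i j).[t]%:C%C.
    by rewrite TJ // -F3 // /T rij.
  have e2 : T i j * (T i j)^*%C =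
      ((edge (rho i) i).[t] * (edge i j).[t] * (edge (rho i) j).[t])%:C%C.
    rewrite TJ // !rmorphM /= -!F2 // /T -rij; ring.
  have e3 := s_triangle (p := (i, j)) g t; rewrite /= in e3.
  have e4 : (T i j - (T i j)^*%C) ^+ 2 = ('i%C * ((minor_line set0).[t] * (s (i, j)).[t])%:C%C) ^+ 2.
    rewrite exprMn sqr_i -rmorphXn -e3; move: e1 e2; move: ((T i j)^*%C) => u e1 e2.
    rewrite rmorphB [X in _ * (X - _)]rmorphM [X in _ * (_ - X)]rmorphXn rmorph_nat /= -e1 -e2.
    by ring.
  move/eqP: e4; rewrite eqf_sqr (negPf ne) /= => /eqP ->.
  by rewrite expr1 mulN1r.
pose w i : C := if i == rho i then 1 else N (rho i) i.
have normE i : w i * (w i)^*%C = (norm_at i).[(t%:C)%C].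
  rewrite /w /norm_at; case: ifPn => [_|ni]; first by rewrite conjc1 mulr1 hornerC.
  have [iD rD _] := rhoD ni.
  by rewrite -hN F2 ?horner_real // eq_sym.
exists eps => S SD S0.
have entryE : {in D &, forall i j, (entry eps i j).[(t%:C)%C] = w i * N i j * (w j)^*%C}.
  move=> i j iD jD; rewrite /entry iD jD /=; have [rij|nrij] /= := eqVneq (rho i) (rho j); last first.
    rewrite horner0; suff -> : N i j = 0 by rewrite mulr0 mul0r.
    have nij : i != j by apply: contraNneq nrij => ->.
    have q0 : edge i j = 0.
      apply/eqP/negPn/negP => q0; case/eqP: nrij; apply: linked_rho_eq.
      by rewrite /linked iD jD q0 orbT.
    have := F2 i j iD jD nij; rewrite q0 horner0 (hN j i) => /eqP.
    by rewrite mulf_eq0 conjc_eq0 orbb => /eqP.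
  have [<-|nij] := eqVneq i j.
    by rewrite hornerM horner_real -F1 // -normE; ring.
  rewrite -rij; have [e1|n1] := eqVneq i (rho i).
    by rewrite /w {1}e1 eqxx mul1r -normE /w -rij -e1 eq_sym (negPf nij).
  have [e2|n2] := eqVneq j (rho i).
    rewrite -normE /w -rij (negPf n1) -e2 eqxx conjc1 mulr1 e2.
    by rewrite [N i (rho i)]hN.
  rewrite !hornerM hornerD !hornerM !hornerC !horner_real hornerM.
  have g : generic_pair i j by rewrite /generic_pair iD jD rij eqxx nij -rij n1 n2.
  have gj : generic_pair j i.
    by rewrite /generic_pair iD jD rij eqxx eq_sym nij -rij n1 n2.
  have e3 : 'i%C * ((minor_line set0).[t] * (signed_imag eps i j).[t])%:C%C = T i j - (T i j)^*%C.
    have sg (b : bool) (p : {poly R}) : ((-1) ^+ b * p).[t]%:C%C = (-1) ^+ b * (p.[t]%:C)%C :> C.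
      by case: b; rewrite ?expr0 ?expr1 ?mul1r // !mulN1r hornerN rmorphN.
    have cM (x y : R) : (x * y)%:C%C = x%:C%C * y%:C%C :> C by rewrite rmorphM.
    have cN (x : R) : (- x)%:C%C = - x%:C%C :> C by rewrite rmorphN.
    rewrite cM /signed_imag; case: ltnP => ij.
      rewrite T_eps // sg cM [X in _ * X = _]mulrCA; exact: mulrCA.
    rewrite -[T i j]TJ // conjcK -opprB T_eps // hornerN cN sg cM !mulrN.
    rewrite [X in - (_ * X) = _]mulrCA; congr (- _); exact: mulrCA.
  have [_ kD _] := rhoD n1.
  have nki : rho i != i by rewrite eq_sym.
  have nkj : rho i != j by rewrite eq_sym.
  rewrite e3 -F3 // -[N (rho i) i * _ * _]/(T i j).
  have -> : N (rho i) j * N j i * N i (rho i) = (T i j)^*%C by rewrite TJ // /T rij.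
  move: ((T i j)^*%C) => u; have -> : T i j + u + (T i j - u) = 2%:R * T i j by ring.
  rewrite mulKf ?pnatr_eq0 //.
  by rewrite /w -rij (negPf n1) (negPf n2) -hN.
transitivity (principal_minor (\matrix_(i, j) (w i * N i j * (w j)^*%C)) S).
  rewrite /principal_minor -[LHS]/(horner_eval _ _) -det_map_mx; congr determinant.
  by apply/matrixP => i j; rewrite !mxE; apply: entryE; apply: (subsetP SD); exact: enum_valP.
rewrite (principal_minor_scale w (fun j => (w j)^*%C)) eN //.
rewrite /target hornerM horner_real hornerM horner_exp; congr (_ * _).
by rewrite horner_prod; apply: eq_bigr => i _; rewrite normE.
Qed.

(* The choice of signs may depend on the point t; as there are finitely many of
   them, one is right at infinitely many points, hence identically. *)
Lemma entry_minors : exists eps, forall S, S \subset D -> S != set0 ->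
  principal_minor (\matrix_(i, j) entry eps i j) S = target S.
Proof.
pose good eps := [forall S : {set 'I_n}, (S \subset D) && (S != set0) ==>
   (principal_minor (\matrix_(i, j) entry eps i j) S == target S)].
have [/existsP[eps /forallP h]|] := boolP [exists eps, good eps].
  by exists eps => S SD S0; have := h S; rewrite SD S0 => /eqP.
rewrite negb_exists => /forallP h; exfalso.
pose diff eps S := principal_minor (\matrix_(i, j) entry eps i j) S - target S.
have [f hf] : exists f : {ffun 'I_n * 'I_n -> bool} -> {set 'I_n}, forall eps,
    [/\ f eps \subset D, f eps != set0 & diff eps (f eps) != 0].
  apply: (@fin_all_exists _ (fun=> {set 'I_n}) (fun eps S =>
    [/\ S \subset D, S != set0 & diff eps S != 0])) => eps; have := h eps; rewrite negb_forall => /existsP[S].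
  by rewrite negb_imply => /andP[/andP[SD S0] ne]; exists S; rewrite /diff subr_eq0.
have minor_line0 : minor_line set0 != 0.
  apply: contraTneq isT => e'; have := horner_minor_line set0 0.
  by rewrite e' horner0 mul0r addr0 a0 => /esym/eqP; rewrite oner_eq0.
pose Q := cp (minor_line set0) * \prod_eps diff eps (f eps).
have Q0 : Q != 0.
  rewrite mulf_neq0 ?map_poly_eq0 //; apply/prodf_neq0 => eps _.
  by case: (hf eps).
have [t] := poly_nonroot Q0.
have -> : (t%:R : C) = ((t%:R : R)%:C)%C by rewrite rmorph_nat.
rewrite hornerM mulf_eq0 negb_or horner_real horner_prod => /andP[lam0 /prodf_neq0 hQ].
have [|eps heps] := @entry_minors_at t%:R; first by apply: contraNneq lam0 => ->.
have [fD f0 _] := hf eps.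
by have := hQ eps isT; rewrite /diff hornerD hornerN heps // subrr eqxx.
Qed.

End Signs.

(** The entries are divided by w_i w_j^*, which [orientation] makes exact; the norms then cancel
    from the minors. *)
Lemma pencil_kernel : exists N : 'M[{poly C}]_n,
  (forall i j, N j i = star (N i j)) /\
  forall S, S \subset D -> S != set0 ->
    principal_minor N S = cp (minor_line S * minor_line set0 ^+ #|S|.-1).
Proof.
have [l lP] := norm_at_factor.
have [s s_triangle] := imag_part.
have [eps minors] := entry_minors s_triangle.
have lE i : l i * star (l i) = norm_at i by case: (lP i).
have l0 i : l i != 0.
  by apply: contraNneq (norm_at_neq0 i) => e'; rewrite -lE e' mul0r.
have sl i : (size (l i) <= 2)%N by case: (lP i).
have P_rho i j : entry s eps i j != 0 -> rho i = rho j.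
  by rewrite /entry; case: ifPn => [_|]; rewrite ?eqxx // negbK => /and3P[_ _ /eqP].
have P_root i : i != rho i -> entry s eps i (rho i) = l i * star (l i).
  move=> ni; have [iD rD _] := rhoD ni.
  by rewrite lE /entry iD rD rhoK eqxx (negPf ni).
have l_root i : l (rho i) = 1 by case: (lP (rho i)) => _ _; apply; rewrite rhoK.
have det_minors m (c : 'I_m -> 'I_n) : injective c ->
    \prod_r (l (c r) * star (l (c r))) %| \det (\matrix_(r, q) entry s eps (c r) (c q)).
  move=> inj_c; pose S := [set c r | r : 'I_m].
  have -> : \det (\matrix_(r, q) entry s eps (c r) (c q)) =
      principal_minor (\matrix_(i, j) entry s eps i j) S.
    rewrite -det_mxsub_image //; congr determinant.
    by apply/matrixP => r q; rewrite !mxE.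
  have [SD|/subsetPn[i iS niD]] := boolP (S \subset D); last first.
    rewrite (principal_minor_row0 iS) ?dvdp0 // => j.
    by rewrite mxE /entry (negPf niD).
  have -> : \prod_r (l (c r) * star (l (c r))) = \prod_(i in S) norm_at i.
    rewrite big_imset /=; last by move=> ? ? _ _; exact: inj_c.
    by apply: eq_bigr => r _; rewrite lE.
  have [->|S0] := eqVneq S set0; first by rewrite big_set0 dvd1p.
  by rewrite minors // /target dvdp_mulr.
have [w [normE wP]] := orientation (entry_star s eps) l0 sl P_rho P_root l_root det_minors.
have w0 i : w i * star (w i) != 0 by rewrite normE lE norm_at_neq0.
have wd i j : w i * star (w j) != 0.
  have := w0 i; have := w0 j; rewrite !mulf_eq0 !negb_or.
  by move=> /andP[_ ->] /andP[-> _].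
pose N := \matrix_(i, j) (entry s eps i j %/ (w i * star (w j))).
have NE i j : entry s eps i j = w i * N i j * star (w j).
  by rewrite mxE mulrAC mulrC divpK.
exists N; split=> [i j|S SD S0].
  apply: (mulfI (wd j i)); have := entry_star s eps i j; rewrite !NE !starM starK => h.
  by rewrite mulrAC h; ring.
have P0 : \prod_(i in S) norm_at i != 0 by apply/prodf_neq0 => i _; exact: norm_at_neq0.
apply: (mulfI P0); rewrite -/(target S) -(minors S SD S0).
have -> : \matrix_(i, j) entry s eps i j = \matrix_(i, j) (w i * N i j * star (w j)).
  by apply/matrixP => i j; rewrite [LHS]mxE [RHS]mxE NE.
rewrite (principal_minor_scale w (fun j => star (w j))); congr (_ * _).
by apply: eq_bigr => i _; rewrite normE lE.
Qed.

End Pencil.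

(** * The bordered matrix *)

Section Border.
Variables (R : rcfType) (n : nat).
Implicit Types (S : {set 'I_n}).
Variables (a : {set 'I_n} -> R) (D : {set 'I_n}) (e : 'I_n).
Hypothesis a0 : a set0 = 1.
Hypothesis a_nonneg : rayleigh_nonneg a.
Hypothesis eD : e \notin D.
Local Notation C := (R[i]).
Local Notation cp := (map_poly (real_complex R)).
Local Notation minor_line := (minor_line a e).

Variable N : 'M[{poly C}]_n.
Hypothesis N_star : forall i j, N j i = star (N i j).
Hypothesis N_minor : forall S, S \subset D -> S != set0 ->
    principal_minor N S = cp (minor_line S * minor_line set0 ^+ #|S|.-1).
Hypothesis ae : a [set e] != 0.

Let H i j : C := (N i j)`_0.
Let L i j : C := (N i j)`_1.
Let al : C := (a [set e])%:C%C.
(** For a bordered matrix with corner al and column v, [rank_one_update] requires (1 + t al) H - t v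
    v^* = H + t L, that is v v^* = al H - L. *)
Let B i j := al * H i j - L i j.

Let ne0 (S : {set 'I_n}) l : l \in S -> S != set0.
Proof. by move=> lS; apply/set0Pn; exists l. Qed.

Let N1 i : i \in D -> N i i = cp (minor_line [set i]).
Proof.
by move=> iD; rewrite -principal_minor1 N_minor ?sub1set ?(@ne0 _ i) ?inE // cards1 expr0 mulr1.
Qed.

Let N2 i j : i \in D -> j \in D -> i != j ->
  N i i * N j j - N i j * N j i = cp (minor_line [set i; j] * minor_line set0).
Proof.
move=> iD jD nij; rewrite -principal_minor2 // N_minor ?(@ne0 _ i) ?inE ?eqxx //.
  by rewrite cards2 nij expr1.
by rewrite subUset !sub1set iD.
Qed.

Let N3 i j k : i \in D -> j \in D -> k \in D -> i != j -> i != k -> j != k ->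
  N i i * (N j j * N k k - N j k * N k j) - N i j * (N j i * N k k - N j k * N k i)
    + N i k * (N j i * N k j - N j j * N k i) = cp (minor_line [set i; j; k] * minor_line set0 ^+ 2).
Proof.
move=> iD jD kD nij nik njk; have := principal_minor3 N nij nik njk.
have c3 : #|[set i; j; k]| = 3%N.
  by rewrite setUC cardsU1 !inE negb_or ![k == _]eq_sym nik njk cards2 nij.
rewrite N_minor ?(@ne0 _ i) ?inE ?eqxx //; last by rewrite !subUset !sub1set iD jD.
rewrite c3 /= => h; rewrite -[RHS]addr0.
move: h; set X := cp _ => h.
have -> : X = X - N i i * N j j * N k k + N i i * (N j k * N k j) + N j j * (N i k * N k i) + N k k * (N i j * N j i)
  + (N i i * N j j * N k k - N i i * (N j k * N k j) - N j j * (N i k * N k i) - N k k * (N i j * N j i)) by ring.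
rewrite -h; ring.
Qed.

(** Off the diagonal, N_ij times its star is an edge polynomial, of degree at most two, and both
    factors have the same degree. *)
Let size_N i j : i \in D -> j \in D -> (size (N i j) <= 2)%N.
Proof.
move=> iD jD; have [<-|nij] := eqVneq i j.
  rewrite N1 // size_map_poly; exact: size_lin.
have e2 : N i j * N j i = cp (edge a e i j).
  have := N2 iD jD nij; rewrite !N1 // /edge rmorphB !rmorphM /= => h.
  by rewrite [X in _ - X]mulrC -h; ring.
have [->|N0] := eqVneq (N i j) 0; first by rewrite size_poly0.
have := size_edge a e i j; rewrite -(size_map_poly (real_complex R)) -e2 (N_star i j).
rewrite size_mul ?star_eq0 //. rewrite size_star; move: (size _) => m. case: m => [|[|[|m]]]; lia.
Qed.

Let NE i j t : i \in D -> j \in D -> (N i j).[t] = H i j + t * L i j.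
Proof.
move=> iD jD; rewrite (horner_coef_wide _ (size_N iD jD)) !big_ord_recl big_ord0 /=.
by rewrite expr0 expr1 mulr1 addr0 mulrC.
Qed.

(* At the root [tstar] of [minor_line set0] all the minors of N of order at least
   two vanish, so that N has rank one there; this provides the new row. *)
Let tstar : R := - (a [set e])^-1.

Let horner_tstar p : (cp p).[tstar%:C%C] = (p.[tstar])%:C%C.
Proof. exact: horner_map. Qed.

Let minor_line0_tstar : (minor_line set0).[tstar] = 0.
Proof. by rewrite horner_minor_line setU0 a0 /tstar mulNr mulVf // subrr. Qed.

Let BE i j : i \in D -> j \in D -> B i j = al * (N i j).[tstar%:C%C].
Proof.
move=> iD jD; rewrite NE // /B mulrDr mulrA.
have -> : al * tstar%:C%C = -1.
  by rewrite /al -rmorphM /tstar mulrN divff // rmorphN1.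
by rewrite mulN1r.
Qed.

Let B_star i j : B j i = (B i j)^*%C.
Proof.
rewrite /B /H /L N_star /star !coef_map rmorphB rmorphM.
by congr (_ * _ - _); exact/esym/conjc_real.
Qed.

(** The diagonal entry is the Rayleigh difference a_i a_e - a_ie at the origin. *)
Let B_ge0 i : i \in D -> 0 <= B i i.
Proof.
move=> iD; have nie : i != e by apply: contraNneq eD => <-.
rewrite BE // N1 // horner_tstar horner_minor_line /al -rmorphM ler0c.
have -> : a [set e] * (a [set i] + tstar * a (e |: [set i])) =
    a [set i] * a [set e] - a set0 * a [set i; e].
  by rewrite /tstar a0 setUC mulrDr mulrA mulrN divff //; ring.
by rewrite ray_standard //; exact: a_nonneg.
Qed.

Let B_rank_one : exists v : 'I_n -> C, {in D &, forall i j, B i j = v i * (v j)^*%C}.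
Proof.
apply: hermitian_rank_one B_star B_ge0 _ _ => [i j iD jD nij|i j k iD jD kD nij nik njk].
  have := congr1 (fun p => al ^+ 2 * p.[tstar%:C%C]) (N2 iD jD nij).
  rewrite horner_tstar [(_ * minor_line set0).[_]]hornerM minor_line0_tstar mulr0 [_ * 0%:C%C]mulr0 => <-.
  rewrite !BE // !(hornerD, hornerN, hornerM); ring.
have := congr1 (fun p => al ^+ 3 * p.[tstar%:C%C]) (N3 iD jD kD nij nik njk).
rewrite horner_tstar [(_ * minor_line set0 ^+ 2).[_]]hornerM horner_exp minor_line0_tstar expr0n mulr0.
rewrite [_ * 0%:C%C]mulr0 => <-.
rewrite !BE // !(hornerD, hornerN, hornerM); ring.
Qed.

Lemma realizable_border : realizable (e |: D) a.
Proof.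
have [v vE] := B_rank_one.
pose u i : C := if i \in D then v i else 0.
pose M : 'M[C]_n := \matrix_(i, j)
  if i == e then (if j == e then al else (u j)^*%C)
  else if j == e then u i else if (i \in D) && (j \in D) then H i j else 0.
have H_star i j : H j i = (H i j)^*%C by rewrite /H N_star coef_map.
have hM : M \is hermsymmx.
  apply/hermsymmxP => i j; rewrite !mxE; case: eqP => _; case: eqP => _.
  - by rewrite /al conjc_real.
  - by [].
  - by rewrite conjcK.
  by rewrite andbC; case: ifP => _; rewrite ?conjc0 // H_star.
have Mee : M e e = al by rewrite mxE eqxx.
(* Both sides are affine in t, so the minors with and without e will be read off at t = 0 and at one
   nonzero t. *)
have key (t : R) S : 1 + t * a [set e] != 0 -> S \subset D ->
    principal_minor M S + t%:C%C * principal_minor M (e |: S) = ((minor_line S).[t])%:C%C.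
  move=> lam0 SD; pose lam : C := 1 + t%:C%C * al.
  have lamE : lam = (1 + t * a [set e])%:C%C by rewrite rmorphD rmorphM rmorph1.
  have lam0' : lam != 0 by rewrite lamE fmorph_eq0.
  have lam_alp : lam = ((minor_line set0).[t])%:C%C by rewrite horner_minor_line a0 setU0.
  have eS : e \notin S by apply: contra eD; exact: (subsetP SD).
  rewrite rank_one_update ?Mee // -/lam.
  have [->|S0] := eqVneq S set0; first by rewrite principal_minor0 mulr1 lam_alp.
  pose Nt : 'M[C]_n := \matrix_(i, j) (N i j).[t%:C%C].
  have -> : principal_minor (\matrix_(i, j) (M i j - t%:C%C / lam * M i e * M e j)) S =
      principal_minor (\matrix_(i, j) (lam^-1 * Nt i j * 1)) S.
    apply: principal_minor_eq => i j iS jS.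
    have iD := subsetP SD _ iS; have jD := subsetP SD _ jS.
    have nie : i != e by apply: contraNneq eS => <-.
    have nje : j != e by apply: contraNneq eS => <-.
    rewrite !mxE eqxx (negPf nie) (negPf nje) iD jD /= NE // mulr1.
    have -> : t%:C%C / lam * u i * (u j)^*%C = t%:C%C / lam * (al * H i j - L i j).
      by rewrite -/(B i j) vE // /u iD jD mulrA.
    by move: lam0'; rewrite /lam => lam0'; field.
  rewrite (principal_minor_scale (fun _ => lam^-1) (fun _ => 1)) prodr_const mulr1.
  have -> : principal_minor Nt S = (principal_minor N S).[t%:C%C].
    rewrite /principal_minor -[RHS]/(horner_eval _ _) -det_map_mx; congr determinant.
    by apply/matrixP => i j; rewrite !mxE.
  rewrite N_minor // [in LHS]horner_map /= hornerM horner_exp rmorphM rmorphXn /= -lam_alp.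
  have -> : #|S| = #|S|.-1.+1 by rewrite prednK // card_gt0.
  have z0 : lam ^+ #|S|.-1 != 0 by rewrite expf_neq0.
  rewrite /= exprVn exprS; move: (lam ^+ _) ((minor_line S).[t]%:C)%C z0 => z x z0.
  by clearbody lam; field; rewrite z0.
have key0 S : S \subset D -> principal_minor M S = (a S)%:C%C.
  move=> SD; have := key 0 S _ SD; rewrite mul0r addr0 oner_eq0 => /(_ isT).
  by rewrite mul0r addr0 horner_minor_line mul0r addr0.
have [t t0 lam0] : exists2 t : R, t != 0 & 1 + t * a [set e] != 0.
  have [e'|ne] := eqVneq (a [set e]) (-1); last first.
    by exists 1; rewrite ?oner_eq0 // mul1r addrC -[1]opprK subr_eq0.
  by exists (-1); rewrite ?oppr_eq0 ?oner_eq0 // e' mulrNN mulr1 -mulr2n pnatr_eq0.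
exists M; split=> // S SD.
have [eS|eS] := boolP (e \in S); last first.
  apply: key0; apply/subsetP => i iS; have := subsetP SD _ iS.
  by rewrite !inE => /orP[/eqP e'|//]; rewrite -e' iS in eS.
have S'D : S :\ e \subset D by rewrite subDset.
have := key t _ lam0 S'D; rewrite key0 // setD1K // horner_minor_line setD1K // => h.
apply: (@mulfI _ (t%:C%C)); first by rewrite fmorph_eq0.
move: h; rewrite rmorphD rmorphM => /addrI; exact.
Qed.

End Border.

(** * Induction on the index set *)

Section Realization.
Variables (R : rcfType) (n : nat).
Implicit Types (a b : {set 'I_n} -> R) (D S : {set 'I_n}).

Lemma trans_set0 a y : trans a y set0 = mform a (fun _ => 1) y.
Proof.
rewrite -[LHS]mform_set mform_trans; apply: eq_mform => i; rewrite inE //=.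
by rewrite mulr1 addr0.
Qed.

Lemma trans_set1 a y e :
  trans a y [set e] = mform a (upd (fun _ => 1) e 0) (upd y e 1).
Proof.
rewrite -[LHS]mform_set mform_trans.
by apply: eq_mform => i; rewrite inE /upd; case: eqP => //= _; rewrite ?mulr0 ?add0r ?mulr1 ?addr0.
Qed.

(** At the indicator of S the form is the sum of a (e |: T) over the subsets T of S; the proper ones
    vanish by induction. *)
Lemma partial_slice_eq0 a D e : e \notin D ->
  (forall z, (forall i, i \notin e |: D -> z i = 0) ->
     mform a (upd (fun _ => 1) e 0) (upd z e 1) = 0) ->
  forall S, S \subset D -> a (e |: S) = 0.
Proof.
move=> eD a0 S; have [m] := ubnP #|S|; elim: m S => // m IH S lt_m SD.
have eS : e \notin S by apply: contra eD; exact: (subsetP SD).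
rewrite -[RHS](a0 (fun i => (i \in S)%:R)) => [|i]; last first.
  by rewrite !inE negb_or => /andP[_ iD]; rewrite (contraNF (subsetP SD i) iD).
rewrite /mform (bigD1 (e |: S)) //= [X in _ + X]big1 ?addr0 => [|T neT].
  rewrite big1 ?mulr1 // => i _; rewrite !inE /upd.
  by case: eqP => //= _; case: (i \in S).
have [eT|eT] := boolP (e \in T); last first.
  by rewrite (bigD1 e) //= (negPf eT) /upd eqxx mul0r mulr0.
have [TS|/subsetPn[i iT niS]] := boolP (T :\ e \subset S); last first.
  move: iT; rewrite !inE => /andP[ie iT].
  by rewrite (bigD1 i) //= iT /upd (negPf ie) (negPf niS) mul0r mulr0.
rewrite -(setD1K eT) IH ?mul0r //; last exact: subset_trans SD.
apply: leq_trans (_ : #|S| <= m)%N; last by rewrite -ltnS.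
apply: proper_card; rewrite properEneq TS andbT.
by apply: contraNneq neT => <-; rewrite setD1K.
Qed.

Lemma realizable_zero_border a D e : e \notin D -> realizable D a ->
  (forall S, S \subset D -> a (e |: S) = 0) -> realizable (e |: D) a.
Proof.
move=> eD [M [hM eM]] ae.
exists (\matrix_(i, j) if (i == e) || (j == e) then 0 else M i j); split.
  apply/hermsymmxP => i j; rewrite !mxE orbC; case: ifP => _; first by rewrite conjc0.
  by move/hermsymmxP: hM => ->.
move=> S SD; have [eS|eS] := boolP (e \in S).
  rewrite (principal_minor_row0 eS) => [|j]; last by rewrite mxE eqxx.
  by rewrite -(setD1K eS) ae // subDset.
have SD' : S \subset D.
  apply/subsetP => i iS; have := subsetP SD _ iS.
  by rewrite !inE => /orP[/eqP e'|//]; rewrite -e' iS in eS.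
rewrite -eM //; apply: principal_minor_eq => i j iS jS; rewrite mxE.
have ne k : k \in S -> (k == e) = false by move=> kS; apply: contraNF eS => /eqP <-.
by rewrite !ne.
Qed.

(** The induction is over all vectors at once, as the hypothesis is applied to normalized translates
    of a at varying t. *)
Lemma good_realizable D a : a set0 = 1 -> rayleigh_nonneg a ->
  hyperdet_neg_squares a -> realizable D a.
Proof.
have [m] := ubnP #|D|; elim: m D a => // m IH D' a lt_m a0 a1 a2.
have [D0|[e eD']] := set_0Vmem D'.
  exists 0; split; first by apply/hermsymmxP => i j; rewrite !mxE conjc0.
  by move=> S; rewrite D0 subset0 => /eqP ->; rewrite principal_minor0 a0.
pose D := D' :\ e; have eD : e \notin D by rewrite !inE eqxx.
have IHD b : b set0 = 1 -> rayleigh_nonneg b -> hyperdet_neg_squares b -> realizable D b.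
  by apply: IH; rewrite -ltnS; apply: leq_trans lt_m; rewrite ltnS [X in (_ < X)%N](cardsD1 e) eD'.
rewrite -(setD1K eD') -/D.
(* If the coefficient of {e} vanishes for all translates in the slice, no line in direction e has a
   point where 1 + t a_e = 0. Then a vanishes on the subsets of e |: D that contain e, and a zero
   row and column suffice. *)
have [c [cD F0 ray_c [dF|dF]]] := generic_point (e |: D) e a0; last first.
  by apply: (realizable_zero_border eD (IHD a a0 a1 a2)); exact: partial_slice_eq0 dF.
apply: (realizable_shift a0 cD F0); set F := mform a _ c in F0 *.
set b := fun S => F^-1 * trans a c S.
have b0 : b set0 = 1 by rewrite /b trans_set0 mulVf.
have b1 : rayleigh_nonneg b by exact/rayleigh_nonneg_scale/rayleigh_nonneg_trans.
have b2 : hyperdet_neg_squares b.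
  exact/hyperdet_neg_squares_scale/hyperdet_neg_squares_trans.
have ray_b i j z : i != j -> ray b i j (fun _ => 1) z =
    F^-1 ^+ 2 * ray a i j (fun _ => 1) (fun k => c k + z k).
  by move=> nij; rewrite /b ray_scale ray_trans.
have generic_b : {in D &, forall i j, i != j -> ray b i j (fun _ => 1) (fun _ => 0) != 0 \/
    forall z, (forall i, i \notin e |: D -> z i = 0) -> ray b i j (fun _ => 1) z = 0}.
  move=> i j _ _ nij; have [h|h] := ray_c i j; [left|right=> z zD].
    rewrite ray_b // mulf_neq0 ?expf_neq0 ?invr_eq0 //.
    by apply: contraNneq h => <-; apply/eqP/eq_ray => // k; rewrite addr0.
  by rewrite ray_b // h ?mulr0 // => k kD; rewrite cD // zD // addr0.
have [N [N_star N_minor]] := pencil_kernel b0 b1 b2 eD IHD generic_b.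
apply: (realizable_border b0 b1 eD N_star N_minor).
by rewrite /b trans_set1 mulf_neq0 ?invr_eq0.
Qed.

End Realization.

Theorem corollary7p13 (R : realType) (n : nat) (a : {set 'I_n} -> R)
    (ha : a set0 = 1) :
  (exists A : 'M[R[i]]_n,
     A \is hermsymmx /\
     forall S : {set 'I_n}, principal_minor A S = (a S)%:C%C)
  <->
  (forall (g : 'I_n -> 'M[R]_2) (s : 'S_n),
     (forall i : 'I_n, \det (g i) = 1) ->
     let a' := vec_act g s a in
     [/\ forall i1 i2 : 'I_n, i1 = 0%N :> nat -> i2 = 1%N :> nat ->
           a' [set i1] * a' [set i2] - a' set0 * a' [set i1; i2] >= 0,
         forall i1 i2 i3 : 'I_n,
           i1 = 0%N :> nat -> i2 = 1%N :> nat -> i3 = 2%N :> nat ->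
           HypDet i1 i2 i3 a' <= 0
       & forall i1 i2 i3 i4 : 'I_n,
           i1 = 0%N :> nat -> i2 = 1%N :> nat -> i3 = 2%N :> nat ->
           i4 = 3%N :> nat ->
           let h := discr i3 (rayleigh i1 i2 (fpoly a')) in
           [/\ restrict_first 4 (Bpoly i4 h) = 0,
               restrict_first 4 (Cpoly i4 h) = 0
             & restrict_first 4 (Dpoly i4 h) = 0]]).
Proof.
split=> [[A [hA eA]] g s dg a'|conds]; last first.
  have [a1 a2] := conditions_good conds.
  have [A [hA eA]] := good_realizable setT ha a1 a2.
  by exists A; split=> // S; rewrite eA ?subsetT.
have [h1 h2 h3] := minors_conditions hA eA s dg.
have ne (i j : 'I_n) k l : i = k :> nat -> j = l :> nat -> k != l -> i != j.
  by move=> ei ej; rewrite -val_eqE /= ei ej.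
split=> [i1 i2 e1 e2|i1 i2 i3 e1 e2 e3|i1 i2 i3 i4 e1 e2 e3 e4 h].
- by rewrite ray_standard; [apply: h1|]; exact: ne e1 e2 _.
- rewrite HypDetE; [apply: h2| | |]; first [exact: ne e1 e2 _ | exact: ne e1 e3 _ | exact: ne e2 e3 _].
have [] := h3 i1 i2 i3 i4 (ne _ _ _ _ e1 e2 isT) (ne _ _ _ _ e1 e3 isT)
  (ne _ _ _ _ e2 e3 isT) (ne _ _ _ _ e1 e4 isT) (ne _ _ _ _ e2 e4 isT) (ne _ _ _ _ e3 e4 isT).
by rewrite -/h => -> -> ->; rewrite restrict_first0.
Qed.
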